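(* Let $\alpha$ be a finite, positive Borel measure on $[-1,1]$, absolutely continuous with respect to the Lebesgue measure $\lambda_1$, and let $N$ be a positive integer. Let $D\subset\mathbb{C}$, $D\neq\mathbb{C}$, be a simply connected domain, symmetric with respect to the real axis, with $[-1,1]\subset D$. Put $L=1/4$; if $D$ is additionally convex, one may take $L=1/2$. Then $$J_+(D;N)\geq \sup_{\varepsilon>0}\left\{\left(\frac{\exp\left(\frac{2L\varepsilon}{\delta_D}\right)-1}{\exp\left(\frac{2L\varepsilon}{\delta_D}\right)+1}\right)^{2N}\bigl(\alpha([-1,1])-\omega(2N\varepsilon,\alpha)\bigr)\right\},$$ where $\omega(\delta,\alpha):=\sup\{\alpha(A): A\subset[-1,1]\text{ is a Borel subset},\ \lambda_1(A)\leq\delta\}$. Moreover, $$\lim_{\delta_D\to 0}J_+(D;N)=\alpha([-1,1]),$$ i.e. (with $\alpha$ and $N$ fixed) for every $\eta>0$ there is $\delta_0>0$ such that $|J_+(D;N)-\alpha([-1,1])|<\eta$ for every simply connected domain $D\subset\mathbb{C}$, $D\neq\mathbb{C}$, symmetric with respect to the real axis, with $[-1,1]\subset D$ and $\delta_D<\delta_0$.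
   Context: A domain is an open connected set. $\delta_D(x):=\inf\{|x-z|:z\in\mathbb{C}\setminus D\}$ and $\delta_D:=\sup\{\delta_D(x):x\in[-1,1]\}$. $\mathbb{D}$ is the open unit disk and $\mathcal{O}(D,\mathbb{D})$ is the set of holomorphic functions from $D$ to $\mathbb{D}$. For $X=(x_1,\dots,x_n)$ with $-1\le x_1<\dots<x_n\le 1$ and positive integers $\mathcal{K}=(k_1,\dots,k_n)$, let $\mathcal{F}_+(D;X;\mathcal{K})$ be the set of all $f\in\mathcal{O}(D,\mathbb{D})$ such that $f^{(l)}(x_j)=0$ for $l=0,\dots,k_j-1$, $j=1,\dots,n$, and $f$ is real-valued with $f\ge 0$ on $D\cap\mathbb{R}$. Define $$J_+(D;X;\mathcal{K}):=\sup\left\{\left|\int_{-1}^1 g(x)\,d\alpha(x)\right|: g\in\mathcal{F}_+(D;X;\mathcal{K})\right\},$$ $$J_+(D;N):=\inf\{J_+(D;(x_1,\dots,x_n);(k_1,\dots,k_n)): n\in\mathbb{N},\ n\ge 1,\ -1\le x_1<\dots<x_n\le 1,\ k_1+\dots+k_n=N\},$$ where the $k_j$ are positive integers. *)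

(* Defs.v *)
From HB Require Import structures.
From mathcomp Require Import all_boot all_order all_algebra.
From mathcomp Require Import all_classical all_reals all_analysis.
From mathcomp.real_closed Require Import complex.

Set Implicit Arguments.
Unset Strict Implicit.
Unset Printing Implicit Defensive.

Import Order.TTheory GRing.Theory Num.Theory numFieldNormedType.Exports.

Local Open Scope complex_scope.
Local Open Scope ring_scope.
Local Open Scope classical_set_scope.

(* The usual topology of the complex plane, with [R[i]] as a normed module over
   itself: [derivable f z 1] is complex differentiability at [z] and [f^`(l)]
   is the l-th complex derivative. *)
HB.instance Definition _ (R : rcfType) := PseudoPointedMetric.copy R[i] (R[i])^o.
HB.instance Definition _ (R : rcfType) := GRing.ComAlgebra.copy R[i] (R[i])^o.
HB.instance Definition _ (R : rcfType) := Vector.copy R[i] (R[i])^o.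
HB.instance Definition _ (R : rcfType) := NormedModule.copy R[i] (R[i])^o.

Definition segment11 (R : realType) : set R := `[-1, 1].

Definition domain (R : realType) (D : set R[i]) : Prop :=
  open D /\ connected D.

(* Every loop in [D] based at [g 0] is homotopic in [D], with fixed base point,
   to a constant loop; in [H (s, t)], [s] is the deformation parameter. *)
Definition loops_contractible (R : realType) (D : set R[i]) : Prop :=
  forall g : R -> R[i],
    {within `[0, 1], continuous g} ->
    (forall t, 0 <= t <= 1 -> D (g t)) ->
    g 0 = g 1 ->
    exists H : R * R -> R[i],
      [/\ {within `[0, 1] `*` `[0, 1], continuous H},
          (forall s t, 0 <= s <= 1 -> 0 <= t <= 1 -> D (H (s, t))),
          (forall t, 0 <= t <= 1 -> H (0, t) = g t),
          (forall t, 0 <= t <= 1 -> H (1, t) = g 0)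
        & (forall s, 0 <= s <= 1 -> H (s, 0) = g 0 /\ H (s, 1) = g 0)].

Definition simply_connected_domain (R : realType) (D : set R[i]) : Prop :=
  domain D /\ loops_contractible D.

Definition symmetric_real_axis (R : realType) (D : set R[i]) : Prop :=
  forall z, D z -> D z^*.

Definition admissible (R : realType) (D : set R[i]) : Prop :=
  [/\ simply_connected_domain D,
      D <> setT,
      symmetric_real_axis D
    & forall x : R, segment11 x -> D x%:C].

(* [inf] and [sup] are real-valued; the sets below are nonempty and bounded when
   [D] is not the whole plane. *)
Definition dist_compl (R : realType) (D : set R[i]) (x : R) : R :=
  inf [set complex.Re `|x%:C - z| | z in ~` D].

Definition deltaD (R : realType) (D : set R[i]) : R :=
  sup [set dist_compl D x | x in @segment11 R].

(* Functions are total; only the values on [D] are constrained, and as [D] is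
   open the derivatives at points of [D] depend only on these values. *)
Definition holo_to_disk (R : realType) (D : set R[i]) (f : R[i] -> R[i]) : Prop :=
  forall z, D z -> derivable f z 1 /\ `|f z| < 1.

(* The order of [R[i]] makes [0 <= w] mean that [w] is real and nonnegative. *)
Definition F_plus (R : realType) (D : set R[i]) (n : nat) (X : 'I_n -> R)
    (K : 'I_n -> nat) : set (R[i] -> R[i]) :=
  [set f | [/\ holo_to_disk D f,
               (forall (j : 'I_n) (l : nat), (l < K j)%N -> f^`(l) (X j)%:C = 0)
             & (forall x : R, D x%:C -> 0 <= f x%:C)]].

(* A measure on [-1, 1] is given by its extension by zero to the real line. The
   functions of [F_plus] are real-valued on [-1, 1], so that integrating the real
   part is integrating the function. *)
Definition J_plus_XK (R : realType)
    (alpha : {finite_measure set (measurableTypeR R) -> \bar R})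
    (D : set R[i]) (n : nat) (X : 'I_n -> R) (K : 'I_n -> nat) : \bar R :=
  ereal_sup [set (`| \int[alpha]_(x in @segment11 R) (complex.Re (g x%:C))%:E |)%E
            | g in F_plus D X K].

Definition node_data (R : realType) (N n : nat) (X : 'I_n -> R)
    (K : 'I_n -> nat) : Prop :=
  [/\ (0 < n)%N,
      (forall j, -1 <= X j <= 1),
      (forall i j : 'I_n, (i < j)%N -> X i < X j),
      (forall j, (0 < K j)%N)
    & (\sum_(j < n) K j)%N = N].

Definition J_plus (R : realType)
    (alpha : {finite_measure set (measurableTypeR R) -> \bar R})
    (D : set R[i]) (N : nat) : \bar R :=
  ereal_inf [set J | exists (n : nat) (X : 'I_n -> R) (K : 'I_n -> nat),
                       node_data N X K /\ J = J_plus_XK alpha D X K].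

Definition omega (R : realType) (d : R)
    (alpha : {finite_measure set (measurableTypeR R) -> \bar R}) : \bar R :=
  ereal_sup [set alpha A | A in [set A : set (measurableTypeR R) |
    [/\ measurable A, A `<=` @segment11 R & (lebesgue_measure A <= d%:E)%E]]].

Definition lower_bound (R : realType)
    (alpha : {finite_measure set (measurableTypeR R) -> \bar R})
    (D : set R[i]) (N : nat) (L : R) : \bar R :=
  ereal_sup [set
    ((((expR (2 * L * eps / deltaD D) - 1) / (expR (2 * L * eps / deltaD D) + 1))
       ^+ (2 * N))%:E
     * (alpha (@segment11 R) - omega (2 * N%:R * eps) alpha))%E
    | eps in [set eps : R | 0 < eps]].

(* Main.v *)
Require Import Defs.
From HB Require Import structures.
From mathcomp Require Import all_boot all_order all_algebra.
From mathcomp Require Import all_classical all_reals all_analysis.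
From mathcomp.real_closed Require Import complex.
From mathcomp Require Import ring lra.

(** Say that two points p and q of D are c-separated if holomorphic maps of D
into the unit disk that vanish at p take at q values of modulus arbitrarily
close to c, or larger. The theorem reduces to one geometric fact: points x and
y of [-1, 1] are T-separated, where T = tanh (L |x - y| / delta_D), that is,
(exp u - 1) / (exp u + 1) for u = 2 L |x - y| / delta_D ([sep_admissible]).

From separation to integrals. For each node choose a map f_j that vanishes there
and is, up to a factor r < 1, as large as possible at every other point. The
product g of the powers (f_j(w) * conj (f_j(conj w)))^(k_j) is holomorphic by the
symmetry of D, has the required zeros, and equals the product of the
|f_j|^(2 k_j) >= 0 on the real axis ([test_function]). Off the
intervals of radius eps about the nodes, g >= (r T)^(2N) with |x - y| = eps in
T; these intervals have total length at most 2 N eps, so that they carry at most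
omega(2 N eps) of the mass, and r tends to 1 ([J_plus_ge]). For the limit, absolute
continuity makes omega(2 N eps) small for a suitable eps, after which T tends to 1
with delta_D; conversely |g| < 1 bounds J_+ by the total mass.

Nearly extremal maps. A nonvanishing holomorphic function on D has a holomorphic
square root: continue the root along paths and compare two continuations by
means of a homotopy, over whose square a root exists by subdivision
([exists_root]). Consider the injective maps f of D into the disk with f(y) = 0.
If f omits a value a, then composing with Blaschke factors and a square root
multiplies |f'(y)| by (1 + |a|) / (2 sqrt |a|) ([uniformizer_step]). Hence a map
with |f'(y)| close to its supremum takes all values of modulus at most r, the set
|f| <= r is compact, and the maximum principle applied to powers of g / f gives
r |g| <= |f| for every competitor g: one map f is nearly extremal at all points
of D simultaneously ([near_extremal]).

Addition. Let f = (w - y) f1 be nearly extremal at a real point y. The function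
F = (w - y) sqrt (f1(w) * conj (f1(conj w))) maps D into the disk, and on the real
axis it is real, has modulus |f| and changes sign at y. A Blaschke factor
then turns separation a of x, y and b of y, z, where x < y < z, into
separation (a + b) / (1 + a b) of x and z ([sep_add]), which is the addition
law of tanh.

Local estimate. Let w be a point outside D nearest to t. Symmetry and simple
connectedness make the map z - Re w + sqrt ((z - w) (z - conj w)), or z - w up to
sign if w is real, well defined from D to the plane without the negative axis;
with the principal root and a Cayley transform this separates t from t + h by
about h / (4 |t - w|) ([sep_local]). In a convex domain the half-plane bounded by
a supporting line at w gives h / (2 |t - w|) ([sep_local_convex]). Cutting the
segment from x to y into many equal pieces and adding, the local estimates
become tanh (L |x - y| / delta_D) in the limit ([sep_seg]).

The test functions arise from polynomials by field operations, reflections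
w |-> conj (f (conj w)) and square roots, all of which preserve existence of
complex derivatives of all orders ([smooth]). *)

Set Implicit Arguments.
Unset Strict Implicit.
Unset Printing Implicit Defensive.

Import Order.TTheory GRing.Theory Num.Theory numFieldNormedType.Exports.

Local Open Scope complex_scope.
Local Open Scope ring_scope.
Local Open Scope classical_set_scope.

(** * The modulus of a complex number *)

Section Modulus.
Variable R : realType.
Implicit Types (z w : R[i]) (x y : R).

(** Real-valued, whereas the norm of [R[i]] takes its values in [R[i]]. *)
Definition cmod z : R := complex.Re `|z|.

Lemma normE z : `|z| = (cmod z)%:C.
Proof. by rewrite /cmod normc_def. Qed.

Lemma cmod_ge0 z : 0 <= cmod z.
Proof. by rewrite -ler0c -normE normr_ge0. Qed.

Lemma cmod0 : cmod 0 = 0.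
Proof. by rewrite /cmod normr0. Qed.

Lemma cmod1 : cmod 1 = 1.
Proof. by rewrite /cmod normr1. Qed.

Lemma cmodM z w : cmod (z * w) = cmod z * cmod w.
Proof. by apply: complexI; rewrite -normE normrM !normE rmorphM. Qed.

Lemma cmodX z n : cmod (z ^+ n) = cmod z ^+ n.
Proof. by elim: n => [|n IH]; rewrite ?expr0 ?cmod1 // !exprS cmodM IH. Qed.

Lemma cmod_eq0 z : (cmod z == 0) = (z == 0).
Proof. by rewrite -[z == 0]normr_eq0 normE -(inj_eq (@complexI R)). Qed.

Lemma cmod_gt0 z : (0 < cmod z) = (z != 0).
Proof. by rewrite lt_def cmod_ge0 cmod_eq0 andbT. Qed.

Lemma cmodV z : cmod z^-1 = (cmod z)^-1.
Proof. by apply: complexI; rewrite -normE normfV normE fmorphV. Qed.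

Lemma cmodN z : cmod (- z) = cmod z.
Proof. by rewrite /cmod normrN. Qed.

Lemma cmodB z w : cmod (z - w) = cmod (w - z).
Proof. by rewrite -cmodN opprB. Qed.

Lemma cmodD z w : cmod (z + w) <= cmod z + cmod w.
Proof. by rewrite -lecR rmorphD -!normE ler_normD. Qed.

Lemma cmod_subr z w : cmod z - cmod w <= cmod (z - w).
Proof. by rewrite lerBlDr (le_trans _ (cmodD _ _))// subrK. Qed.

Lemma cmod_real x : cmod x%:C = `|x|.
Proof. by rewrite /cmod normc_def /= expr0n addr0 sqrtr_sqr. Qed.

Lemma cmodJ z : cmod (conjc z) = cmod z.
Proof. by rewrite /cmod normcJ. Qed.

Lemma sqr_cmod z : cmod z ^+ 2 = complex.Re z ^+ 2 + complex.Im z ^+ 2.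
Proof. by apply: complexI; rewrite add_Re2_Im2 normE rmorphXn. Qed.

Lemma mulcJ z : z * conjc z = (cmod z ^+ 2)%:C.
Proof. by rewrite -sqr_normc normE rmorphXn. Qed.

Lemma Re_le_cmod z : `|complex.Re z| <= cmod z.
Proof. by rewrite -lecR -normE normc_ge_Re. Qed.

Lemma Im_le_cmod z : `|complex.Im z| <= cmod z.
Proof.
rewrite -(@ler_pXn2r _ 2) ?nnegrE ?cmod_ge0 ?normr_ge0 //.
by rewrite sqr_cmod real_normK ?num_real // lerDr sqr_ge0.
Qed.

Lemma cmod_le_ReIm z : cmod z <= `|complex.Re z| + `|complex.Im z|.
Proof.
rewrite -(@ler_pXn2r _ 2) ?nnegrE ?cmod_ge0 ?addr_ge0 ?normr_ge0 //.
rewrite sqr_cmod sqrrD !real_normK ?num_real // -addrA lerD2l lerDr.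
by rewrite mulrn_wge0 // mulr_ge0.
Qed.

Lemma norm_lt_real z x : (`|z| < x%:C) = (cmod z < x).
Proof. by rewrite normE ltcR. Qed.

Lemma gt0_realC (e : R[i]) : 0 < e -> exists2 x, 0 < x & e = x%:C.
Proof.
case: e => a b; rewrite ltcE /= => /andP[/eqP -> a0].
by exists a.
Qed.

Lemma ReM z w : complex.Re (z * w) =
  complex.Re z * complex.Re w - complex.Im z * complex.Im w.
Proof. by case: z w => [a b] [c d]. Qed.

Lemma ReD z w : complex.Re (z + w) = complex.Re z + complex.Re w.
Proof. by case: z w => [a b] [c d]. Qed.
Lemma ReN z : complex.Re (- z) = - complex.Re z.
Proof. by case: z => [a b]. Qed.
Lemma ImD z w : complex.Im (z + w) = complex.Im z + complex.Im w.
Proof. by case: z w => [a b] [c d]. Qed.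
Lemma ImN z : complex.Im (- z) = - complex.Im z.
Proof. by case: z => [a b]. Qed.

End Modulus.

(** * Continuity and compactness in the plane *)

Section Topology.
Variable R : realType.
Implicit Types (z w : R[i]) (x y e d : R).

Lemma nbhs_cmodP z (A : set R[i]) :
  nbhs z A <-> exists2 d, 0 < d & forall w, cmod (w - z) < d -> A w.
Proof.
split.
  move=> /nbhs_ballP[_ /= /gt0_realC[d d0 ->]] h; exists d => // w wz.
  by apply: h; rewrite -ball_normE /= -normrN opprB norm_lt_real.
case=> d d0 h; apply/nbhs_ballP; exists d%:C => /=; first by rewrite ltcR.
by move=> w; rewrite -ball_normE /= -normrN opprB norm_lt_real => /h.
Qed.

Lemma continuousC_P (T : topologicalType) (f : T -> R[i]) (t : T) :
  {for t, continuous f} <->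
  forall e, 0 < e -> \forall s \near t, cmod (f s - f t) < e.
Proof.
split=> [h e e0|h].
  by apply: (h [set w | cmod (w - f t) < e]); apply/nbhs_cmodP; exists e.
by move=> A /nbhs_cmodP[d d0 hd]; apply: filterS (h d d0) => s /hd.
Qed.

Lemma continuousCC_P (f : R[i] -> R[i]) z :
  {for z, continuous f} <->
  forall e, 0 < e -> exists2 d, 0 < d & forall w, cmod (w - z) < d ->
    cmod (f w - f z) < e.
Proof.
rewrite continuousC_P; split=> h e e0; have := h e e0.
  by move/nbhs_cmodP.
by move=> hd; apply/nbhs_cmodP.
Qed.

Lemma lip_continuousCR (f : R[i] -> R) :
  (forall z w, `|f z - f w| <= cmod (z - w)) -> continuous f.
Proof.
move=> lip z; apply: (proj2 (@cvgrPdist_lt _ _ _ (nbhs z) _ f (f z))) => e e0.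
apply/nbhs_cmodP; exists e => // w.
by move=> h; rewrite (le_lt_trans (lip _ _)) // cmodB.
Qed.

Lemma continuous_Re : continuous (@complex.Re R).
Proof. by apply: lip_continuousCR => z w; rewrite -ReN -ReD Re_le_cmod. Qed.

Lemma continuous_cmod : continuous (@cmod R).
Proof.
apply: lip_continuousCR => z w; rewrite ler_norml lerNl opprB.
by rewrite !(le_trans (cmod_subr _ _)) // cmodB.
Qed.

Lemma continuous_real_complex : continuous (fun x : R => x%:C : R[i]).
Proof.
move=> x; apply/continuousC_P => e e0.
near=> y; rewrite -rmorphB cmod_real distrC.
by near: y; exact: cvgr_dist_lt.
Unshelve. all: by end_near. Qed.

Lemma continuous_complexP (T : topologicalType) (f : T -> R[i]) (t : T) :
  {for t, continuous (fun s => complex.Re (f s))} ->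
  {for t, continuous (fun s => complex.Im (f s))} ->
  {for t, continuous f}.
Proof.
move=> /cvgrPdist_lt hr /cvgrPdist_lt hi; apply/continuousC_P => e e0.
near=> s; apply: le_lt_trans (cmod_le_ReIm _) _.
rewrite ReD ReN ImD ImN [e]splitr ltrD // distrC.
  by near: s; apply: hr; rewrite divr_gt0.
by near: s; apply: hi; rewrite divr_gt0.
Unshelve. all: by end_near. Qed.

Lemma continuous_conj : continuous (@conjc R : R[i] -> R[i]).
Proof.
move=> z; apply/continuousCC_P => e e0; exists e => // w.
by rewrite -[_ - _ in X in _ -> X](rmorphB (@conjc R)) cmodJ.
Qed.

Lemma compact_rect (a b c d : R) :
  compact [set z : R[i] | a <= complex.Re z <= b /\ c <= complex.Im z <= d].
Proof.
have -> : [set z : R[i] | a <= complex.Re z <= b /\ c <= complex.Im z <= d] =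
   (fun p : R * R => (p.1 +i* p.2 : R[i])) @` (`[a, b] `*` `[c, d]).
  apply/seteqP; split=> [z [h1 h2]|_ [p [h1 h2] <-]] /=.
    by exists (complex.Re z, complex.Im z); [rewrite /= !in_itv|case: (z)].
  by move: h1 h2; rewrite /= !in_itv.
apply: continuous_compact; last exact: compact_setX (@segment_compact R _ _) (@segment_compact R _ _).
apply: continuous_subspaceT => p; apply: continuous_complexP => /=; [exact: cvg_fst|exact: cvg_snd].
Qed.

Section ContOps.
Variables (T : topologicalType).
Implicit Types (t : T) (f g : T -> R[i]).

(** Continuity at a point, as a record around the epsilon form, so that
unification does not unfold it to filter inclusions. *)
Record ccont f t : Prop := Ccont {
  ccontE : forall e, 0 < e -> \forall s \near t, cmod (f s - f t) < e }.

Lemma ccontP f t : ccont f t <-> {for t, continuous f}.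
Proof.
by split=> [[/continuousC_P]|/continuousC_P] // h; constructor.
Qed.

Lemma ccont_cst (c : R[i]) t : ccont (fun=> c) t.
Proof. by apply/ccontP; exact: (@cvg_cst R[i] c T (nbhs t)). Qed.

Lemma ccontD f g t : ccont f t -> ccont g t -> ccont (fun s => f s + g s) t.
Proof. rewrite !ccontP; exact: (@cvgD _ R[i]). Qed.

Lemma ccontN f t : ccont f t -> ccont (fun s => - f s) t.
Proof. rewrite !ccontP; exact: (@cvgN _ R[i]). Qed.

Lemma ccontM f g t : ccont f t -> ccont g t -> ccont (fun s => f s * g s) t.
Proof. rewrite !ccontP; exact: (@cvgM R[i]). Qed.

Lemma ccontV f t : f t != 0 -> ccont f t -> ccont (fun s => (f s)^-1) t.
Proof. move=> f0; rewrite !ccontP => h; exact: (@cvgV R[i] T (nbhs t) _ f (f t)). Qed.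

Lemma ccontX f n t : ccont f t -> ccont (fun s => f s ^+ n) t.
Proof.
move=> cf; elim: n => [|n IH]; first exact: ccont_cst.
have -> : (fun s => f s ^+ n.+1) = (fun s => f s * f s ^+ n).
  by apply/funext => s; rewrite exprS.
exact: ccontM.
Qed.

Lemma ccont_near f g t : (\forall s \near t, f s = g s) -> ccont f t -> ccont g t.
Proof.
move=> fg [cf]; constructor=> e e0.
have ft : f t = g t by exact: nbhs_singleton fg.
by apply: filterS2 fg (cf e e0) => s <-; rewrite -ft.
Qed.
End ContOps.

Lemma ccont_ballP (f : R[i] -> R[i]) z : ccont f z <->
  forall e, 0 < e -> exists2 d, 0 < d & forall w, cmod (w - z) < d ->
    cmod (f w - f z) < e.
Proof. by rewrite ccontP continuousCC_P. Qed.

Lemma ccont_comp (T : topologicalType) (f : T -> R[i]) (g : R[i] -> R[i]) (t : T) :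
  ccont f t -> ccont g (f t) -> ccont (fun s => g (f s)) t.
Proof.
move=> [cf] /ccont_ballP cg; constructor=> e e0.
have [d d0 hd] := cg e e0.
by apply: filterS (cf d d0) => s /hd.
Qed.

Lemma ccont_id z : ccont id z.
Proof. by apply/ccont_ballP => e e0; exists e. Qed.

Lemma ccont_conj z : ccont (@conjc R : R[i] -> R[i]) z.
Proof. by apply/ccontP; exact: continuous_conj. Qed.

Lemma closed_cball z r : closed [set w : R[i] | cmod (w - z) <= r].
Proof.
have -> : [set w : R[i] | cmod (w - z) <= r] =
   (fun w => cmod (w - z)) @^-1` [set x | x <= r] by [].
apply: preimage_closed; last exact: closed_le.
move=> w _; apply: (@continuous_comp _ _ _ (fun w => w - z) (@cmod R)); last exact: continuous_cmod.
by apply/ccontP; apply: ccontD; [exact: ccont_id|exact: ccont_cst].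
Qed.

Lemma compact_cball z r : compact [set w : R[i] | cmod (w - z) <= r].
Proof.
apply: (@subclosed_compact _ _ [set w : R[i] |
  complex.Re z - r <= complex.Re w <= complex.Re z + r /\
  complex.Im z - r <= complex.Im w <= complex.Im z + r]).
- exact: closed_cball.
- exact: compact_rect.
- move=> w /= h; split; rewrite lerBlDr -lerBlDl.
    have := le_trans (Re_le_cmod _) h; rewrite ReD ReN ler_norml => /andP[? ?].
    by apply/andP; split; lra.
  have := le_trans (Im_le_cmod _) h; rewrite ImD ImN ler_norml => /andP[? ?].
  by apply/andP; split; lra.
Qed.

Lemma compact_sup_attained (K : set R[i]) (f : R[i] -> R) :
  compact K -> K !=set0 -> {within K, continuous f} ->
  exists2 z, K z & forall w, K w -> f w <= f z.
Proof.
move=> cK K0 fc; have [z Kz h] := compact_EVT_max K0 cK fc.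
by exists z; [exact: set_mem|move=> w Kw; apply: h; exact: mem_set].
Qed.

Lemma compact_inf_attained (K : set R[i]) (f : R[i] -> R) :
  compact K -> K !=set0 -> {within K, continuous f} ->
  exists2 z, K z & forall w, K w -> f z <= f w.
Proof.
move=> cK K0 fc; have [z Kz h] := compact_EVT_min K0 cK fc.
by exists z; [exact: set_mem|move=> w Kw; apply: h; exact: mem_set].
Qed.
End Topology.

(** * Complex derivatives of all orders *)

Section Derivative.
Variable R : realType.
Implicit Types (f g q : R[i] -> R[i]) (z w a b : R[i]) (D : set R[i]).

(** Caratheodory's form of complex differentiability: the slope, extended by
the derivative, is a continuous function. The differentiation rules become
algebraic identities between slopes. *)
Record hasder f z a : Prop := Hasder {
  slope : exists q, [/\ ccont q z, q z = a &
    forall w, f w - f z = q w * (w - z)] }.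

(** A slope known near [z] only extends by the difference quotient. *)
Lemma hasder_near f q z d : ccont q z -> 0 < d ->
  (forall w, cmod (w - z) < d -> f w - f z = q w * (w - z)) ->
  hasder f z (q z).
Proof.
move=> cq d0 h; constructor.
pose p w := if w == z then q z else (f w - f z) / (w - z).
have pz : p z = q z by rewrite /p eqxx.
exists p; split; first last.
- move=> w; rewrite /p; case: eqP => [->|/eqP wz]; first by rewrite !subrr mulr0.
  by rewrite divfK // subr_eq0.
- exact: pz.
- apply/ccont_ballP => e e0.
  have /ccont_ballP /(_ e e0) [c c0 hc] := cq.
  exists (Num.min c d); first by rewrite lt_min c0.
  move=> w; rewrite lt_min => /andP[wc wd]; rewrite pz.
  have [->|wz] := eqVneq w z; first by rewrite pz subrr cmod0.
  rewrite /p (negbTE wz).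
  by rewrite h // mulfK ?subr_eq0 //; exact: hc.
Qed.

Lemma hasderP f z a : hasder f z a <-> is_derive z 1 f a.
Proof.
split.
  move=> [[q [/ccontP cq qz hq]]].
  have h : (fun h : R[i] => h^-1 *: (f (h *: 1 + z) - f z)) @ 0^' --> a.
    move=> A /nbhs_cmodP[e e0 he].
    have /continuousCC_P /(_ e e0) [d d0 hd] := cq.
    apply/nbhs_cmodP; exists d; first exact: d0.
    move=> w wd /= w0; apply: he.
    rewrite hq addrK [w *: 1]mulr1 [_^-1 *: _]mulrC mulfK // -qz.
    by apply: hd; rewrite addrK -[w]subr0.
  have ch : derivable f z 1 by apply/cvg_ex; exists a; exact: h.
  apply: DeriveDef; first exact: ch.
  by apply: cvg_lim; [exact: norm_hausdorff|exact: h].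
move=> [df fa].
have h : (fun h : R[i] => h^-1 *: (f (h *: 1 + z) - f z)) @ 0^' --> a.
  by rewrite -fa; exact: df.
constructor; pose p w := if w == z then a else (f w - f z) / (w - z).
have pz : p z = a by rewrite /p eqxx.
exists p; split; first last.
- move=> w; rewrite /p; case: eqP => [->|/eqP wz]; first by rewrite !subrr mulr0.
  by rewrite divfK // subr_eq0.
- exact: pz.
- apply/ccont_ballP => e e0; rewrite pz.
  have /h : nbhs a [set w : R[i] | cmod (w - a) < e].
    by apply/nbhs_cmodP; exists e; [exact: e0|].
  move=> /nbhs_cmodP[d d0 hd]; exists d; first exact: d0.
  move=> w wd; have [->|wz] := eqVneq w z; first by rewrite pz subrr cmod0.
  rewrite /p (negbTE wz).
  have := hd (w - z); rewrite /= subr0 subr_eq0 => /(_ wd wz).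
  by rewrite [_ *: 1]mulr1 subrK [_^-1 *: _]mulrC.
Qed.

Lemma hasder_derive1 f z a : hasder f z a -> f^`() z = a.
Proof. by move=> /hasderP[_ <-]; rewrite derive1E. Qed.

Lemma derivable_hasder f z : derivable f z 1 -> hasder f z (f^`() z).
Proof. by move=> h; apply/hasderP; rewrite derive1E; exact: derivableP. Qed.

Lemma hasder_derivable f z a : hasder f z a -> derivable f z 1.
Proof. by move=> /hasderP[]. Qed.

Lemma hasder_ccont f z a : hasder f z a -> ccont f z.
Proof.
move=> [[q [cq _ hq]]].
have -> : f = (fun w => f z + q w * (w - z)).
  by apply/funext => w; rewrite -hq addrC subrK.
apply: ccontD; first exact: ccont_cst.
apply: ccontM; first exact: cq.
by apply: ccontD; [exact: ccont_id|exact: ccont_cst].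
Qed.

Lemma hasder_eq_near f g z a d : 0 < d ->
  (forall w, cmod (w - z) < d -> f w = g w) -> hasder f z a -> hasder g z a.
Proof.
move=> d0 fg [[q [cq <- hq]]].
apply: (hasder_near cq d0) => w wd; rewrite -(fg w wd) -(fg z) ?hq //.
by rewrite subrr cmod0.
Qed.

Lemma der_eq f z a b : hasder f z a -> a = b -> hasder f z b.
Proof. by move=> h <-. Qed.

Lemma der_cst a z : hasder (fun=> a) z 0.
Proof.
constructor; exists (fun=> 0); split; [exact: ccont_cst|by []|].
by move=> w; rewrite subrr mul0r.
Qed.

Lemma der_id z : hasder id z 1.
Proof.
constructor; exists (fun=> 1); split; [exact: ccont_cst|by []|].
by move=> w; rewrite mul1r.
Qed.

Lemma der_add f g z a b : hasder f z a -> hasder g z b ->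
  hasder (fun w => f w + g w) z (a + b).
Proof.
move=> [[p [cp <- hp]]] [[q [cq <- hq]]].
constructor; exists (fun w => p w + q w); split; [exact: ccontD|by []|].
by move=> w; rewrite mulrDl -hp -hq; ring.
Qed.

Lemma der_mul f g z a b : hasder f z a -> hasder g z b ->
  hasder (fun w => f w * g w) z (a * g z + f z * b).
Proof.
move=> fa gb; have cg := hasder_ccont gb.
move: fa gb => [[p [cp <- hp]]] [[q [cq <- hq]]].
constructor; exists (fun w => p w * g w + f z * q w); split; [|by []|].
  apply: ccontD; first exact: ccontM.
  by apply: ccontM; [exact: ccont_cst|].
move=> w; have -> : (p w * g w + f z * q w) * (w - z) =
   (p w * (w - z)) * g w + f z * (q w * (w - z)) by ring.
by rewrite -hp -hq; ring.
Qed.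

Lemma ccont_neq0 f z : f z != 0 -> ccont f z ->
  exists2 d, 0 < d & forall w, cmod (w - z) < d -> f w != 0.
Proof.
rewrite -cmod_gt0 => f0 /ccont_ballP/(_ _ f0)[d d0 hd]; exists d => // w /hd.
by apply: contraTneq => ->; rewrite sub0r cmodN ltxx.
Qed.

Lemma der_inv f z a : f z != 0 -> hasder f z a ->
  hasder (fun w => (f w)^-1) z (- a * (f z)^-1 * (f z)^-1).
Proof.
move=> fz0 fa; have cf := hasder_ccont fa.
have [d d0 hd] := ccont_neq0 fz0 cf.
move: fa => [[p [cp <- hp]]].
apply: (@hasder_near _ (fun w => - p w * (f w)^-1 * (f z)^-1) _ d) => //.
  apply: ccontM; last exact: ccont_cst.
  by apply: ccontM; [exact: ccontN|exact: ccontV].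
move=> w /hd fw0.
have -> : - p w / f w / f z * (w - z) = - (p w * (w - z)) / f w / f z by ring.
by rewrite -hp; field; rewrite fw0 fz0.
Qed.

(** The slope of [s] is that of [f] divided by [s w + s z], because
[f w - f z = (s w - s z) * (s w + s z)]. *)
Lemma der_sqrt f (s : R[i] -> R[i]) z a d : s z != 0 -> ccont s z -> 0 < d ->
  (forall w, cmod (w - z) < d -> s w * s w = f w) -> hasder f z a ->
  hasder s z (a * (s z + s z)^-1).
Proof.
move=> sz0 cs d0 sf [[p [cp <- hp]]].
have sz2 : s z + s z != 0 by rewrite -mulr2n -mulr_natl mulf_eq0 pnatr_eq0 negb_or.
have cs2 : ccont (fun w => s w + s z) z by apply: ccontD => //; exact: ccont_cst.
have [c c0 hc] := @ccont_neq0 (fun w => s w + s z) z sz2 cs2.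
apply: (@hasder_near _ (fun w => p w * (s w + s z)^-1) _ (Num.min c d)).
- by apply: ccontM => //; exact: ccontV.
- by rewrite lt_min c0.
- move=> w; rewrite lt_min => /andP[/hc sw wd].
  have -> : p w / (s w + s z) * (w - z) = (p w * (w - z)) / (s w + s z) by ring.
  rewrite -hp -(sf w wd) -(sf z) ?subrr ?cmod0 //.
  by field.
Qed.

Lemma der_conj f z a : hasder f (conjc z) a ->
  hasder (fun w => conjc (f (conjc w))) z (conjc a).
Proof.
move=> [[p [cp <- hp]]].
constructor; exists (fun w => conjc (p (conjc w))); split; [|by []|].
  apply: (@ccont_comp _ _ (fun w => p (conjc w))); last exact: ccont_conj.
  by apply: (@ccont_comp _ _ (@conjc R)); [exact: ccont_conj|].
move=> w; rewrite -(rmorphB (@conjc R)) hp rmorphM rmorphB.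
by rewrite /= !conjcK.
Qed.

(** The derivatives are quantified existentially, so that closure properties are
proved by exhibiting them. Order 2 serves the maximum principle, higher orders
the vanishing of iterated derivatives at the nodes. *)
Fixpoint csmooth n D f : Prop :=
  if n is m.+1 then exists2 g, (forall z, D z -> hasder f z (g z)) & csmooth m D g
  else forall z, D z -> ccont f z.

Definition smooth D f := forall n, csmooth n D f.

Lemma open_cball D z : open D -> D z ->
  exists2 d, 0 < d & forall w, cmod (w - z) < d -> D w.
Proof. by move=> oD Dz; apply/nbhs_cmodP; exact: open_nbhs_nbhs. Qed.

Lemma csmooth_ext n D f g : open D -> (forall z, D z -> f z = g z) ->
  csmooth n D f -> csmooth n D g.
Proof.
move=> oD; elim: n f g => [|n IH] f g fg /=.
  move=> h z Dz; have [d d0 hd] := open_cball oD Dz.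
  apply: (ccont_near _ (h z Dz)); apply/nbhs_cmodP; exists d => // w /hd.
  exact: fg.
move=> [f' df cf']; exists f' => // z Dz.
have [d d0 hd] := open_cball oD Dz.
by apply: (hasder_eq_near d0 _ (df z Dz)) => w /hd/fg.
Qed.

Lemma csmooth_cont n D f : csmooth n D f -> forall z, D z -> ccont f z.
Proof.
case: n => [|n] //= [g h _] z /h; exact: hasder_ccont.
Qed.

Lemma csmooth_pred n D f : csmooth n.+1 D f -> csmooth n D f.
Proof.
elim: n f => [|n IH] f; first by move=> h; exact: (csmooth_cont h).
by move=> [g h1 h2]; exists g => //; exact: IH.
Qed.

Lemma csmooth_sub n D E f : E `<=` D -> csmooth n D f -> csmooth n E f.
Proof.
move=> ED; elim: n f => [|n IH] f /=; first by move=> h z /ED/h.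
by move=> [g h1 h2]; exists g => [z /ED/h1//|]; exact: IH.
Qed.

Lemma csmooth_cst n D a : open D -> csmooth n D (fun=> a).
Proof.
move=> oD; elim: n a => [|n IH] a /=; first by move=> z _; exact: ccont_cst.
by exists (fun=> 0) => // z _; exact: der_cst.
Qed.

Lemma csmooth_id n D : open D -> csmooth n D id.
Proof.
move=> oD; case: n => [|n] /=; first by move=> z _; exact: ccont_id.
exists (fun=> 1); last exact: csmooth_cst.
by move=> z _; exact: der_id.
Qed.

Lemma csmooth_add n D f g : open D -> csmooth n D f -> csmooth n D g ->
  csmooth n D (fun w => f w + g w).
Proof.
move=> oD; elim: n f g => [|n IH] f g; first by move=> /= cf cg z Dz; apply: ccontD; auto.
move=> [f' df cf] [g' dg cg]; exists (fun z => f' z + g' z); last exact: IH.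
by move=> z Dz; apply: der_add; [exact: df|exact: dg].
Qed.

Lemma csmooth_mul n D f g : open D -> csmooth n D f -> csmooth n D g ->
  csmooth n D (fun w => f w * g w).
Proof.
move=> oD; elim: n f g => [|n IH] f g; first by move=> /= cf cg z Dz; apply: ccontM; auto.
move=> cf0 cg0; have [f' df cf] := cf0; have [g' dg cg] := cg0.
exists (fun z => f' z * g z + f z * g' z).
  by move=> z Dz; apply: der_mul; [exact: df|exact: dg].
by apply: csmooth_add => //; apply: IH => //; exact: csmooth_pred.
Qed.

Lemma csmooth_opp n D f : open D -> csmooth n D f -> csmooth n D (fun w => - f w).
Proof.
move=> oD cf; apply: (@csmooth_ext _ _ (fun w => -1 * f w)) => //.
  by move=> z _; rewrite mulN1r.
by apply: csmooth_mul => //; exact: csmooth_cst.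
Qed.

Lemma csmooth_inv n D f : open D -> (forall z, D z -> f z != 0) ->
  csmooth n D f -> csmooth n D (fun w => (f w)^-1).
Proof.
move=> oD f0; elim: n f f0 => [|n IH] f f0; first by move=> /= cf z Dz; apply: ccontV; auto.
move=> cf0; have [f' df cf] := cf0.
exists (fun z => - f' z * (f z)^-1 * (f z)^-1).
  by move=> z Dz; apply: der_inv; [exact: f0|exact: df].
have ci : csmooth n D (fun w => (f w)^-1) by apply: IH => //; exact: csmooth_pred.
by apply: csmooth_mul => //; apply: csmooth_mul => //; exact: csmooth_opp.
Qed.

Lemma csmooth_sqrt n D f s : open D -> (forall z, D z -> f z != 0) ->
  (forall z, D z -> ccont s z) ->
  (forall z, D z -> s z * s z = f z) ->
  csmooth n D f -> csmooth n D s.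
Proof.
move=> oD f0 cs sf; elim: n => [//|n IH] cf0; have [f' df cf] := cf0.
have s0 z : D z -> s z != 0.
  by move=> Dz; have := f0 z Dz; rewrite -sf // mulf_eq0 negb_or => /andP[].
exists (fun z => f' z * (s z + s z)^-1).
  move=> z Dz; have [d d0 hd] := open_cball oD Dz.
  apply: (@der_sqrt f _ _ _ d) => //; [exact: s0|exact: cs|by move=> w /hd/sf|].
  exact: df.
have cs' : csmooth n D s by apply: IH; exact: csmooth_pred.
apply: csmooth_mul => //.
apply: csmooth_inv => //; last exact: csmooth_add.
by move=> z Dz; rewrite -mulr2n -mulr_natl mulf_eq0 pnatr_eq0 negb_or s0.
Qed.

Lemma csmooth_conj n D f : open D -> (forall z, D z -> D (conjc z)) ->
  csmooth n D f -> csmooth n D (fun w => conjc (f (conjc w))).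
Proof.
move=> oD sD; elim: n f => [|n IH] f.
  move=> /= cf z Dz.
  apply: (@ccont_comp _ _ (fun w => f (conjc w))); last exact: ccont_conj.
  by apply: (@ccont_comp _ _ (@conjc R)); [exact: ccont_conj|apply: cf; exact: sD].
move=> [f' df cf]; exists (fun w => conjc (f' (conjc w))); last exact: IH.
by move=> z Dz; apply: der_conj; apply: df; exact: sD.
Qed.
End Derivative.

(** * Principal square roots, and rigidity of roots along a path *)

Section SquareRoot.
Variable R : realType.
Implicit Types (z w : R[i]) (x y t e d : R).

Lemma ccont_real (T : topologicalType) (f : T -> R) (t : T) :
  {for t, continuous f} -> ccont (fun s => (f s)%:C : R[i]) t.
Proof.
move=> cf; apply/ccontP.
apply: (@continuous_comp _ _ _ f (fun x : R => x%:C : R[i])); first exact: cf.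
exact: continuous_real_complex.
Qed.

Lemma ccont_compR (g : R -> R[i]) (u : R -> R) t :
  {for t, continuous u} -> ccont g (u t) -> ccont (fun s => g (u s)) t.
Proof.
by move=> cu /ccontP cg; apply/ccontP; exact: (@continuous_comp _ _ _ u g).
Qed.

Lemma ccont_cmod (T : topologicalType) (f : T -> R[i]) (t : T) :
  ccont f t -> {for t, continuous (fun s => cmod (f s))}.
Proof.
move=> /ccontP cf; apply: (@continuous_comp _ _ _ f (@cmod R)); first exact: cf.
exact: continuous_cmod.
Qed.

Lemma ccont_Re (T : topologicalType) (f : T -> R[i]) (t : T) :
  ccont f t -> {for t, continuous (fun s => complex.Re (f s))}.
Proof.
move=> /ccontP cf; apply: (@continuous_comp _ _ _ f (@complex.Re R)); first exact: cf.
exact: continuous_Re.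
Qed.

(** The principal square root, holomorphic off the closed negative real axis;
the inequality [0 < cmod z + Re z] below says that [z] is off this axis. *)
Definition psqrt z : R[i] :=
  (z + (cmod z)%:C) / (Num.sqrt (2 * (cmod z + complex.Re z)))%:C.

Lemma psqrtK z : 0 < cmod z + complex.Re z -> psqrt z * psqrt z = z.
Proof.
move=> h; rewrite /psqrt; set r := Num.sqrt _.
have r2 : r * r = 2 * (cmod z + complex.Re z).
  by rewrite -expr2 sqr_sqrtr // mulr_ge0 // ltW.
have r0 : r != 0.
  by apply/eqP => r0; move: r2; rewrite r0 mul0r => /eqP; rewrite eq_sym mulf_eq0 pnatr_eq0 /= gt_eqF.
have rC0 : r%:C != 0 :> R[i] by rewrite (inj_eq (@complexI R)).
have -> : (z + (cmod z)%:C) / r%:C * ((z + (cmod z)%:C) / r%:C) =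
  ((z + (cmod z)%:C) * (z + (cmod z)%:C)) / (r * r)%:C.
  by rewrite rmorphM; field.
rewrite r2; apply: (canLR (mulfK _)).
  by rewrite (inj_eq (@complexI R)) mulf_eq0 pnatr_eq0 /= gt_eqF.
have e1 : (cmod z)%:C * (cmod z)%:C = z * conjc z :> R[i] by rewrite mulcJ expr2 rmorphM.
have e2 : (2 * (cmod z + complex.Re z))%:C = 2%:R * (cmod z)%:C + (z + conjc z) :> R[i].
  by rewrite addcJ rmorphM rmorph_nat rmorphD mulrDr.
by rewrite e2 mulrDl mulrDr [X in _ + X]mulrDr e1; ring.
Qed.

Lemma Re_psqrt_gt0 z : 0 < cmod z + complex.Re z -> 0 < complex.Re (psqrt z).
Proof.
move=> h; rewrite /psqrt -fmorphV ReM /= mulr0 subr0 ReD /= addrC.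
by rewrite mulr_gt0 // invr_gt0 sqrtr_gt0 mulr_gt0.
Qed.

Lemma psqrt1 : psqrt 1 = 1.
Proof.
rewrite /psqrt cmod1 /=.
have -> : 2 * (1 + 1) = 2 ^+ 2 :> R by rewrite expr2; congr (_ * _).
rewrite sqrtr_sqr ger0_norm //.
rewrite (rmorph1 (real_complex R)) (rmorph_nat (real_complex R) 2).
by rewrite -[1 + 1]/(2%:R) divff // pnatr_eq0.
Qed.

Section RealContOps.
Variable T : topologicalType.
Implicit Types (f g : T -> R).
Lemma rcontD f g (s : T) : {for s, continuous f} -> {for s, continuous g} ->
  {for s, continuous (fun s => f s + g s)}.
Proof. exact: (@cvgD _ R). Qed.
Lemma rcontM f g (s : T) : {for s, continuous f} -> {for s, continuous g} ->
  {for s, continuous (fun s => f s * g s)}.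
Proof. exact: (@cvgM R). Qed.
Lemma rcont_cst c (s : T) : {for s, continuous (fun=> c : R)}.
Proof. exact: (@cvg_cst R c T (nbhs s)). Qed.
End RealContOps.

Lemma ccont_psqrt z : 0 < cmod z + complex.Re z -> ccont psqrt z.
Proof.
move=> h; rewrite /psqrt; apply: ccontM.
  apply: ccontD; first exact: ccont_id.
  by apply: ccont_real; apply: ccont_cmod; exact: ccont_id.
apply: (@ccontV _ _ (fun z => (Num.sqrt (2 * (cmod z + complex.Re z)))%:C)).
  by rewrite (inj_eq (@complexI R)) gt_eqF // sqrtr_gt0 mulr_gt0.
apply: ccont_real.
apply: (@continuous_comp _ _ _ (fun z : R[i] => 2 * (cmod z + complex.Re z)) (@Num.sqrt R)).
  apply: (@rcontM _ (fun=> 2)); first exact: rcont_cst.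
  by apply: rcontD; [exact: ccont_cmod (ccont_id z)|exact: ccont_Re (ccont_id z)].
exact: sqrt_continuous.
Qed.

Lemma near1_slit z : cmod (z - 1) < 1 -> 0 < cmod z + complex.Re z.
Proof.
move=> h; have := le_lt_trans (Re_le_cmod _) h.
rewrite ReD ReN /= ltr_norml => /andP[h1 _].
by apply: ltr_wpDl; [exact: cmod_ge0|lra].
Qed.

(** Nearby nonzero values have a quotient with a principal square root; this is
the local step of every continuation of a square root. *)
Lemma ratio_slit z w : w != 0 -> cmod (z - w) < cmod w ->
  0 < cmod (z / w) + complex.Re (z / w).
Proof.
move=> w0 h; apply: near1_slit; rewrite -[X in _ - X](divff w0) -mulrBl cmodM cmodV.
by rewrite ltr_pdivrMr ?cmod_gt0 // mul1r.
Qed.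

Lemma sqr_eq_or z w : z * z = w * w -> z = w \/ z = - w.
Proof. by move=> /eqP; rewrite -!expr2 eqf_sqr => /orP[] /eqP; auto. Qed.

Definition clamp x : R := Num.max 0 (Num.min 1 x).

Lemma clamp_itv x : 0 <= clamp x <= 1.
Proof. by rewrite /clamp le_max ge_max ge_min !lexx ler01. Qed.

Lemma clamp_id x : 0 <= x <= 1 -> clamp x = x.
Proof. by move=> /andP[h0 h1]; rewrite /clamp min_r // max_r. Qed.

Lemma clamp_le0 x : x <= 0 -> clamp x = 0.
Proof. by move=> h; rewrite /clamp min_r ?max_l // (le_trans h). Qed.

Lemma clamp_ge1 x : 1 <= x -> clamp x = 1.
Proof. by move=> h; rewrite /clamp min_l // max_r. Qed.

Lemma clamp_spec x : [\/ x <= 0 /\ clamp x = 0, 0 <= x <= 1 /\ clamp x = x |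
  1 <= x /\ clamp x = 1].
Proof.
have [h|h] := leP x 0; first by constructor 1; rewrite clamp_le0.
have [h1|h1] := leP x 1; first by constructor 2; rewrite clamp_id ?h1 ?ltW.
by constructor 3; rewrite clamp_ge1 ltW.
Qed.

Lemma clamp_lip x y : `|clamp x - clamp y| <= `|x - y|.
Proof.
rewrite ler_norml; have h1 := ler_norm (x - y); have h2 := ler_norm (y - x).
rewrite distrC in h2.
case: (clamp_spec x) => -[hx ->]; case: (clamp_spec y) => -[hy ->];
  apply/andP; split; lra.
Qed.

Lemma continuous_clamp : continuous clamp.
Proof.
move=> x; apply/cvgrPdist_lt => e e0; near=> y.
apply: le_lt_trans (clamp_lip x y) _.
by near: y; exact: cvgr_dist_lt.
Unshelve. all: by end_near. Qed.

Lemma continuous_affine (a b : R) : continuous (fun t : R => a * t + b).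
Proof.
move=> t; apply: cvgD; last exact: cvg_cst.
by apply: cvgM; [exact: cvg_cst|exact: cvg_id].
Qed.

Lemma continuous_clamp_affine (a b : R) t : {for t, continuous (fun t : R => clamp (a * t + b))}.
Proof.
apply: (@continuous_comp _ _ _ (fun t : R => a * t + b) clamp).
  exact: continuous_affine.
exact: continuous_clamp.
Qed.

(** The quotient of the two roots is continuous with values 1 and -1, hence
constant by the intermediate value theorem. *)
Lemma root_rigid (s r : R -> R[i]) :
  (forall t, 0 <= t <= 1 -> ccont s t) -> (forall t, 0 <= t <= 1 -> ccont r t) ->
  (forall t, 0 <= t <= 1 -> s t * s t = r t * r t) ->
  (forall t, 0 <= t <= 1 -> r t != 0) -> s 0 = r 0 ->
  forall t, 0 <= t <= 1 -> s t = r t.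
Proof.
move=> cs cr sr r0 sr0 t ht.
have in0 : 0 <= (0 : R) <= 1 by rewrite lexx ler01.
have [//|sN] := sqr_eq_or (sr t ht); exfalso.
pose u x := complex.Re (s x / r x).
have u0 : u 0 = 1 by rewrite /u sr0 divff // r0.
have ut : u t = -1 by rewrite /u sN mulNr divff ?r0.
have cu : {within `[0, t], continuous u}.
  apply: continuous_in_subspaceT => x; rewrite inE /= in_itv /= => /andP[x0 xt].
  have hx : 0 <= x <= 1 by move: ht; lra.
  apply: (@ccont_Re _ (fun y => s y / r y)); apply: ccontM; first exact: cs.
  by apply: ccontV; [exact: r0|exact: cr].
have t0 : 0 <= t by case/andP: ht.
have [|c] := IVT (v := 0) t0 cu.
  by rewrite u0 ut ge_min le_max lerN10 ler01 orbT.
rewrite in_itv /= => /andP[c0 ct]; rewrite /u => uc.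
have hc : 0 <= c <= 1 by move: ht; lra.
have [e|e] := sqr_eq_or (sr c hc); move: uc; rewrite e ?mulNr divff ?r0 //=.
  by move/eqP; rewrite oner_eq0.
by move/eqP; rewrite oppr_eq0 oner_eq0.
Qed.
End SquareRoot.

(** * Square roots on simply connected domains *)

Section Lifting.
Variable R : realType.
Implicit Types (z w : R[i]) (x y t e d : R).

Let I2 : set (R * R) := `[0, 1] `*` `[0, 1].

Lemma compact_I2 : compact I2.
Proof. exact: compact_setX (@segment_compact R _ _) (@segment_compact R _ _). Qed.

Lemma rcont_pair (T : topologicalType) (f g : T -> R) (t : T) :
  {for t, continuous f} -> {for t, continuous g} ->
  {for t, continuous (fun s => (f s, g s))}.
Proof.
move=> cf cg A [[B C] /= [fB gC] BC].
have h1 : \forall s \near t, B (f s) by exact: cf.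
have h2 : \forall s \near t, C (g s) by exact: cg.
have : \forall s \near t, A (f s, g s); last exact.
by near=> s; apply: BC; split; [exact: (near h1 s)|exact: (near h2 s)].
Unshelve. all: by end_near. Qed.

Lemma continuous_scale2 (a : R) (p : R * R) :
  {for p, continuous (fun p : R * R => (a * p.1, a * p.2))}.
Proof.
apply: rcont_pair.
  by apply: (@rcontM _ _ (fun=> a) (fun p : R * R => p.1)); [exact: rcont_cst|exact: cvg_fst].
by apply: (@rcontM _ _ (fun=> a) (fun p : R * R => p.2)); [exact: rcont_cst|exact: cvg_snd].
Qed.

(** Lebesgue-number form of uniform continuity, from compactness of the
square. *)
Lemma unif_cont_I2 (G : R * R -> R[i]) e : (forall p, ccont G p) -> 0 < e ->
  exists2 d, 0 < d & forall p q, I2 p -> `|q.1 - p.1| < d -> `|q.2 - p.2| < d ->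
    cmod (G q - G p) < e.
Proof.
move=> cG e0.
have /compact_near_coveringP cov := compact_I2.
pose P d (p : R * R) := forall q : R * R, `|q.1 - p.1| < d -> `|q.2 - p.2| < d ->
  cmod (G q - G p) < e.
have : \forall d \near 0^'+, I2 `<=` P d.
  apply: cov => p _.
  have /nbhs_ballP[r /= r0 hr] := ccontE (cG p) (divr_gt0 e0 (ltr0Sn R 1)).
  have r20 : 0 < r / 2 by rewrite divr_gt0.
  exists (ball p (r / 2), [set d | d < r / 2]) => /=.
    split; first exact: nbhsx_ballx.
    by apply: nbhs_right_lt.
  move=> [p' d] [/= [b1 b2] hd] q h1 h2.
  rewrite -!ball_normE /= in b1 b2.
  have k1 : cmod (G p' - G p) < e / 2.
    by apply: hr; split; rewrite -ball_normE /=; lra.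
  have k2 : cmod (G q - G p) < e / 2.
    apply: hr; split => /=; rewrite -ball_normE /=.
      have -> : p.1 - q.1 = (p.1 - p'.1) - (q.1 - p'.1) by ring.
      by rewrite (le_lt_trans (ler_normB _ _)) //; lra.
    have -> : p.2 - q.2 = (p.2 - p'.2) - (q.2 - p'.2) by ring.
    by rewrite (le_lt_trans (ler_normB _ _)) //; lra.
  have -> : G q - G p' = (G q - G p) - (G p' - G p) by ring.
  rewrite (le_lt_trans (cmodD _ _)) // cmodN; lra.
move=> h; near (0 : R)^'+ => d.
exists d; first by near: d; exact: nbhs_right_gt.
move=> p q Ip; apply: (_ : I2 `<=` P d) => //.
by near: d.
Unshelve. all: by end_near. Qed.

(** Join the origin to [p] by the straight segment and cut it into [N] equal steps;
for [N] large, independent of [p], successive quotients of values of [G] have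
principal roots, and their product is a root of [G p] continuous in [p]. *)
Lemma root_on_square (G : R * R -> R[i]) : (forall p, ccont G p) ->
  (forall p, I2 p -> G p != 0) ->
  exists2 S : R * R -> R[i], (forall p, I2 p -> ccont S p) &
    forall p, I2 p -> S p * S p = G p.
Proof.
move=> cG G0.
have I20 : I2 (0, 0) by rewrite /I2 /= !in_itv /= lexx ler01.
have [p0 p0I hp0] : exists2 p0, p0 \in I2 & forall p, p \in I2 -> cmod (G p0) <= cmod (G p).
  apply: compact_EVT_min; [by exists (0, 0)|exact: compact_I2|].
  by apply: continuous_subspaceT => p; exact: ccont_cmod.
have m0 : 0 < cmod (G p0) by rewrite cmod_gt0 G0 //; exact: set_mem.
have [d d0 hd] := unif_cont_I2 cG m0.
(* a step of length 1 / N moves each point of the square by less than d *)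
pose N := (Num.Def.truncn d^-1).+1.
have N0 : 0 < N%:R :> R by rewrite ltr0n.
have Nd : N%:R^-1 < d by rewrite invf_plt ?posrE // truncnS_gt.
pose sc (k : nat) (p : R * R) : R * R := (k%:R / N%:R * p.1, k%:R / N%:R * p.2).
have scI k p : (k <= N)%N -> I2 p -> I2 (sc k p).
  move=> kN; rewrite /I2 /= !in_itv /= => -[/andP[a1 a2] /andP[b1 b2]].
  have k1 : k%:R / N%:R <= 1 :> R by rewrite ler_pdivrMr // mul1r ler_nat.
  have k0 : 0 <= k%:R / N%:R :> R by rewrite divr_ge0.
  by split; apply/andP; split; [exact: mulr_ge0|exact: mulr_ile1|exact: mulr_ge0|exact: mulr_ile1].
have cGs k p : ccont (fun p => G (sc k p)) p.
  apply/ccontP; apply: (@continuous_comp _ _ _ (sc k) G); first exact: continuous_scale2.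
  by apply/ccontP; exact: cG.
have ratio k p : (k < N)%N -> I2 p -> G (sc k p) != 0 /\
    0 < cmod (G (sc k.+1 p) / G (sc k p)) + complex.Re (G (sc k.+1 p) / G (sc k p)).
  move=> kN Ip; have Ik := scI k p (ltnW kN) Ip.
  split; first exact: G0.
  apply: ratio_slit; first exact: G0.
  apply: lt_le_trans (hp0 _ (mem_set Ik)); apply: hd => //=.
    rewrite -mulrBl -mulrBl -natr1 addrAC subrr add0r mul1r normrM.
    case: Ip; rewrite /= !in_itv /= => /andP[a1 a2] _.
    by rewrite !ger0_norm ?invr_ge0 //; apply: le_lt_trans Nd; rewrite ler_piMr // invr_ge0.
  rewrite -mulrBl -mulrBl -natr1 addrAC subrr add0r mul1r normrM.
  case: Ip; rewrite /= !in_itv /= => _ /andP[a1 a2].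
  by rewrite !ger0_norm ?invr_ge0 //; apply: le_lt_trans Nd; rewrite ler_piMr // invr_ge0.
pose S := fix S (k : nat) (p : R * R) : R[i] := if k is j.+1 then
  S j p * psqrt (G (sc j.+1 p) / G (sc j p)) else sqrtc (G (0, 0)).
have sc0 p : sc 0 p = (0, 0) by rewrite /sc !mul0r.
have scN p : sc N p = p.
  by rewrite /sc divff ?mul1r ?gt_eqF //; case: p.
exists (S N).
  have : (N <= N)%N by [].
  elim: {-2}N => [|k IH] kN p Ip /=; first exact: ccont_cst.
  have [h1 h2] := ratio k p kN Ip.
  apply: ccontM; first by apply: IH => //; exact: ltnW.
  apply: (@ccont_comp _ _ (fun p => G (sc k.+1 p) / G (sc k p))); last exact: ccont_psqrt.
  by apply: ccontM => //; apply: ccontV.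
move=> p Ip; have key k : (k <= N)%N -> S k p * S k p = G (sc k p).
  elim: k => [|k IH] kN; first by rewrite /= sc0 -expr2 sqr_sqrtc.
  have [h1 h2] := ratio k p kN Ip.
  by rewrite /= mulrACA (IH (ltnW kN)) (psqrtK h2) mulrC (divfK h1).
by rewrite key // scN.
Qed.

Lemma ccont_clamp2 (H : R * R -> R[i]) : {within I2, continuous H} ->
  forall p, ccont (fun p : R * R => H (clamp p.1, clamp p.2)) p.
Proof.
move=> /subspace_continuousP cH p; apply/ccontP => B.
have cl : I2 (clamp p.1, clamp p.2) by rewrite /I2 /= !in_itv /= !clamp_itv.
move=> /(cH _ cl) h.
have cc : {for p, continuous (fun p : R * R => (clamp p.1, clamp p.2))}.
  apply: rcont_pair.
    by apply: (@continuous_comp _ _ _ (fun p : R * R => p.1) (@clamp R)); [exact: cvg_fst|exact: continuous_clamp].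
  by apply: (@continuous_comp _ _ _ (fun p : R * R => p.2) (@clamp R)); [exact: cvg_snd|exact: continuous_clamp].
have h2 : nbhs p [set q : R * R | I2 (clamp q.1, clamp q.2) -> B (H (clamp q.1, clamp q.2))].
  exact: cc _ h.
have : nbhs p [set q : R * R | B (H (clamp q.1, clamp q.2))]; last exact.
apply: filterS h2 => q /=; apply.
by rewrite /I2 /= !in_itv /= !clamp_itv.
Qed.

(** [(w, r)] is reached from [(z, s)] by a path of [D] lifted to the graph of the
two-valued function sqrt f: analytic continuation of a root, without germs. *)
Definition lifted (D : set R[i]) (f : R[i] -> R[i]) z s w r :=
  exists g h : R -> R[i], [/\ (forall t, ccont g t /\ ccont h t),
    (forall t, D (g t) /\ h t * h t = f (g t)),
    g 0 = z /\ h 0 = s & g 1 = w /\ h 1 = r].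

Lemma lifted_refl D f z s : D z -> s * s = f z -> lifted D f z s z s.
Proof.
move=> Dz sf; exists (fun=> z), (fun=> s); split => // t.
by split; exact: ccont_cst.
Qed.

Lemma lifted_sym D f z s w r : lifted D f z s w r -> lifted D f w r z s.
Proof.
move=> [g [h [cgh gh [g0 h0] [g1 h1]]]].
exists (fun t => g (-1 * t + 1)), (fun t => h (-1 * t + 1)); split.
- move=> t; have [cg ch] := cgh (-1 * t + 1).
  by split; apply: (@ccont_compR _ _ (fun t => -1 * t + 1)) => //; exact: continuous_affine.
- by move=> t; exact: gh.
- by rewrite mulr0 add0r.
- by rewrite mulr1 addNr.
Qed.

(** The paths are concatenated by adding clamped reparametrisations, which keeps
them continuous on the whole line without gluing. *)
Lemma lifted_trans D f z s w r v q :
  lifted D f z s w r -> lifted D f w r v q -> lifted D f z s v q.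
Proof.
move=> [g [h [cgh gh [g0 h0] [g1 h1]]]] [g' [h' [cgh' gh' [g0' h0'] [g1' h1']]]].
(* each summand is stationary while the other moves *)
pose cat (a b : R -> R[i]) t := a (clamp (2 * t + 0)) + b (clamp (2 * t + -1)) - a 1.
have cc (a b : R -> R[i]) t : (forall t, ccont a t) -> (forall t, ccont b t) -> ccont (cat a b) t.
  move=> ca cb; apply: ccontD; last exact: ccont_cst.
  apply: ccontD.
    by apply: (@ccont_compR _ _ (fun t => clamp (2 * t + 0))) => //; exact: continuous_clamp_affine.
  by apply: (@ccont_compR _ _ (fun t => clamp (2 * t + -1))) => //; exact: continuous_clamp_affine.
have cat1 (a b : R -> R[i]) t : a 1 = b 0 -> t <= 1 / 2 -> cat a b t = a (clamp (2 * t + 0)).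
  move=> ab ht; rewrite /cat [clamp (2 * t + -1)]clamp_le0 ?ab ?addrK //; lra.
have cat2 (a b : R -> R[i]) t : 1 / 2 <= t -> cat a b t = b (clamp (2 * t + -1)).
  move=> ht; rewrite /cat [clamp (2 * t + 0)]clamp_ge1 ?[a 1 + _]addrC ?addrK //; lra.
have eg : g 1 = g' 0 by rewrite g1 g0'.
have eh : h 1 = h' 0 by rewrite h1 h0'.
exists (cat g g'), (cat h h'); split.
- by move=> t; split; apply: cc => x; [case: (cgh x)|case: (cgh' x)|case: (cgh x)|case: (cgh' x)].
- move=> t; have [ht|/ltW ht] := leP t (1 / 2).
    by rewrite !cat1 //; exact: gh.
  by rewrite !cat2 //; exact: gh'.
- by rewrite !cat1 ?mulr0 ?addr0 ?clamp_le0 //; lra.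
- by rewrite !cat2 ?clamp_ge1 //; lra.
Qed.

Section Domain.
Variables (D : set R[i]) (f : R[i] -> R[i]).
Hypotheses (oD : open D) (conD : connected D).
Hypotheses (cf : forall z, D z -> ccont f z) (f0 : forall z, D z -> f z != 0).

Lemma lifted_local z : D z -> exists2 d, 0 < d & forall w, cmod (w - z) < d ->
  [/\ D w, 0 < cmod (f w / f z) + complex.Re (f w / f z) &
    forall s, s * s = f z -> lifted D f z s w (s * psqrt (f w / f z))].
Proof.
move=> Dz; have [a a0 ha] := open_cball oD Dz.
have fz0 : 0 < cmod (f z) by rewrite cmod_gt0 f0.
have /ccont_ballP /(_ _ fz0)[b b0 hb] := cf Dz.
exists (Num.min a b); first by rewrite lt_min a0.
move=> w wd.
have slit v : cmod (v - z) < Num.min a b -> D v /\ 0 < cmod (f v / f z) + complex.Re (f v / f z).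
  rewrite lt_min => /andP[va vb]; split; first exact: ha.
  by apply: ratio_slit; [exact: f0|exact: hb].
have [Dw sw] := slit w wd; split => // s sf.
pose g t : R[i] := z + (clamp (1 * t + 0))%:C * (w - z).
have gd t : cmod (g t - z) < Num.min a b.
  rewrite /g [z + _]addrC addrK cmodM cmod_real; apply: le_lt_trans wd.
  have /andP[c0 c1] := clamp_itv (1 * t + 0).
  by rewrite ger0_norm // ler_piMl // cmod_ge0.
have cg t : ccont g t.
  apply: ccontD; first exact: ccont_cst.
  apply: ccontM; last exact: ccont_cst.
  by apply: ccont_real; exact: continuous_clamp_affine.
exists g, (fun t => s * psqrt (f (g t) / f z)); split.
- move=> t; have [Dg sg] := slit _ (gd t); split=> //.
  apply: ccontM; first exact: ccont_cst.
  apply: (@ccont_comp _ _ (fun t => f (g t) / f z)); last exact: ccont_psqrt.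
  apply: ccontM; last exact: ccont_cst.
  by apply: (@ccont_comp _ _ g) => //; exact: cf.
- move=> t; have [Dg sg] := slit _ (gd t); split=> //.
  by rewrite mulrACA sf psqrtK // mulrC divfK // f0.
- by rewrite /g mulr0 addr0 clamp_le0 // mul0r addr0 divff ?f0 // psqrt1 mulr1.
- by rewrite /g mulr1 addr0 clamp_ge1 // mul1r addrC subrK.
Qed.

(** The set of points where a continuation arrives is open, and so is its
complement in [D]. *)
Lemma lifted_all z0 s0 : D z0 -> s0 * s0 = f z0 ->
  forall w, D w -> exists r, lifted D f z0 s0 w r.
Proof.
move=> Dz0 sf.
pose A := [set w | D w /\ exists r, lifted D f z0 s0 w r].
have sqA w r : lifted D f z0 s0 w r -> r * r = f w.
  by move=> [g [h [_ gh _ [g1 h1]]]]; have [_] := gh 1; rewrite g1 h1.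
have oA : open A.
  rewrite openE => w [Dw [r lr]]; have [d d0 hd] := lifted_local Dw.
  apply/nbhs_cmodP; exists d => // v /hd [Dv _ l]; split=> //.
  have rr := sqA _ _ lr.
  by exists (r * psqrt (f v / f w)); apply: lifted_trans lr _; exact: l.
have oB : open (D `\` A).
  rewrite openE => w [Dw nA]; have [d d0 hd] := lifted_local Dw.
  apply/nbhs_cmodP; exists d => // v vd; have [Dv sl l] := hd v vd; split=> // -[_ [r lr]].
  apply: nA; split => //.
  pose p := psqrt (f v / f w).
  have p2 : p * p = f v / f w by exact: psqrtK.
  have p0 : p != 0.
    apply/eqP => p0; move: p2; rewrite p0 mul0r => /esym/eqP.
    by rewrite mulf_eq0 invr_eq0 (negbTE (f0 Dv)) (negbTE (f0 Dw)).
  have rr := sqA _ _ lr.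
  (* the root r at v is carried back to w along the same short path *)
  exists (r / p); apply: lifted_trans lr _; apply: lifted_sym.
  have := l (r / p); rewrite -/p divfK //; apply.
  rewrite mulrACA rr -invfM p2 invfM invrK.
  by rewrite mulrA divff ?mul1r // f0.
have AD : A = D.
  apply: conD.
  - by exists z0; split=> //; exists s0; exact: lifted_refl.
  - by exists A => //; apply/seteqP; split=> [w [? ?]|w []].
  - exists (~` (D `\` A)); first exact: open_closedC.
    apply/seteqP; split=> [w Aw|w [Dw nB]]; first by split; [case: Aw|case].
    by apply: contrapT => nA; apply: nB.
by move=> w Dw; have [] : A w by rewrite AD.
Qed.

Hypothesis scD : loops_contractible D.

(** Monodromy: contract the loop by a homotopy [H] and take a root [S] of
[f \o H] on the square. On the three sides that [H] sends to the base point [S]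
is constant, hence [S] takes equal values at both ends of the fourth side, along
which [S] and the given lift agree up to a fixed sign. *)
Lemma lifted_uniq z s r : lifted D f z s z r -> s = r.
Proof.
move=> [g [h [cgh gh [g0 h0] [g1 h1]]]].
have in01 (t : R) : t = 0 \/ t = 1 -> 0 <= t <= 1 by case=> ->; rewrite ?lexx ?ler01.
have i0 : 0 <= (0 : R) <= 1 by apply: in01; left.
have i1 : 0 <= (1 : R) <= 1 by apply: in01; right.
have [||| H [cH DH H0 H1 Hs]] := scD (g := g).
- by apply: continuous_subspaceT => t; apply/ccontP; case: (cgh t).
- by move=> t _; case: (gh t).
- by rewrite g0 g1.
pose G (p : R * R) := f (H (clamp p.1, clamp p.2)).
have DHc p : D (H (clamp p.1, clamp p.2)) by apply: DH; exact: clamp_itv.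
have cG p : ccont G p.
  apply: (@ccont_comp _ _ (fun p : R * R => H (clamp p.1, clamp p.2))).
    exact: ccont_clamp2.
  exact: cf.
have [|S cS S2] := root_on_square cG.
  by move=> p _; apply: f0.
have I2i s' t' : 0 <= s' <= 1 -> 0 <= t' <= 1 -> I2 (s', t').
  by move=> a b; rewrite /I2 /= !in_itv.
have GE s' t' : 0 <= s' <= 1 -> 0 <= t' <= 1 -> G (s', t') = f (H (s', t')).
  by move=> a b; rewrite /G /= !clamp_id.
have cS1 s' : 0 <= s' <= 1 -> forall t, 0 <= t <= 1 -> ccont (fun t => S (s', t)) t.
  move=> hs t ht; apply/ccontP; apply: (@continuous_comp _ _ _ (fun t => (s', t)) S).
    by apply: rcont_pair; [exact: rcont_cst|exact: cvg_id].
  by apply/ccontP; apply: cS; exact: I2i.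
have cS2 t' : 0 <= t' <= 1 -> forall t, 0 <= t <= 1 -> ccont (fun t => S (t, t')) t.
  move=> hs t ht; apply/ccontP; apply: (@continuous_comp _ _ _ (fun t => (t, t')) S).
    by apply: rcont_pair; [exact: cvg_id|exact: rcont_cst].
  by apply/ccontP; apply: cS; exact: I2i.
have Dz : D z by rewrite -g0; case: (gh 0).
have Sn0 s' t' : 0 <= s' <= 1 -> 0 <= t' <= 1 -> S (s', t') != 0.
  move=> a b; have := S2 _ (I2i _ _ a b); rewrite GE // => e.
  have := f0 (DH _ _ a b); rewrite -e mulf_eq0 negb_or => /andP[] //.
have cst (u : R -> R[i]) : (forall t, 0 <= t <= 1 -> ccont u t) ->
    (forall t, 0 <= t <= 1 -> u t * u t = u 0 * u 0) -> u 0 != 0 -> u 1 = u 0.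
  move=> cu uu u0; apply: (@root_rigid _ u (fun=> u 0)) => //.
  by move=> t _; exact: ccont_cst.
(* S is constant on the sides that H maps to the base point *)
have E1 : S (1, 0) = S (0, 0).
  apply: (cst (fun t => S (t, 0))); [exact: cS2| |exact: Sn0].
  move=> t ht; rewrite !S2 ?GE //; try exact: I2i.
  by have [-> _] := Hs t ht; have [-> _] := Hs 0 i0.
have E2 : S (1, 1) = S (1, 0).
  apply: (cst (fun t => S (1, t))); [exact: cS1| |exact: Sn0].
  by move=> t ht; rewrite !S2 ?GE ?H1 //; exact: I2i.
have E3 : S (1, 1) = S (0, 1).
  apply: (cst (fun t => S (t, 1))); [exact: cS2| |exact: Sn0].
  move=> t ht; rewrite !S2 ?GE //; try exact: I2i.
  by have [_ ->] := Hs t ht; have [_ ->] := Hs 0 i0.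
have S01 : S (0, 1) = S (0, 0) by rewrite -E3 E2 E1.
have hS t : 0 <= t <= 1 -> h t * h t = S (0, t) * S (0, t).
  by move=> ht; have [_ ->] := gh t; rewrite S2 ?GE ?H0 //; exact: I2i.
have ch t : 0 <= t <= 1 -> ccont h t by move=> _; case: (cgh t).
rewrite -h0 -h1.
have [e|e] := sqr_eq_or (hS 0 i0).
  rewrite (@root_rigid _ h (fun t => S (0, t)) ch (cS1 0 i0) hS _ e 1 i1) ?e ?S01 //.
  by move=> t ht; exact: Sn0.
rewrite (@root_rigid _ h (fun t => - S (0, t)) ch _ _ _ e 1 i1) ?e ?S01 //.
- by move=> t ht; apply: ccontN; exact: cS1.
- by move=> t ht; rewrite mulrNN; exact: hS.
- by move=> t ht; rewrite oppr_eq0; exact: Sn0.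
Qed.

(** The value at [z] is the end value of any continuation from a base point, well
defined by [lifted_uniq] and continuous by [lifted_local]. *)
Lemma exists_root : exists2 s : R[i] -> R[i], (forall z, D z -> ccont s z) &
  forall z, D z -> s z * s z = f z.
Proof.
have [[z0 Dz0]|D0] := pselect (D !=set0); last first.
  by exists (fun=> 0) => z Dz; exfalso; apply: D0; exists z.
pose s0 := sqrtc (f z0).
have s02 : s0 * s0 = f z0 by rewrite -expr2 sqr_sqrtc.
have hs z : exists r, D z -> lifted D f z0 s0 z r.
  have [Dz|nD] := pselect (D z); last by exists 0.
  by have [r lr] := lifted_all Dz0 s02 Dz; exists r.
pose s z := projT1 (cid (hs z)).
have sP z : D z -> lifted D f z0 s0 z (s z) by exact: (projT2 (cid (hs z))).
have s2 z : D z -> s z * s z = f z.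
  by move=> /sP[g [h [_ gh _ [g1 h1]]]]; have [_] := gh 1; rewrite g1 h1.
exists s => // z Dz; have [d d0 hd] := lifted_local Dz.
apply: (@ccont_near _ _ (fun w => s z * psqrt (f w / f z))).
  apply/nbhs_cmodP; exists d => // w /hd[Dw sl l].
  apply: (@lifted_uniq w); apply: lifted_trans (lifted_sym _) (sP w Dw).
  by apply: lifted_trans (sP z Dz) _; apply: l; exact: s2.
apply: ccontM; first exact: ccont_cst.
apply: (@ccont_comp _ _ (fun w => f w / f z)).
  by apply: ccontM; [exact: cf|exact: ccont_cst].
apply: ccont_psqrt; apply: ratio_slit; first exact: f0.
by rewrite subrr cmod0 cmod_gt0 f0.
Qed.
End Domain.
End Lifting.

(** * The maximum principle *)

Section MaximumPrinciple.
Variable R : realType.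
Implicit Types (z w : R[i]) (x y t e d : R) (f g h : R[i] -> R[i]).

Lemma realC_neq0 x : x != 0 -> x%:C != 0 :> R[i].
Proof. by rewrite (inj_eq (@complexI R)). Qed.

Lemma der_real_path g z a (c v p : R[i]) t : z = p + t%:C * v -> hasder g z a ->
  is_derive t 1 (fun s : R => complex.Re (c * g (p + s%:C * v)))
    (complex.Re (c * (a * v))).
Proof.
move=> zE [[q [cq <- hq]]]; apply/is_derive1_caratheodory.
exists (fun s => complex.Re (c * (q (p + s%:C * v) * v))); split.
- move=> s; rewrite -ReN -ReD -mulrBr -zE hq zE.
  have -> : p + s%:C * v - (p + t%:C * v) = (s - t)%:C * v by rewrite rmorphB; ring.
  have -> : c * (q (p + s%:C * v) * ((s - t)%:C * v)) = c * (q (p + s%:C * v) * v) * (s - t)%:C by ring.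
  by rewrite [LHS]ReM /= mulr0 subr0.
- apply: (@ccont_Re R R (fun s : R => c * (q (p + s%:C * v) * v))).
  apply: ccontM; first exact: ccont_cst.
  apply: ccontM; last exact: ccont_cst.
  apply: (@ccont_comp _ _ (fun s : R => p + s%:C * v)); last by rewrite -zE.
  apply: ccontD; first exact: ccont_cst.
  by apply: ccontM; [apply: ccont_real; exact: cvg_id|exact: ccont_cst].
- by rewrite -zE.
Qed.

(** The real mean value theorem applied to the component of [g] in the direction of
the increment [g (p + v) - g p]. *)
Lemma mean_value g (g' : R[i] -> R[i]) p v M :
  (forall t, 0 <= t <= 1 -> hasder g (p + t%:C * v) (g' (p + t%:C * v))) ->
  (forall t, 0 <= t <= 1 -> cmod (g' (p + t%:C * v)) <= M) ->
  cmod (g (p + v) - g p) <= M * cmod v.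
Proof.
move=> dg bg; set c := g (p + v) - g p.
pose phi s := complex.Re (conjc c * g (p + s%:C * v)).
pose phi' s := complex.Re (conjc c * (g' (p + s%:C * v) * v)).
have dphi (s : R) : 0 <= s <= 1 -> is_derive s 1 phi (phi' s).
  by move=> hs; apply: (@der_real_path _ (p + s%:C * v)) => //; exact: dg.
have [||x] := @MVT R phi phi' 0 1 ltr01.
- by move=> x; rewrite in_itv /= => /andP[a b]; apply: dphi; rewrite !ltW.
- apply: derivable_within_continuous => x; rewrite in_itv /= => hx.
  by have [] := dphi x hx.
rewrite in_itv /= => /andP[x0 x1]; rewrite subr0 mulr1 /phi /phi' => e.
have e2 : complex.Re (conjc c * g (p + 1%:C * v)) - complex.Re (conjc c * g (p + 0%:C * v)) = cmod c ^+ 2.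
  rewrite -ReN -ReD -mulrBr mul1r mul0r addr0 -/c mulrC mulcJ //.
have hx : 0 <= x <= 1 by rewrite !ltW.
have : cmod c ^+ 2 <= cmod c * (M * cmod v).
  rewrite -e2 e; apply: le_trans (ler_norm _) _; apply: le_trans (Re_le_cmod _) _.
  rewrite !cmodM cmodJ ler_wpM2l ?cmod_ge0 // ler_wpM2r ?cmod_ge0 //.
  exact: bg.
have := cmod_ge0 c; rewrite le_eqVlt => /orP[/eqP <- _|c0].
  by rewrite mulr_ge0 ?cmod_ge0 // (le_trans _ (bg 0 _)) ?cmod_ge0 // lexx ler01.
by rewrite expr2 ler_pM2l.
Qed.

Lemma taylor2 U h z : open U -> csmooth 2 U h -> U z ->
  exists b c : R[i], forall e, 0 < e -> exists2 d, 0 < d &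
    forall v, cmod v < d ->
      cmod (h (z + v) - (h z + b * v + c * v ^+ 2)) <= e * cmod v ^+ 2.
Proof.
move=> oU [h1 dh [h2 dh1 _]] Uz.
exists (h1 z), (h2 z / 2) => e e0.
have [r r0 hr] := open_cball oU Uz.
have [[q [/ccont_ballP cq qz hq]]] := dh1 z Uz.
have [d d0 hd] := cq e e0.
exists (Num.min r d); first by rewrite lt_min r0.
move=> v; rewrite lt_min => /andP[vr vd].
pose k w := h w - (h z + h1 z * (w - z) + h2 z / 2 * (w - z) ^+ 2).
have kz : k z = 0 by rewrite /k subrr; ring.
have -> : h (z + v) - (h z + h1 z * v + h2 z / 2 * v ^+ 2) = k (z + v) - k z.
  by rewrite kz /k [z + v - z]addrC addKr subr0.
have sm t : 0 <= t <= 1 -> cmod (t%:C * v) <= cmod v.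
  by move=> /andP[t0 t1]; rewrite cmodM cmod_real ger0_norm // ler_piMl // cmod_ge0.
pose k' w := h1 w - (h1 z + h2 z * (w - z)).
rewrite expr2 mulrA; apply: (@mean_value _ k').
  move=> t ht; set w := z + t%:C * v.
  have Uw : U w by apply: hr; rewrite /w [z + _]addrC addrK (le_lt_trans (sm t ht)).
  have dz : hasder (fun w => w - z) w (1 + 0) by apply: der_add; [exact: der_id|exact: der_cst].
  have D1 : hasder (fun w => h1 z * (w - z)) w (0 * (w - z) + h1 z * (1 + 0)).
    by apply: der_mul; [exact: der_cst|].
  have D2 := der_mul dz dz.
  have D3 := der_mul (der_cst (h2 z / 2) w) D2.
  have D4 := der_add (der_add (der_cst (h z) w) D1) D3.
  have D5 := der_add (dh w Uw) (der_mul (der_cst (-1) w) D4).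
  rewrite /k; apply: (@der_eq _ _ _ (h1 w + (0 * (h z + h1 z * (w - z) + h2 z / 2 * ((w - z) * (w - z))) +
     -1 * (0 + (0 * (w - z) + h1 z * (1 + 0)) +
           (0 * ((w - z) * (w - z)) + h2 z / 2 * ((1 + 0) * (w - z) + (w - z) * (1 + 0))))))).
    apply: (hasder_eq_near ltr01 _ D5) => u _ /=; ring.
  by rewrite /k'; field.
move=> t ht; set w := z + t%:C * v.
have wz : w - z = t%:C * v by rewrite /w addrC addKr.
have -> : k' w = (q w - q z) * (w - z).
  by rewrite /k' opprD addrA hq qz; ring.
rewrite cmodM wz; apply: ler_pM; rewrite ?cmod_ge0 ?sm //.
by apply/ltW/hd; rewrite wz (le_lt_trans (sm t ht)).
Qed.

(** Discrete Parseval identity over the four points [r], [-r], [i r], [-i r]: the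
mixed terms cancel, so that the mean of the squared moduli is at least that at
the centre. *)
Lemma four_points (a b c : R[i]) r :
  cmod (a + b * (r +i* 0) + c * (r +i* 0) ^+ 2) ^+ 2 +
  cmod (a + b * (- r +i* 0) + c * (- r +i* 0) ^+ 2) ^+ 2 +
  cmod (a + b * (0 +i* r) + c * (0 +i* r) ^+ 2) ^+ 2 +
  cmod (a + b * (0 -i* r) + c * (0 -i* r) ^+ 2) ^+ 2 =
  4 * (cmod a ^+ 2 + cmod b ^+ 2 * r ^+ 2 + cmod c ^+ 2 * r ^+ 4).
Proof.
case: a => a1 a2; case: b => b1 b2; case: c => c1 c2.
by rewrite !expr2 -!expr2 !sqr_cmod /=; ring.
Qed.

Lemma sqr_cmod_add_ge (P E : R[i]) : cmod P ^+ 2 - 2 * cmod P * cmod E <= cmod (P + E) ^+ 2.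
Proof.
have h := cmodD (P + E) (- E); rewrite addrK cmodN in h.
have p0 := cmod_ge0 P; have e0 := cmod_ge0 E; have s0 := cmod_ge0 (P + E).
have [le|lt] := leP (cmod E) (cmod P); first by nra.
by nra.
Qed.

(** Compare means over four points of a small circle about [z] with the values at
[z]: by [four_points] the term [e |z|^2] gains [e r^2], and [|h|^2] loses at most
the Taylor remainder [(e / 2) r^2]. *)
Lemma no_interior_max U h z e : open U -> csmooth 2 U h -> U z -> 0 < e ->
  exists2 w, U w & cmod (h z) ^+ 2 + e * cmod z ^+ 2 < cmod (h w) ^+ 2 + e * cmod w ^+ 2.
Proof.
move=> oU sh Uz e0; have [b [c T]] := taylor2 oU sh Uz.
set M := cmod (h z) + cmod b + cmod c + 1.
have M1 : 1 <= M by rewrite /M lerDr !addr_ge0 ?cmod_ge0.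
have M0 : 0 < M by rewrite (lt_le_trans ltr01).
have [d d0 hd] := T (e / (4 * M)) (divr_gt0 e0 (mulr_gt0 (ltr0Sn R 3) M0)).
have [s s0 hs] := open_cball oU Uz.
pose r := Num.min (Num.min (d / 2) (s / 2)) 1.
have r0 : 0 < r by rewrite /r !lt_min !divr_gt0 ?ltr01.
have r1 : r <= 1 by rewrite /r ge_min lexx orbT.
have rd : r < d by rewrite /r (le_lt_trans (_ : _ <= d / 2)) ?ge_min ?lexx //; lra.
have rs : r < s by rewrite /r (le_lt_trans (_ : _ <= s / 2)) ?ge_min ?lexx ?orbT //; lra.
(* M bounds |P| on the unit disk; the choice e / (4 M) in the remainder
   keeps the cross term 2 |P| |remainder| below (e / 2) r^2 *)
pose P v := h z + b * v + c * v ^+ 2.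
have key v : cmod v = r -> U (z + v) /\
   cmod (P v) ^+ 2 - (e / 2) * r ^+ 2 <= cmod (h (z + v)) ^+ 2.
  move=> vr; split; first by apply: hs; rewrite addrAC subrr add0r vr.
  have := hd v; rewrite vr => /(_ rd); rewrite -/(P v) => hE.
  have PM : cmod (P v) <= M.
    apply: le_trans (cmodD _ _) _; rewrite cmodM cmodX vr.
    apply: le_trans (lerD (cmodD _ _) (lexx _)) _; rewrite cmodM vr /M.
    have := cmod_ge0 b; have := cmod_ge0 c => c0 b0.
    have : cmod b * r <= cmod b by rewrite ler_piMr.
    have : cmod c * r ^+ 2 <= cmod c by rewrite ler_piMr // exprn_ile1 // ltW.
    lra.
  have := sqr_cmod_add_ge (P v) (h (z + v) - P v); rewrite [P v + _]addrC subrK.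
  apply: le_trans; rewrite lerD2l lerN2 -mulrA.
  have -> : e / 2 * r ^+ 2 = 2 * (M * (e / (4 * M) * r ^+ 2)) by field; rewrite gt_eqF.
  rewrite ler_pM2l //; apply: ler_pM; rewrite ?cmod_ge0 //.
have cm1 : cmod (r +i* 0 : R[i]) = r by rewrite cmod_real ger0_norm // ltW.
have cm2 : cmod (- r +i* 0 : R[i]) = r by rewrite cmod_real normrN ger0_norm // ltW.
have cm3 : cmod (0 +i* r : R[i]) = r.
  by rewrite /cmod normc_def /= expr0n add0r sqrtr_sqr ger0_norm // ltW.
have cm4 : cmod (0 -i* r : R[i]) = r.
  by rewrite /cmod normc_def /= expr0n add0r sqrtr_sqr normrN ger0_norm // ltW.
have [U1 K1] := key _ cm1; have [U2 K2] := key _ cm2.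
have [U3 K3] := key _ cm3; have [U4 K4] := key _ cm4.
have F1 := four_points (h z) b c r; rewrite -!/(P _) in F1.
have F2 := four_points z 1 0 r; rewrite !mul0r !addr0 !mul1r cmod1 cmod0 in F2.
have rr : 0 < r ^+ 2 by rewrite exprn_gt0.
have b2 : 0 <= cmod b ^+ 2 * r ^+ 2 by rewrite mulr_ge0 // exprn_ge0 // ?cmod_ge0 // ltW.
have c2 : 0 <= cmod c ^+ 2 * r ^+ 4 by rewrite mulr_ge0 // exprn_ge0 // ?cmod_ge0 // ltW.
rewrite expr1n mul1r expr0n mul0r addr0 in F2.
apply: contrapT => nex.
have W w : U w -> cmod (h w) ^+ 2 + e * cmod w ^+ 2 <= cmod (h z) ^+ 2 + e * cmod z ^+ 2.
  by move=> Uw; rewrite leNgt; apply/negP => lt; apply: nex; exists w.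
have := W _ U1; have := W _ U2; have := W _ U3; have := W _ U4.
move: F1 F2 K1 K2 K3 K4.
set p1 := cmod (P _) ^+ 2; set p2 := cmod (P _) ^+ 2; set p3 := cmod (P _) ^+ 2; set p4 := cmod (P _) ^+ 2.
set q1 := cmod (z + _) ^+ 2; set q2 := cmod (z + _) ^+ 2; set q3 := cmod (z + _) ^+ 2; set q4 := cmod (z + _) ^+ 2.
move=> F1 F2 K1 K2 K3 K4 W4 W3 W2 W1.
have : e * (q1 + q2 + q3 + q4) = e * (4 * (cmod z ^+ 2 + r ^+ 2)) by rewrite F2.
have : 0 < e * r ^+ 2 by rewrite mulr_gt0.
lra.
Qed.

(** Maximise [|h|^2 + e |z|^2] over [K]; by [no_interior_max] the maximum is on
[K] minus [U], and [e] tends to 0. *)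
Lemma max_principle (K U : set R[i]) h M : compact K -> U `<=` K -> open U ->
  csmooth 2 U h -> (forall z, K z -> ccont h z) ->
  (forall z, K z -> ~ U z -> cmod (h z) <= M) ->
  forall z, K z -> cmod (h z) <= M.
Proof.
move=> cK UK oU sh ch hM z Kz.
have K0 : K !=set0 by exists z.
have cc (f : R[i] -> R) : (forall z, K z -> {for z, continuous f}) -> {within K, continuous f}.
  by move=> hf; apply: continuous_in_subspaceT => w; rewrite inE; exact: hf.
have [b Kb hb] := compact_sup_attained cK K0
  (cc _ (fun z _ => ccont_cmod (ccont_id z))).
set B := cmod b in hb.
have bound e : 0 < e -> 0 <= M /\ cmod (h z) ^+ 2 <= M ^+ 2 + e * B ^+ 2.
  move=> e0; pose u w := cmod (h w) ^+ 2 + e * cmod w ^+ 2.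
  have [|s Ks hs] := @compact_sup_attained R K u cK K0.
    apply: cc => w Kw; apply: rcontD.
      by apply: (@rcontM _ _ (fun w => cmod (h w)) (fun w => cmod (h w))); apply: ccont_cmod; exact: ch.
    apply: (@rcontM _ _ (fun=> e)); first exact: rcont_cst.
    by apply: (@rcontM _ _ (@cmod R) (@cmod R)); apply: (@ccont_cmod _ _ id); exact: ccont_id.
  have nUs : ~ U s.
    move=> Us; have [w Uw] := no_interior_max oU sh Us e0.
    by rewrite ltNge => /negP; apply; apply: hs; exact: UK.
  have hsM := hM s Ks nUs.
  have M0 : 0 <= M := le_trans (cmod_ge0 _) hsM.
  split=> //; have := hs z Kz; rewrite /u => h1.
  have h2 : cmod (h s) ^+ 2 <= M ^+ 2 by rewrite ler_pXn2r // ?nnegrE ?cmod_ge0.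
  have h3 : cmod s ^+ 2 <= B ^+ 2 by rewrite ler_pXn2r ?nnegrE ?cmod_ge0 // hb.
  have h4 : e * cmod s ^+ 2 <= e * B ^+ 2 by rewrite ler_pM2l.
  have h5 : 0 <= e * cmod z ^+ 2 by rewrite mulr_ge0 ?exprn_ge0 ?cmod_ge0 // ltW.
  lra.
have [M0 _] := bound 1 ltr01.
rewrite -(@ler_pXn2r _ 2) ?nnegrE ?cmod_ge0 //.
apply/ler_addgt0Pr => e e0.
have B1 : 0 < B ^+ 2 + 1 by rewrite ltr_wpDl // exprn_ge0 // cmod_ge0.
have [_] := bound (e / (B ^+ 2 + 1)) (divr_gt0 e0 B1).
move/le_trans; apply; rewrite lerD2l mulrAC ler_pdivrMr // ler_pM2l //.
by rewrite lerDl.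
Qed.
End MaximumPrinciple.

(** * Maps into the disk, Blaschke factors and a Schwarz lemma *)

Section Smooth.
Variable R : realType.
Implicit Types (z w : R[i]) (f g : R[i] -> R[i]) (D : set R[i]).

Lemma smooth_cst D (a : R[i]) : open D -> smooth D (fun=> a).
Proof. by move=> oD n; exact: csmooth_cst. Qed.
Lemma smooth_id D : open D -> smooth D id.
Proof. by move=> oD n; exact: csmooth_id. Qed.
Lemma smooth_add D f g : open D -> smooth D f -> smooth D g -> smooth D (fun w => f w + g w).
Proof. by move=> oD sf sg n; exact: csmooth_add. Qed.
Lemma smooth_opp D f : open D -> smooth D f -> smooth D (fun w => - f w).
Proof. by move=> oD sf n; exact: csmooth_opp. Qed.
Lemma smooth_sub D f g : open D -> smooth D f -> smooth D g -> smooth D (fun w => f w - g w).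
Proof. by move=> oD sf sg; apply: smooth_add => //; exact: smooth_opp. Qed.
Lemma smooth_mul D f g : open D -> smooth D f -> smooth D g -> smooth D (fun w => f w * g w).
Proof. by move=> oD sf sg n; exact: csmooth_mul. Qed.
Lemma smooth_inv D f : open D -> (forall z, D z -> f z != 0) -> smooth D f ->
  smooth D (fun w => (f w)^-1).
Proof. by move=> oD f0 sf n; exact: csmooth_inv. Qed.
Lemma smooth_div D f g : open D -> (forall z, D z -> g z != 0) -> smooth D f -> smooth D g ->
  smooth D (fun w => f w / g w).
Proof. by move=> oD g0 sf sg; apply: smooth_mul => //; exact: smooth_inv. Qed.
Lemma smooth_exp D f m : open D -> smooth D f -> smooth D (fun w => f w ^+ m).
Proof.
move=> oD sf; elim: m => [|m IH]; first exact: smooth_cst.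
have -> : (fun w => f w ^+ m.+1) = (fun w => f w * f w ^+ m).
  by apply/funext => w; rewrite exprS.
exact: smooth_mul.
Qed.
Lemma smooth_conj D f : open D -> (forall z, D z -> D (conjc z)) -> smooth D f ->
  smooth D (fun w => conjc (f (conjc w))).
Proof. by move=> oD sD sf n; exact: csmooth_conj. Qed.
Lemma smooth_sub_set D E f : E `<=` D -> smooth D f -> smooth E f.
Proof. by move=> ED sf n; exact: csmooth_sub (sf n). Qed.
Lemma smooth_ccont D f z : smooth D f -> D z -> ccont f z.
Proof. by move=> sf; exact: (csmooth_cont (sf 0%N)). Qed.
Lemma smooth_ext D f g : open D -> (forall z, D z -> f z = g z) -> smooth D f -> smooth D g.
Proof. by move=> oD fg sf n; exact: csmooth_ext (sf n). Qed.

(** [csmooth_sqrt] upgrades the continuous root of [exists_root]. *)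
Lemma smooth_root D f : simply_connected_domain D -> smooth D f ->
  (forall z, D z -> f z != 0) ->
  exists2 s, smooth D s & forall z, D z -> s z * s z = f z.
Proof.
move=> [[oD cD] lD] sf f0.
have [s cs s2] := exists_root oD cD (fun z => @smooth_ccont D f z sf) f0 lD.
by exists s => // n; apply: (csmooth_sqrt oD f0) => //; exact: sf.
Qed.

Definition to_disk D f := smooth D f /\ forall z, D z -> cmod (f z) < 1.

(** The automorphism of the disk sending [a] to 0; its inverse is [blaschke (- a)]. *)
Definition blaschke (a w : R[i]) := (w - a) / (1 - conjc a * w).

Lemma blaschke_den (a w : R[i]) : cmod a < 1 -> cmod w < 1 -> 1 - conjc a * w != 0.
Proof.
move=> a1 w1; rewrite subr_eq0; apply/negP => /eqP e.
have : cmod (1 : R[i]) < 1.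
  rewrite e cmodM cmodJ; have [->|w0] := eqVneq (cmod w) 0; first by rewrite mulr0.
  by rewrite mulr_ilt1 ?cmod_ge0.
by rewrite cmod1 ltxx.
Qed.

Lemma blaschke_identity (a w : R[i]) :
  cmod (1 - conjc a * w) ^+ 2 - cmod (w - a) ^+ 2 = (1 - cmod a ^+ 2) * (1 - cmod w ^+ 2).
Proof. by case: a w => [a1 a2] [w1 w2]; rewrite !sqr_cmod /=; ring. Qed.

Lemma blaschke_lt1 (a w : R[i]) : cmod a < 1 -> cmod w < 1 -> cmod (blaschke a w) < 1.
Proof.
move=> a1 w1; rewrite /blaschke cmodM cmodV ltr_pdivrMr ?cmod_gt0 ?blaschke_den // mul1r.
rewrite -(@ltr_pXn2r _ 2) ?nnegrE ?cmod_ge0 // -subr_gt0 blaschke_identity.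
by rewrite mulr_gt0 // subr_gt0 exprn_ilt1 ?cmod_ge0.
Qed.

Lemma blaschke_xx (a : R[i]) : blaschke a a = 0.
Proof. by rewrite /blaschke subrr mul0r. Qed.

Lemma blaschke_0 (a : R[i]) : blaschke a 0 = - a.
Proof. by rewrite /blaschke sub0r mulr0 subr0 divr1. Qed.

Lemma blaschke_eq0 (a w : R[i]) : cmod a < 1 -> cmod w < 1 -> (blaschke a w == 0) = (w == a).
Proof. by move=> a1 w1; rewrite /blaschke mulf_eq0 invr_eq0 (negbTE (blaschke_den a1 w1)) orbF subr_eq0. Qed.

Lemma blaschke_addK (a w : R[i]) : cmod a < 1 -> cmod w < 1 ->
  blaschke a w + a = w * (1 - a * conjc a) / (1 - conjc a * w).
Proof. by move=> a1 w1; rewrite /blaschke; field; exact: blaschke_den. Qed.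

Lemma blaschkeK (a w : R[i]) : cmod a < 1 -> cmod w < 1 -> blaschke (- a) (blaschke a w) = w.
Proof.
move=> a1 w1; have d := blaschke_den a1 w1.
have a2 : 1 - a * conjc a != 0.
  by rewrite mulrC; apply: blaschke_den.
have e : 1 - conjc (- a) * blaschke a w = (1 - a * conjc a) / (1 - conjc a * w).
  by rewrite rmorphN mulNr opprK /blaschke; field.
by rewrite {1}/blaschke opprK e blaschke_addK //; field; rewrite d a2.
Qed.

Lemma ccont_blaschke (a w : R[i]) : cmod a < 1 -> cmod w < 1 -> ccont (blaschke a) w.
Proof.
move=> a1 w1; apply: ccontM.
  by apply: ccontD; [exact: ccont_id|exact: ccont_cst].
apply: (@ccontV _ _ (fun w => 1 - conjc a * w)); first exact: blaschke_den.
apply: ccontD; first exact: ccont_cst.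
by apply: ccontN; apply: ccontM; [exact: ccont_cst|exact: ccont_id].
Qed.

Lemma to_disk_blaschke D f (a : R[i]) : open D -> cmod a < 1 -> to_disk D f ->
  to_disk D (fun z => blaschke a (f z)).
Proof.
move=> oD a1 [sf f1]; split; last by move=> z Dz; apply: blaschke_lt1; rewrite ?f1.
apply: smooth_div => //; first by move=> z Dz; apply: blaschke_den; rewrite ?f1.
  by apply: smooth_sub => //; exact: smooth_cst.
apply: smooth_sub => //; first exact: smooth_cst.
by apply: smooth_mul => //; exact: smooth_cst.
Qed.
End Smooth.

Section Schwarz.
Variable R : realType.
Implicit Types (z w y : R[i]) (f g : R[i] -> R[i]) (D : set R[i]).

Lemma bernoulli (t : R) m : 1 <= t -> 1 + m%:R * (t - 1) <= t ^+ m.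
Proof.
move=> t1; elim: m => [|m IH]; first by rewrite mul0r addr0 expr0.
rewrite exprS; apply: le_trans (_ : t * (1 + m%:R * (t - 1)) <= _); last first.
  by rewrite ler_pM2l // (lt_le_trans ltr01).
rewrite -natr1; have : 0 <= m%:R * (t - 1) ^+ 2 by rewrite mulr_ge0 // sqr_ge0.
by nra.
Qed.

(** The exponents differ by one because [G ^ m.+1 / f ^ m], unlike
[(G / f) ^ m], is continuous at a common zero with value 0 there. *)
Lemma le_of_pow (a b : R) : 0 <= a -> 0 <= b ->
  (forall m, (0 < m)%N -> a ^+ m.+1 <= b ^+ m) -> a <= b.
Proof.
move=> a0 b0 h; rewrite leNgt; apply/negP => ba.
have a1 : 0 < a by exact: le_lt_trans ba.
have [b00|bn0] := eqVneq b 0.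
  by have := h 1%N isT; rewrite b00 expr1 leNgt exprn_gt0.
have bp : 0 < b by rewrite lt_def bn0.
(* if b < a, the powers of t = a / b would be bounded by 1 / a *)
pose t := a / b; have t1 : 1 < t by rewrite /t ltr_pdivlMr // mul1r.
have h2 m : a * t ^+ m.+1 <= 1.
  have := h m.+1 isT; rewrite exprS /t expr_div_n mulrA ler_pdivrMr ?exprn_gt0 //.
  by rewrite mul1r.
pose c := (a * (t - 1))^-1; have c0 : 0 < c by rewrite invr_gt0 mulr_gt0 // subr_gt0.
have := h2 (Num.truncn c); apply/negP; rewrite -ltNge.
apply: lt_le_trans (_ : a * (1 + (Num.truncn c).+1%:R * (t - 1)) <= _); last first.
  by rewrite ler_pM2l //; apply: bernoulli; exact: ltW.
have : c < (Num.truncn c).+1%:R by exact: truncnS_gt.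
set N := _%:R => cN.
have : c * (a * (t - 1)) < N * (a * (t - 1)) by rewrite ltr_pM2r // mulr_gt0 // subr_gt0.
rewrite mulVf ?gt_eqF ?mulr_gt0 ?subr_gt0 // => h3.
nra.
Qed.

(** Apply the maximum principle to [G ^ m.+1 / f ^ m] on the compact set where
[|f| <= r], then let [m] tend to infinity. The zero of [G] at [y] absorbs the simple
zero of [f]; the extra factor [G] settles the value at [y]. *)
Lemma schwarz D y f f1 G (r : R) : open D -> D y -> smooth D f1 ->
  (forall z, D z -> f1 z != 0) -> (forall z, D z -> f z = (z - y) * f1 z) ->
  0 < r -> compact [set z | D z /\ cmod (f z) <= r] ->
  to_disk D G -> G y = 0 -> forall z, D z -> r * cmod (G z) <= cmod (f z).
Proof.
move=> oD Dy sf1 f10 fE r0 cK [sG G1] Gy z Dz.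
have [fr|fr] := ltP r (cmod (f z)).
  by rewrite (le_trans _ (ltW fr)) // ler_piMr ?ltW // G1.
have sf : smooth D f.
  apply: (@smooth_ext _ _ (fun z => (z - y) * f1 z)) => //; first by move=> w Dw; rewrite fE.
  by apply: smooth_mul => //; apply: smooth_sub => //; [exact: smooth_id|exact: smooth_cst].
have f0 w : D w -> w != y -> f w != 0.
  by move=> Dw wy; rewrite fE // mulf_neq0 ?f10 // subr_eq0.
rewrite mulrC -ler_pdivlMr //; apply: le_of_pow.
- exact: cmod_ge0.
- by rewrite divr_ge0 ?cmod_ge0 // ltW.
move=> m m0.
have [->|zy] := eqVneq z y; first by rewrite Gy cmod0 expr0n /= exprn_ge0 // divr_ge0 ?cmod_ge0 // ltW.
pose h w := G w ^+ m.+1 / f w ^+ m.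
pose U := [set w | [/\ D w, cmod (f w) < r & w != y]].
have oU : open U.
  rewrite openE => w [Dw wr wy]; apply/nbhs_cmodP.
  have [d d0 hd] := open_cball oD Dw.
  have cf := smooth_ccont sf Dw.
  have e0 : 0 < r - cmod (f w) by rewrite subr_gt0.
  have /ccont_ballP/(_ _ e0)[d1 d10 hd1] := cf.
  have wy' : w - y != 0 by rewrite subr_eq0.
  have cwy : ccont (fun w => w - y) w by apply: ccontD; [exact: ccont_id|exact: ccont_cst].
  have [d2 d20 hd2] := @ccont_neq0 _ (fun w => w - y) w wy' cwy.
  exists (Num.min d (Num.min d1 d2)); first by rewrite !lt_min d0 d10.
  move=> v; rewrite !lt_min => /and3P[v1 v2 v3]; split; first exact: hd.
    have := hd1 v v2; have := cmod_subr (f v) (f w); lra.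
  by have := hd2 v v3; rewrite subr_eq0.
have UD : U `<=` D by move=> w [].
suff : cmod (h z) <= r ^- m.
  rewrite /h cmodM cmodV !cmodX expr_div_n ler_pdivrMr; last first.
    by rewrite exprn_gt0 // cmod_gt0 f0.
  by rewrite mulrC.
apply: (@max_principle R [set z | D z /\ cmod (f z) <= r] U h (r ^- m) cK) => //.
- by move=> w [Dw /ltW wr _].
- apply: (@smooth_div _ U (fun w => G w ^+ m.+1) (fun w => f w ^+ m)) => //.
  + by move=> w [Dw _ wy]; rewrite expf_neq0 // f0.
  + by apply: smooth_exp => //; exact: smooth_sub_set sG.
  + by apply: smooth_exp => //; exact: smooth_sub_set sf.
- move=> w [Dw _]; have [->|wy] := eqVneq w y; last first.
    apply: ccontM; first by apply: ccontX; exact: smooth_ccont Dw.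
    apply: (@ccontV _ _ (fun w => f w ^+ m)); first by rewrite expf_neq0 // f0.
    by apply: ccontX; exact: smooth_ccont Dw.
  have [G' dG _] := sG 1%N.
  have [[q [cq _ hq]]] := dG y Dy.
  apply: (@ccont_near _ _ (fun w => (q w / f1 w) ^+ m * G w)).
    have [d d0 hd] := open_cball oD Dy.
    apply/nbhs_cmodP; exists d => // v /hd Dv.
    have Gv : G v = q v * (v - y) by rewrite -hq Gy subr0.
    rewrite /h fE //; have [->|vy] := eqVneq v y.
      by rewrite Gy mulr0 expr0n /= mul0r.
    have vy' : v - y != 0 by rewrite subr_eq0.
    rewrite exprSr mulrAC; congr (_ * _).
    rewrite Gv !exprMn exprVn invfM mulrA; congr (_ / _).
    by rewrite mulfK // expf_neq0.
  apply: ccontM; last exact: smooth_ccont Dy.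
  apply: ccontX; apply: ccontM => //; apply: ccontV; first exact: f10.
  exact: smooth_ccont Dy.
- move=> w [Dw wr] nU; have [->|wy] := eqVneq w y.
    by rewrite /h Gy expr0n /= mul0r cmod0 invr_ge0 exprn_ge0 // ltW.
  have wr' : cmod (f w) = r.
    apply/eqP; rewrite eq_le wr leNgt; apply/negP => lt; exact: nU.
  rewrite /h cmodM cmodV !cmodX wr' ler_piMl //; first by rewrite invr_ge0 exprn_ge0 // ltW.
  by rewrite exprn_ile1 ?cmod_ge0 // ltW // G1.
Qed.
End Schwarz.

(** * Nearly extremal maps *)

Section Extremal.
Variable R : realType.
Implicit Types (z w y : R[i]) (f g : R[i] -> R[i]).
Variables (D : set R[i]) (y : R[i]).
Hypotheses (scD : simply_connected_domain D) (Dy : D y).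
Let oD : open D. Proof. by case: scD => -[]. Qed.

(** An injective map of [D] into the disk with a simple zero at [y]. Injectivity is
stated through a left inverse [p] continuous on the image, which makes preimages of
compact subsets of the image compact; [f1 y] is the derivative at [y]. *)
Definition uniformizer f f1 (p : R[i] -> R[i]) :=
  [/\ to_disk D f, smooth D f1, (forall z, D z -> f1 z != 0),
      (forall z, D z -> f z = (z - y) * f1 z) &
      forall z, D z -> p (f z) = z /\ ccont p (f z)].

Lemma closed_ball_in : exists2 r : R, 0 < r & forall w, cmod (w - y) <= r -> D w.
Proof.
have [d d0 hd] := open_cball oD Dy; exists (d / 2); first by rewrite divr_gt0.
by move=> w h; apply: hd; lra.
Qed.

(** Cauchy's estimate: the maximum principle for [f1] on a closed disk about [y] of
radius [r], on whose boundary [|f1| = |f| / r]. *)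
Lemma uniformizer_bound : exists B, forall f f1 p, uniformizer f f1 p -> cmod (f1 y) <= B.
Proof.
have [r r0 hr] := closed_ball_in; exists r^-1 => f f1 p [[_ fd] sf1 f10 fE _].
have ballD : [set w | cmod (w - y) < r] `<=` D by move=> w /= h; apply: hr; exact: ltW.
apply: (@max_principle R [set w | cmod (w - y) <= r] [set w | cmod (w - y) < r]) => //.
- exact: compact_cball.
- by move=> w /= /ltW.
- rewrite openE => w /= wr; apply/nbhs_cmodP; exists (r - cmod (w - y)); first by rewrite subr_gt0.
  move=> v vw /=; have -> : v - y = (v - w) + (w - y) by ring.
  by have := cmodD (v - w) (w - y); lra.
- exact: csmooth_sub (sf1 2%N).
- by move=> w /= /hr; exact: smooth_ccont.
- move=> w /= wr nw; have Dw := hr w wr.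
  have e : cmod (w - y) = r by apply/eqP; rewrite eq_le wr leNgt; apply/negP.
  have := fd w Dw; rewrite fE // cmodM e => h.
  by rewrite -(ler_pM2l r0) mulfV ?gt_eqF // ltW.
- by rewrite /= subrr cmod0 ltW.
Qed.

(** Let [w0] be outside [D] and [s] a square root of [z - w0]. Since [s] cannot take
both a value and its opposite, it stays away from [- s y], and the map
[(s - s y) / (s + s y)] is bounded and injective. *)
Lemma uniformizer_exists : D <> setT -> exists f f1 p, uniformizer f f1 p.
Proof.
move=> DT; have [w0 nD] : exists w, ~ D w.
  by apply: contrapT => h; apply: DT; apply/seteqP; split=> // w _; apply: contrapT => n; apply: h; exists w.
have sm : smooth D (fun z => z - w0).
  by apply: smooth_sub => //; [exact: smooth_id|exact: smooth_cst].
have [|s ss s2] := smooth_root scD sm.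
  by move=> z Dz; rewrite subr_eq0; apply: contraPneq Dz => ->.
set c := s y.
have s0 z : D z -> s z != 0.
  move=> Dz; apply/eqP => sz; have := s2 z Dz; rewrite sz mul0r => /esym/eqP.
  by rewrite subr_eq0 => /eqP e; apply: nD; rewrite -e.
have c0 : c != 0 by exact: s0.
have cc : 0 < cmod c by rewrite cmod_gt0.
have sq z : D z -> (s z - c) * (s z + c) = z - y.
  by move=> Dz; have := s2 z Dz; have := s2 y Dy; rewrite -/c => e1 e2; rewrite -subr_sqr !expr2 e1 e2; ring.
have c2 : 0 < 3 * cmod c by rewrite mulr_gt0.
(* if s z is close to - c, then (s z - c) (s z + c) = z - y is small, so
   s z is close to c as well, which is absurd as c != 0 *)
have [rho rho0 hrho] : exists2 rho, 0 < rho & forall z, D z -> rho <= cmod (s z + c).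
  have /ccont_ballP/(_ _ cc)[d d0 hd] := smooth_ccont ss Dy.
  exists (Num.min (cmod c) (d / (3 * cmod c))); first by rewrite lt_min cc divr_gt0.
  move=> z Dz; rewrite leNgt; apply/negP; rewrite lt_min => /andP[h1 h2].
  have h3 : cmod (s z - c) <= 3 * cmod c.
    have -> : s z - c = (s z + c) - (c + c) by ring.
    have := cmodD (s z + c) (- (c + c)); rewrite cmodN; have := cmodD c c; lra.
  have : cmod (z - y) < d.
    rewrite -sq // cmodM; apply: le_lt_trans (_ : 3 * cmod c * cmod (s z + c) < d).
      by rewrite ler_wpM2r ?cmod_ge0.
    by rewrite mulrC -ltr_pdivlMr.
  move=> /hd; rewrite -/c => h4.
  have : cmod (c + c) <= cmod (s z + c) + cmod (s z - c).
    have -> : c + c = (s z + c) - (s z - c) by ring.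
    by have := cmodD (s z + c) (- (s z - c)); rewrite cmodN.
  have -> : c + c = 2%:C * c by rewrite rmorph_nat; ring.
  by rewrite cmodM cmod_real ger0_norm //; lra.
have sc0 z : D z -> s z + c != 0.
  by move=> Dz; rewrite -cmod_gt0 (lt_le_trans rho0) // hrho.
(* (s - c) / (s + c) = 1 - 2 c / (s + c) is bounded by 1 + 2 |c| / rho < M *)
pose M : R := 2 * cmod c / rho + 2.
have M0 : 0 < M by rewrite /M ltr_wpDl // divr_ge0 ?mulr_ge0 // ltW.
have MC : M%:C != 0 :> R[i] by apply: realC_neq0; rewrite gt_eqF.
pose f z := (s z - c) / (s z + c) / M%:C.
pose f1 z := ((s z + c) * (s z + c) * M%:C)^-1.
(* solves v = f z for s z and returns s z ^ 2 + w0 = z *)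
pose p v := (c * (1 + M%:C * v) / (1 - M%:C * v)) ^+ 2 + w0.
have ssc (b : R[i]) : smooth D (fun z => s z + b) by apply: smooth_add => //; exact: smooth_cst.
exists f, f1, p; split.
- split.
    apply: smooth_div => //; last exact: smooth_cst.
    by apply: smooth_div => //; exact: ssc.
  move=> z Dz; rewrite /f cmodM cmodV cmod_real ger0_norm ?ltW // ltr_pdivrMr // mul1r.
  have -> : (s z - c) / (s z + c) = 1 - (c + c) / (s z + c) by field; exact: sc0.
  apply: le_lt_trans (cmodD _ _) _; rewrite cmod1 cmodN cmodM cmodV /M.
  have h1 : cmod (c + c) / cmod (s z + c) <= 2 * cmod c / rho.
    apply: ler_pM; rewrite ?cmod_ge0 ?invr_ge0 ?cmod_ge0 //.
      by have := cmodD c c; lra.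
    by rewrite lef_pV2 ?posrE ?hrho ?cmod_gt0 ?sc0.
  lra.
- apply: smooth_inv => //; first by move=> z Dz; rewrite !mulf_neq0 // sc0.
  by apply: smooth_mul; [|apply: smooth_mul|exact: smooth_cst].
- by move=> z Dz; rewrite invr_neq0 // !mulf_neq0 // sc0.
- move=> z Dz; rewrite -sq // /f /f1; field; rewrite MC sc0 //.
move=> z Dz; have h0 := sc0 z Dz.
have e : M%:C * f z = (s z - c) / (s z + c) by rewrite /f; field; rewrite MC h0.
have e1 : 1 - M%:C * f z = (c + c) / (s z + c) by rewrite e; field.
have cc0 : c + c != 0 by rewrite -mulr2n -mulr_natl mulf_eq0 pnatr_eq0 negb_or.
have e10 : 1 - M%:C * f z != 0 by rewrite e1 mulf_neq0 ?invr_neq0.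
split.
  have e2 : 1 + M%:C * f z = (s z + s z) / (s z + c) by rewrite e; field.
  rewrite /p e1 e2.
  have -> : c * ((s z + s z) / (s z + c)) / ((c + c) / (s z + c)) = s z by field; rewrite cc0 h0.
  by rewrite expr2 s2 // subrK.
apply: ccontD; last exact: ccont_cst.
apply: ccontX; apply: ccontM.
  apply: ccontM; first exact: ccont_cst.
  apply: ccontD; first exact: ccont_cst.
  by apply: ccontM; [exact: ccont_cst|exact: ccont_id].
apply: (@ccontV _ _ (fun v => 1 - M%:C * v)) => //.
apply: ccontD; first exact: ccont_cst.
by apply: ccontN; apply: ccontM; [exact: ccont_cst|exact: ccont_id].
Qed.

Lemma uniformizer_y f f1 p : uniformizer f f1 p -> f y = 0.
Proof. by move=> [_ _ _ -> //]; rewrite subrr mul0r. Qed.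

Lemma uniformizer_eq0 f f1 p z : uniformizer f f1 p -> D z -> f z = 0 -> z = y.
Proof.
move=> [_ _ f10 fE _] Dz; rewrite fE // => /eqP; rewrite mulf_eq0 (negbTE (f10 z Dz)) orbF.
by rewrite subr_eq0 => /eqP.
Qed.

(** Koebe's square root trick: if [f] omits [a], then [blaschke a \o f] has a root [s],
and [blaschke (s y) \o s] is again a uniformizer. Writing [x = |s y|], so that
[x^2 = |a|], the derivative at [y] is multiplied by [(1 + x^2) / (2 x) > 1]. *)
Lemma uniformizer_step f f1 p (a : R[i]) : uniformizer f f1 p -> cmod a < 1 ->
  (forall z, D z -> f z != a) ->
  exists g g1 q, uniformizer g g1 q /\ exists2 x : R, 0 <= x & x ^+ 2 = cmod a /\
    2 * x * cmod (g1 y) = (1 + x ^+ 2) * cmod (f1 y).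
Proof.
move=> Uf a1 fa; have fy := uniformizer_y Uf.
have [[sf fd] sf1 f10 fE pf] := Uf.
have tb := to_disk_blaschke oD a1 (conj sf fd).
have [|s ss s2] := smooth_root scD tb.1.
  by move=> z Dz; rewrite blaschke_eq0 ?fd ?fa.
set b := s y.
have b2 : b * b = - a by rewrite s2 // fy blaschke_0.
have a0 : a != 0 by have := fa y Dy; rewrite fy eq_sym.
have b0 : b != 0.
  by apply: contra_neq a0 => bb; move: b2; rewrite bb mul0r => /esym/eqP; rewrite oppr_eq0 => /eqP.
have s1 z : D z -> cmod (s z) < 1.
  move=> Dz; rewrite -(@ltr_pXn2r _ 2) ?nnegrE ?cmod_ge0 // expr1n -cmodX expr2 s2 //.
  exact: tb.2.
have b1 : cmod b < 1 by exact: s1.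
have db z : D z -> 1 - conjc b * s z != 0 by move=> Dz; rewrite blaschke_den ?s1.
have da z : D z -> 1 - conjc a * f z != 0 by move=> Dz; rewrite blaschke_den ?fd.
have aa : 1 - a * conjc a != 0 by rewrite mulrC; apply: blaschke_den.
(* s z = - b forces f z = f y, hence z = y and b = - b *)
have sb z : D z -> s z + b != 0.
  move=> Dz; rewrite addr_eq0; apply/negP => /eqP sz.
  have : s z * s z = b * b by rewrite sz mulrNN.
  rewrite s2 // b2 => /eqP; rewrite -subr_eq0 opprK blaschke_addK ?fd //.
  rewrite !mulf_eq0 invr_eq0 (negbTE (da z Dz)) (negbTE aa) !orbF => /eqP fz.
  have zy := uniformizer_eq0 Uf Dz fz; move: sz; rewrite zy -/b => /eqP.
  by rewrite -addr_eq0 -mulr2n -mulr_natl mulf_eq0 pnatr_eq0 (negbTE b0).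
pose g z := blaschke b (s z).
pose g1 z := f1 z * (1 - a * conjc a) / ((1 - conjc a * f z) * (s z + b) * (1 - conjc b * s z)).
(* f is recovered from g by undoing the two Blaschke factors and the root *)
pose q v := p (blaschke (- a) (blaschke (- b) v ^+ 2)).
exists g, g1, q; split.
  split.
  - exact: to_disk_blaschke.
  - apply: smooth_div => //.
    + by move=> z Dz; rewrite !mulf_neq0 ?da ?sb ?db.
    + by apply: smooth_mul => //; exact: smooth_cst.
    + apply: smooth_mul => //; first apply: smooth_mul => //.
      * apply: smooth_sub => //; first exact: smooth_cst.
        by apply: smooth_mul => //; exact: smooth_cst.
      * by apply: smooth_add => //; exact: smooth_cst.
      * apply: smooth_sub => //; first exact: smooth_cst.
        by apply: smooth_mul => //; exact: smooth_cst.
  - by move=> z Dz; rewrite !mulf_neq0 ?invr_neq0 ?mulf_neq0 ?da ?sb ?db ?f10.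
  - move=> z Dz; have e : (s z - b) * (s z + b) = f z * (1 - a * conjc a) / (1 - conjc a * f z).
      by rewrite -subr_sqr !expr2 s2 // b2 opprK blaschke_addK ?fd.
    have e2 : s z - b = f z * (1 - a * conjc a) / (1 - conjc a * f z) / (s z + b).
      by rewrite -e mulfK // sb.
    rewrite /g /blaschke e2 /g1 fE //; field.
    by rewrite -fE // da // sb // db.
  - move=> z Dz; have [pz cp] := pf z Dz.
    have e1 : blaschke (- b) (g z) = s z by rewrite blaschkeK ?s1.
    have e2 : blaschke (- a) (blaschke (- b) (g z) ^+ 2) = f z by rewrite e1 expr2 s2 // blaschkeK ?fd.
    split; first by rewrite /q e2.
    apply: (@ccont_comp _ _ (fun v => blaschke (- a) (blaschke (- b) v ^+ 2))); last by rewrite e2.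
    apply: (@ccont_comp _ _ (fun v => blaschke (- b) v ^+ 2) (blaschke (- a))).
      by apply: ccontX; apply: ccont_blaschke; rewrite ?cmodN // blaschke_lt1 // s1.
    apply: ccont_blaschke; rewrite ?cmodN // e1 expr2 s2 //; exact: tb.2.
exists (cmod b); first exact: cmod_ge0.
have bba : cmod b ^+ 2 = cmod a by rewrite -cmodX expr2 b2 cmodN.
split=> //.
have bb : 1 - conjc b * b = (1 - cmod b ^+ 2)%:C by rewrite mulrC mulcJ rmorphB rmorph1.
have aE : 1 - a * conjc a = (1 - cmod b ^+ 2)%:C * (1 + cmod b ^+ 2)%:C.
  rewrite mulcJ -bba !rmorphB !rmorph1 rmorphD rmorph1 !rmorphXn /=; ring.
have b21 : cmod b ^+ 2 < 1 by rewrite bba.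
have d0 : (1 - cmod b ^+ 2)%:C != 0 :> R[i] by apply: realC_neq0; rewrite gt_eqF // subr_gt0.
have -> : g1 y = f1 y * (1 + cmod b ^+ 2)%:C / (2%:C * b).
  rewrite /g1 fy -/b mulr0 subr0 mul1r bb aE [2%:C](rmorph_nat (real_complex R) 2).
  have bb0 : b + b != 0 by rewrite -mulr2n -mulr_natl mulf_eq0 pnatr_eq0 negb_or.
  have gen (F c u v : R[i]) : c != 0 -> c + c != 0 -> u != 0 ->
      F * (u * v) / ((c + c) * u) = F * v / (2 * c).
    by move=> c0 cc0 u0; field; rewrite c0 u0 cc0.
  exact: gen.
rewrite !cmodM cmodV cmodM !cmod_real [`|2|]ger0_norm // ger0_norm; last first.
  by rewrite addr_ge0 ?exprn_ge0 ?cmod_ge0.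
by field; rewrite gt_eqF // cmod_gt0.
Qed.

(** Choose [f] with [|f1 y|] within the factor [2 t / (1 + t^2)] of the supremum,
[t = sqrt r]. By [uniformizer_step] it omits no value of modulus at most [r], so
[|f| <= r] is the image under the left inverse of a closed disk, hence compact,
and [schwarz] applies. *)
Lemma near_extremal (r : R) : D <> setT -> 0 < r -> r < 1 ->
  exists f f1, [/\ to_disk D f, smooth D f1, (forall z, D z -> f1 z != 0),
    (forall z, D z -> f z = (z - y) * f1 z) &
    forall g, to_disk D g -> g y = 0 -> forall z, D z -> r * cmod (g z) <= cmod (f z)].
Proof.
move=> DT r0 r1.
pose E := [set x | exists f f1 p, uniformizer f f1 p /\ x = cmod (f1 y)].
have [f0 [f10 [p0 U0]]] := uniformizer_exists DT.
have supE : has_sup E.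
  split; first by exists (cmod (f10 y)), f0, f10, p0.
  have [B hB] := uniformizer_bound; exists B => x [f [f1 [p [Uf ->]]]]; exact: hB Uf.
have s0 : 0 < sup E.
  have E0 : E (cmod (f10 y)) by exists f0, f10, p0.
  apply: lt_le_trans (sup_upper_bound supE E0).
  by rewrite cmod_gt0; case: U0 => _ _ h _ _; exact: h.
pose t := Num.sqrt r.
have t0 : 0 < t by rewrite sqrtr_gt0.
have t2 : t ^+ 2 = r by rewrite sqr_sqrtr // ltW.
have t1 : t < 1 by rewrite -(@ltr_pXn2r _ 2) ?nnegrE ?ltW // t2 expr1n.
pose e := sup E * (1 - 2 * t / (1 + t ^+ 2)).
have tp : 0 < 1 + t ^+ 2 by rewrite t2 addr_gt0.
have e0 : 0 < e.
  rewrite mulr_gt0 // subr_gt0 ltr_pdivrMr // mul1r -subr_gt0.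
  have -> : 1 + t ^+ 2 - 2 * t = (1 - t) ^+ 2 by ring.
  by rewrite exprn_gt0 // subr_gt0.
have [x [f [f1 [p [Uf xE]]]] xe] := sup_adherent e0 supE.
(* an omitted a would give a derivative above sup E, as b |-> 2 b / (1 + b^2)
   increases on [0, 1] and b <= t *)
have onto a : cmod a <= r -> exists2 z, D z & f z = a.
  move=> ar; apply: contrapT => na.
  have a1 : cmod a < 1 by exact: le_lt_trans r1.
  have [|g [g1 [q [Ug [b b0 [b2 hb]]]]]] := uniformizer_step Uf a1.
    by move=> z Dz; apply/eqP => fz; apply: na; exists z.
  have gs : cmod (g1 y) <= sup E.
    by apply: (sup_upper_bound supE); exists g, g1, q.
  have bt : b <= t by rewrite -(@ler_pXn2r _ 2) ?nnegrE // ?b2 ?t2 // ltW.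
  have h1 : sup E * (2 * t) < (1 + t ^+ 2) * x.
    have -> : sup E * (2 * t) = (1 + t ^+ 2) * (sup E - e).
      by rewrite /e; field; rewrite gt_eqF.
    by rewrite ltr_pM2l.
  have h2 : (1 + b ^+ 2) * x <= 2 * b * sup E.
    by rewrite xE -hb ler_wpM2l // mulr_ge0.
  have x0 : 0 < x by rewrite xE cmod_gt0; case: Uf => _ _ h _ _; exact: h.
  have h3 : b * (sup E * (2 * t)) <= b * ((1 + t ^+ 2) * x) by rewrite ler_wpM2l // ltW.
  have h4 : t * ((1 + b ^+ 2) * x) <= t * (2 * b * sup E) by rewrite ler_pM2l.
  have h5 : t * (1 + b ^+ 2) <= b * (1 + t ^+ 2).
    rewrite -(ler_pM2r x0) -!mulrA; apply: le_trans h4 _; apply: le_trans h3.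
    by rewrite le_eqVlt; apply/orP; left; apply/eqP; ring.
  have h6 : (t - b) * (1 - t * b) <= 0.
    have -> : (t - b) * (1 - t * b) = t * (1 + b ^+ 2) - b * (1 + t ^+ 2) by ring.
    by rewrite subr_le0.
  have tb1 : 0 < 1 - t * b.
    rewrite subr_gt0; apply: le_lt_trans (_ : t * 1 < 1); last by rewrite mulr1.
    by rewrite ler_pM2l // (le_trans bt) // ltW.
  have h7 : b = t.
    by apply/eqP; rewrite eq_le bt -subr_le0 -(pmulr_lle0 _ tb1).
  move: h2 h1; rewrite h7; lra.
have [[sf fd] sf1 f1n fE pf] := Uf.
exists f, f1; split=> // g tg gy.
apply: (@schwarz _ D y f f1) => //.
have -> : [set z | D z /\ cmod (f z) <= r] = p @` [set a | cmod (a - 0) <= r].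
  apply/seteqP; split=> [z [Dz fr]|_ [a /= ar <-]] /=.
    by exists (f z); [rewrite subr0|have [-> _] := pf z Dz].
  rewrite subr0 in ar; have [z Dz fz] := onto a ar.
  by rewrite -fz; have [-> _] := pf z Dz; rewrite fz.
apply: continuous_compact; last exact: compact_cball.
apply: continuous_in_subspaceT => a; rewrite inE /= subr0 => ar.
have [z Dz fz] := onto a ar; have [_ cp] := pf z Dz.
by apply/ccontP; rewrite -fz.
Qed.
End Extremal.

(** * Separation of points and its addition along the real axis *)

Section Separation.
Variable R : realType.
Implicit Types (z w : R[i]) (f g : R[i] -> R[i]) (a b c r t : R) (D : set R[i]).

Lemma conjM z w : conjc (z * w) = conjc z * conjc w.
Proof. exact: (rmorphM (@conjc R)). Qed.

Lemma conjB z w : conjc (z - w) = conjc z - conjc w.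
Proof. exact: (rmorphB (@conjc R)). Qed.

(** The Caratheodory pseudo-distance of [p] and [q] in the disk model is at least
[c]. The factor [r < 1] asks for nearly extremal maps only. *)
Definition sep D (p q : R[i]) c := forall r, 0 < r -> r < 1 ->
  exists g, [/\ to_disk D g, g p = 0 & r * c <= cmod (g q)].

Lemma sep_le D p q c c' : c' <= c -> sep D p q c -> sep D p q c'.
Proof.
move=> cc h r r0 r1; have [g [tg gp gq]] := h r r0 r1; exists g; split=> //.
by rewrite (le_trans _ gq) // ler_pM2l.
Qed.

Lemma sep_sym D p q c : open D -> D q -> sep D p q c -> sep D q p c.
Proof.
move=> oD Dq h r r0 r1; have [g [tg gp gq]] := h r r0 r1.
have gq1 : cmod (g q) < 1 by exact: tg.2.
exists (fun z => blaschke (g q) (g z)); split; first exact: to_disk_blaschke.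
  exact: blaschke_xx.
by rewrite gp blaschke_0 cmodN.
Qed.

Lemma sep_refl D p : open D -> sep D p p 0.
Proof.
move=> oD r r0 r1; exists (fun=> 0); split=> //; last by rewrite mulr0 cmod0.
by split=> [|z _]; [exact: smooth_cst|rewrite cmod0].
Qed.

Lemma le_of_mul_lt1 (a b : R) : (forall r, 0 < r -> r < 1 -> r * a <= b) -> a <= b.
Proof.
move=> h; rewrite leNgt; apply/negP => ba.
have h2 := h (1 / 2); have b0 : a / 2 <= b by have := h2 _ _; lra.
have [a0|a0] := leP a 0; first by lra.
pose r := (1 + b / a) / 2.
have ba0 : 0 < b / a by rewrite divr_gt0 //; lra.
have ba1 : b / a < 1 by rewrite ltr_pdivrMr // mul1r.
have : r * a <= b by apply: h; rewrite /r; lra.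
have -> : r * a = (a + b) / 2 by rewrite /r; field; rewrite gt_eqF.
lra.
Qed.

(** The same map serves all [z]; in a product over several nodes, [c] may thus be
chosen after the maps. *)
Lemma near_extremal_sep D y r : simply_connected_domain D -> D <> setT -> D y ->
  0 < r -> r < 1 ->
  exists f f1, [/\ to_disk D f, smooth D f1, (forall z, D z -> f1 z != 0),
    (forall z, D z -> f z = (z - y) * f1 z) &
    forall z c, D z -> sep D y z c -> r * c <= cmod (f z)].
Proof.
move=> scD DT Dy r0 r1.
have [f [f1 [tf sf1 f10 fE ext]]] := near_extremal scD Dy DT r0 r1.
exists f, f1; split=> // z c Dz h; apply: le_of_mul_lt1 => s s0 s1.
have [g [tg gy gz]] := h s s0 s1.
by apply: le_trans (ext g tg gy z Dz); rewrite mulrCA ler_pM2l.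
Qed.

(** The addition law of tanh, that is, of collinear distances in the disk. *)
Definition hyp_add a b := (a + b) / (1 + a * b).

Lemma hyp_add_mono (a a' b : R) : 0 <= a -> a <= a' -> 0 <= b -> b <= 1 ->
  hyp_add a b <= hyp_add a' b.
Proof.
move=> a0 aa b0 b1; have a'0 := le_trans a0 aa.
have h1 : 0 < 1 + a * b by rewrite ltr_wpDr // mulr_ge0.
have h2 : 0 < 1 + a' * b by rewrite ltr_wpDr // mulr_ge0.
rewrite /hyp_add ler_pdivrMr // mulrAC ler_pdivlMr // -subr_ge0.
have -> : (a' + b) * (1 + a * b) - (a + b) * (1 + a' * b) = (a' - a) * (1 - b ^+ 2) by ring.
by rewrite mulr_ge0 ?subr_ge0 // exprn_ile1.
Qed.

Lemma hyp_addC a b : hyp_add a b = hyp_add b a.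
Proof. by rewrite /hyp_add addrC [a * b]mulrC. Qed.

Lemma segment_point (x z y t : R) : x <= y <= z -> x <= t <= z ->
  forall s : R, 0 <= s <= 1 -> x <= y + s * (t - y) <= z.
Proof.
by move=> /andP[? ?] /andP[? ?] s /andP[? ?]; apply/andP; split; nra.
Qed.

(** On an interval a root of a positive function keeps its sign, by [root_rigid]. *)
Lemma root_on_segment (S : R[i] -> R[i]) (m : R -> R) (x z y : R) :
  x <= y <= z ->
  (forall t, x <= t <= z -> ccont S t%:C) ->
  (forall t, x <= t <= z -> {for t, continuous m}) ->
  (forall t, x <= t <= z -> 0 < m t) ->
  (forall t, x <= t <= z -> S t%:C * S t%:C = (m t * m t)%:C) ->
  S y%:C = (m y)%:C -> forall t, x <= t <= z -> S t%:C = (m t)%:C.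
Proof.
move=> xyz cS cm m0 S2 Sy t ht.
have sp := segment_point xyz ht.
pose u (s : R) := (t - y) * s + y.
have uE s : u s = y + s * (t - y) by rewrite /u addrC mulrC.
have cu s : {for s, continuous u} by exact: continuous_affine.
have u1 : u 1 = t by rewrite uE mul1r addrC subrK.
have u0 : u 0 = y by rewrite uE mul0r addr0.
rewrite -u1; apply: (@root_rigid _ (fun s => S (u s)%:C) (fun s => (m (u s))%:C)).
- move=> s hs; apply: (@ccont_comp _ _ (fun s => (u s)%:C)).
    by apply: ccont_real.
  by apply: cS; rewrite uE; exact: sp.
- move=> s hs; apply: ccont_real; apply: (@continuous_comp _ _ _ u m) => //.
  by apply: cm; rewrite uE; exact: sp.
- by move=> s hs; rewrite S2 ?uE ?sp // rmorphM.
- by move=> s hs; apply: realC_neq0; rewrite gt_eqF // m0 // uE sp.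
- by rewrite u0.
- by rewrite lexx ler01.
Qed.

Lemma cont_cmod_real f x : ccont f x%:C -> {for x, continuous (fun t : R => cmod (f t%:C))}.
Proof.
move=> cf; apply: (@ccont_cmod _ _ (fun t : R => f t%:C)).
apply: (@ccont_comp _ _ (fun t : R => t%:C)) => //.
by apply: ccont_real; exact: cvg_id.
Qed.

(** With [f] nearly extremal at [y], the map [F = (w - y) * S], where [S] is a
root of [f1 w * conj (f1 (conj w))], sends [x], [y], [z] to [- al], 0, [be] on one
diameter, with [al], [be] at least [r a], [r b]; a Blaschke factor moves [- al]
to 0. *)
Lemma sep_add D (x y z a b : R) : simply_connected_domain D -> D <> setT ->
  symmetric_real_axis D -> (forall t, x <= t <= z -> D t%:C) -> x <= y <= z ->
  0 <= a -> 0 <= b -> sep D x%:C y%:C a -> sep D y%:C z%:C b ->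
  sep D x%:C z%:C (hyp_add a b).
Proof.
move=> scD DT symD Dseg xyz a0 b0 sxy syz r r0 r1.
have oD : open D by case: scD => -[].
have /andP[xy yz] := xyz; have xz := le_trans xy yz.
have Dx : D x%:C by apply: Dseg; rewrite lexx.
have Dy : D y%:C by exact: Dseg.
have Dz : D z%:C by apply: Dseg; rewrite lexx xz.
have syx := sep_sym oD Dy sxy.
have [f [f1 [[sf fd] sf1 f10 fE ext]]] := near_extremal_sep scD DT Dy r0 r1.
pose f1c w := conjc (f1 (conjc w)).
have cD w : D w -> D (conjc w) by exact: symD.
have sf1c : smooth D f1c by exact: smooth_conj.
have f1c0 w : D w -> f1c w != 0 by move=> Dw; rewrite conjc_eq0; apply: f10; exact: cD.
have sp : smooth D (fun w => f1 w * f1c w) by exact: smooth_mul.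
have [|S0 sS0 S02] := smooth_root scD sp; first by move=> w Dw; rewrite mulf_neq0 ?f10 ?f1c0.
have S0y : S0 y%:C = (cmod (f1 y%:C))%:C \/ S0 y%:C = - (cmod (f1 y%:C))%:C.
  by apply: sqr_eq_or; rewrite S02 // /f1c conjc_real mulcJ -rmorphM expr2.
(* of the two roots, the one positive at y, hence on the whole segment *)
have [S [sS S2 Sy]] : exists S, [/\ smooth D S, (forall w, D w -> S w * S w = f1 w * f1c w) &
    S y%:C = (cmod (f1 y%:C))%:C].
  case: S0y => e; first by exists S0.
  exists (fun w => - S0 w); split; first exact: smooth_opp.
    by move=> w Dw; rewrite mulrNN S02.
  by rewrite e opprK.
have SE : forall t, x <= t <= z -> S t%:C = (cmod (f1 t%:C))%:C.
  apply: (@root_on_segment S (fun t => cmod (f1 t%:C)) x z y xyz) => //.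
  - by move=> t ht; apply: smooth_ccont sS _; exact: Dseg.
  - by move=> t ht; apply: cont_cmod_real; apply: smooth_ccont sf1 _; exact: Dseg.
  - by move=> t ht; rewrite cmod_gt0; apply: f10; exact: Dseg.
  - by move=> t ht; rewrite (S2 _ (Dseg t ht)) /f1c conjc_real mulcJ expr2.
pose F w := (w - y%:C) * S w.
have tF : to_disk D F.
  split.
    by apply: smooth_mul => //; apply: smooth_sub => //; [exact: smooth_id|exact: smooth_cst].
  move=> w Dw; have h1 := fd w Dw; have h2 := fd _ (cD w Dw).
  (* both factors on the right have modulus less than 1 *)
  have e : F w * F w = f w * conjc (f (conjc w)).
    have -> : conjc (f (conjc w)) = (w - y%:C) * conjc (f1 (conjc w)).
      by rewrite (fE _ (cD w Dw)) conjM conjB conjcK conjc_real.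
    by rewrite /F mulrACA S2 // /f1c (fE w Dw); ring.
  have : cmod (F w) ^+ 2 < 1.
    rewrite -cmodX expr2 e cmodM cmodJ.
    have [->|n0] := eqVneq (cmod (f w)) 0; first by rewrite mul0r.
    by rewrite mulr_ilt1 ?cmod_ge0.
  by move=> h; rewrite -(@ltr_pXn2r _ 2) ?nnegrE ?cmod_ge0 // expr1n.
set al := cmod (f x%:C); set be := cmod (f z%:C).
have Fx : F x%:C = - al%:C.
  rewrite /F SE ?lexx // /al fE // cmodM -rmorphB cmod_real ler0_norm ?subr_le0 //.
  by rewrite -rmorphM -rmorphN mulNr opprK.
have Fz : F z%:C = be%:C.
  rewrite /F SE ?lexx ?andbT // /be fE // cmodM -rmorphB cmod_real ger0_norm ?subr_ge0 //.
  by rewrite rmorphM.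
have al0 : 0 <= al := cmod_ge0 _. have be0 : 0 <= be := cmod_ge0 _.
have al1 : al < 1 by exact: fd. have be1 : be < 1 by exact: fd.
have ra : r * a <= al by exact: ext.
have rb : r * b <= be by exact: ext.
have alC : cmod (- al%:C : R[i]) < 1 by rewrite cmodN cmod_real ger0_norm.
exists (fun w => blaschke (- al%:C) (F w)); split; first exact: to_disk_blaschke.
  by rewrite Fx blaschke_xx.
have -> : blaschke (- al%:C) (F z%:C) = (hyp_add al be)%:C.
  have cal : conjc (- al%:C) = - al%:C :> R[i] by rewrite -rmorphN conjc_real.
  rewrite Fz /blaschke cal opprK mulNr opprK /hyp_add.
  by rewrite rmorphM fmorphV !rmorphD rmorph1 rmorphM addrC.
have den : 0 < 1 + al * be by rewrite ltr_wpDr // mulr_ge0.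
rewrite cmod_real ger0_norm; last by apply: divr_ge0; [exact: addr_ge0|exact: ltW].
have ra0 : 0 <= r * a by rewrite mulr_ge0 // ltW.
have rb0 : 0 <= r * b by rewrite mulr_ge0 // ltW.
have ra1 : r * a <= 1 by rewrite (le_trans ra) // ltW.
apply: le_trans (_ : hyp_add (r * a) be <= _); last by apply: hyp_add_mono => //; exact: ltW.
apply: le_trans (_ : hyp_add (r * a) (r * b) <= _); last first.
  by rewrite hyp_addC [hyp_add (r * a) _]hyp_addC; exact: hyp_add_mono.
have d1 : 0 < 1 + a * b by rewrite ltr_wpDr // mulr_ge0.
have d2 : 0 < 1 + r * a * (r * b) by rewrite ltr_wpDr // mulr_ge0.
rewrite /hyp_add mulrA mulrDr ler_wpM2l ?addr_ge0 //.
rewrite lef_pV2 ?posrE // lerD2l mulrACA ler_piMl ?mulr_ge0 //.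
by rewrite mulr_ile1 // ltW.
Qed.
End Separation.

(** * Maps of symmetric domains into the slit plane *)

Section LocalGeneral.
Variable R : realType.
Implicit Types (z w : R[i]) (f g : R[i] -> R[i]) (a b c r t : R).
Variable D : set R[i].
Hypotheses (scD : simply_connected_domain D) (symD : symmetric_real_axis D).
Let oD : open D. Proof. by case: scD => -[]. Qed.
Let cD w : D w -> D (conjc w). Proof. exact: symD. Qed.

(** Otherwise [z - t2] has a root [s] on [D]. It is real at [t3] and imaginary at
[t1]; but [s] and its reflection, which are roots of the same function and agree at
[t3], agree at [t1] by rigidity along a path in [D]. *)
Lemma real_trace_itv (t1 t2 t3 : R) : t1 < t2 -> t2 < t3 -> D t1%:C -> D t3%:C -> D t2%:C.
Proof.
move=> t12 t23 D1 D3; apply: contrapT => nD.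
pose f w := w - t2%:C.
have sf : smooth D f by apply: smooth_sub => //; [exact: smooth_id|exact: smooth_cst].
have f0 w : D w -> f w != 0 by move=> Dw; rewrite subr_eq0; apply: contraPneq Dw => ->.
have [s ss s2] := smooth_root scD sf f0.
have s23 := s2 _ D3; have s21 := s2 _ D1.
have cf w : D w -> ccont f w by exact: smooth_ccont.
have conD : connected D by case: scD => -[].
have [r [g [h [cgh gh [g0 h0] [g1 h1]]]]] := lifted_all oD conD cf f0 D3 s23 D1.
(* z - t2 is positive at t3 and negative at t1 *)
have real3 : conjc (s t3%:C) = s t3%:C.
  have h3 : 0 < t3 - t2 by rewrite subr_gt0.
  have : s t3%:C * s t3%:C = (Num.sqrt (t3 - t2))%:C * (Num.sqrt (t3 - t2))%:C.
    by rewrite s23 /f -rmorphM -expr2 sqr_sqrtr ?ltW // rmorphB.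
  by move=> /sqr_eq_or[] ->; rewrite ?rmorphN /= ?conjc_real // oppr0.
have := @root_rigid R (fun t => conjc (s (conjc (g t)))) (fun t => s (g t)).
have Dg t : D (g t) by case: (gh t).
have cg t : ccont g t by case: (cgh t).
move=> /(_ _ _ _ _ _ 1); rewrite g1 conjc_real => H.
have real1 : conjc (s t1%:C) = s t1%:C.
  apply: H.
  - move=> t _; apply: (@ccont_comp _ _ (fun t => s (conjc (g t)))); last exact: ccont_conj.
    apply: (@ccont_comp _ _ (fun t => conjc (g t))).
      by apply: (@ccont_comp _ _ g) => //; exact: ccont_conj.
    by apply: smooth_ccont ss _; exact: cD.
  - by move=> t _; apply: (@ccont_comp _ _ g) => //; exact: smooth_ccont ss _.
  - move=> t _; rewrite -conjM s2 ?s2 //; last exact: cD.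
    by rewrite /f conjB conjcK conjc_real.
  - move=> t _; have := f0 _ (Dg t); rewrite -s2 // mulf_eq0 negb_or => /andP[] //.
  - by rewrite g0 conjc_real.
  - by rewrite ler01 lexx.
have : (cmod (s t1%:C) ^+ 2)%:C = (t1 - t2)%:C :> R[i].
  by rewrite -mulcJ real1 s21 /f rmorphB.
move/complexI => e; have := sqr_ge0 (cmod (s t1%:C)); rewrite e; lra.
Qed.

Lemma real_trace_le (t1 t2 t3 : R) : t1 <= t2 <= t3 -> D t1%:C -> D t3%:C -> D t2%:C.
Proof.
case/andP; rewrite le_eqVlt => /predU1P[->//|t12].
rewrite le_eqVlt => /predU1P[->//|t23]; exact: real_trace_itv.
Qed.

Lemma not_slit z : cmod z + complex.Re z <= 0 -> exists2 r : R, 0 <= r & z = - r%:C.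
Proof.
move=> h; exists (cmod z); first exact: cmod_ge0.
have e := sqr_cmod z; have h1 := cmod_ge0 z.
have h2 : complex.Re z ^+ 2 <= cmod z ^+ 2 by rewrite e lerDl sqr_ge0.
have h3 : complex.Re z = - cmod z.
  have := Re_le_cmod z; rewrite ler_norml => /andP[h4 _]; apply/eqP; rewrite eq_le h4 andbT; lra.
have h5 : complex.Im z = 0.
  by move: e; rewrite h3 sqrrN => e; apply/eqP; rewrite -sqrf_eq0 -(addKr (cmod z ^+ 2) (complex.Im z ^+ 2)) -e addNr.
by rewrite -rmorphN; apply/eqP; rewrite eq_complex /= h3 h5 !eqxx.
Qed.

(** The last identity is a finite-difference form of
[u' / u = 1 / |t - w|], the density that yields the constant 1/4 after a root and
a Cayley transform. *)
Definition slit_map (w : R[i]) f (u : R -> R) :=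
  [/\ smooth D f, (forall z, D z -> 0 < cmod (f z) + complex.Re (f z)),
      (forall t, D t%:C -> 0 < u t /\ f t%:C = (u t)%:C) &
      (forall t t', D t%:C -> D t'%:C ->
        `|u t' - u t| * (cmod (t%:C - w) + cmod (t'%:C - w)) =
        `|t' - t| * (u t + u t'))].

(** [D] meets the real axis on one side of [x] only, so [z - x] or [x - z] works. *)
Lemma slit_map_real (x t0 : R) : D t0%:C -> ~ D x%:C -> exists f u, slit_map x%:C f u.
Proof.
move=> D0 nD.
have x0 : x != t0 by apply: contraPneq nD => ->.
have [lt|lt|e] := ltgtP x t0; last by rewrite e eqxx in x0.
  have pos t : D t%:C -> x < t.
    move=> Dt; rewrite ltNge; apply/negP => tx; apply: nD.
    by apply: real_trace_le Dt D0; rewrite tx ltW.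
  exists (fun z => z - x%:C), (fun t => t - x); split.
  - by apply: smooth_sub => //; [exact: smooth_id|exact: smooth_cst].
  - move=> z Dz; rewrite ltNge; apply/negP => /not_slit[r r0 e].
    have zE : z = (x - r)%:C by rewrite rmorphB -e addrC subrK.
    by have := pos (x - r); rewrite -zE => /(_ Dz); lra.
  - by move=> t /pos xt; rewrite subr_gt0 xt rmorphB.
  - move=> t t' /pos xt /pos xt'; rewrite -!rmorphB !cmod_real.
    rewrite [`|t - x|]ger0_norm ?subr_ge0 ?ltW // [`|t' - x|]ger0_norm ?subr_ge0 ?ltW //.
    by have -> : t' - x - (t - x) = t' - t by ring.
have neg t : D t%:C -> t < x.
  move=> Dt; rewrite ltNge; apply/negP => tx; apply: nD.
  by apply: real_trace_le D0 Dt; rewrite tx ltW.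
exists (fun z => x%:C - z), (fun t => x - t); split.
- by apply: smooth_sub => //; [exact: smooth_cst|exact: smooth_id].
- move=> z Dz; rewrite ltNge; apply/negP => /not_slit[r r0 e].
  have zE : z = (x + r)%:C.
    have -> : z = x%:C - (x%:C - z) by ring.
    by rewrite e opprK rmorphD.
  by have := neg (x + r); rewrite -zE => /(_ Dz); lra.
- by move=> t /neg xt; rewrite subr_gt0 xt rmorphB.
- move=> t t' /neg xt /neg xt'; rewrite -!rmorphB !cmod_real.
  rewrite [`|t - x|]ler0_norm ?subr_le0 ?ltW // [`|t' - x|]ler0_norm ?subr_le0 ?ltW //.
  have -> : x - t' - (x - t) = - (t' - t) by ring.
  by rewrite normrN; congr (_ * _); ring.
Qed.

(** [f z = z - x + S z] with [S] a root of [(z - w) * (z - conj w)], which equals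
[(z - x)^2 + v^2]. If [f z = - r], then solving for [z] shows that [z] is real,
where however [f z = z - x + |z - w| > 0]. *)
Lemma slit_map_nonreal (w : R[i]) (t0 : R) : D t0%:C -> ~ D w -> complex.Im w != 0 ->
  exists f u, slit_map w f u.
Proof.
move=> D0 nD v0; set x := complex.Re w; set v := complex.Im w in v0.
have nD' : ~ D (conjc w) by move=> /cD; rewrite conjcK.
pose p z := (z - w) * (z - conjc w).
have sp : smooth D p.
  apply: smooth_mul => //; apply: smooth_sub => //; first exact: smooth_id.
  + exact: smooth_cst.
  + exact: smooth_id.
  + exact: smooth_cst.
have pE z : p z = (z - x%:C) ^+ 2 + (v ^+ 2)%:C.
  rewrite /p /x /v; case: (w) => a b; case: z => c d.
  by apply/eqP; rewrite eq_complex /=; apply/andP; split; apply/eqP; ring.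
have p0 z : D z -> p z != 0.
  by move=> Dz; rewrite mulf_neq0 // subr_eq0; apply: contraPneq Dz => ->.
have pR t : p t%:C = (cmod (t%:C - w) * cmod (t%:C - w))%:C.
  by rewrite /p -expr2 -mulcJ conjB conjc_real.
have dR t : cmod (t%:C - w) ^+ 2 = (t - x) ^+ 2 + v ^+ 2.
  by rewrite sqr_cmod /x /v; case: (w) => a b /=; ring.
have d0 t : `|t - x| < cmod (t%:C - w).
  rewrite -(@ltr_pXn2r _ 2) ?nnegrE ?cmod_ge0 // dR real_normK ?num_real // ltrDl.
  by rewrite exprn_even_gt0.
have [S1 sS1 S12] := smooth_root scD sp p0.
have [S [sS S2 St0]] : exists S, [/\ smooth D S, (forall z, D z -> S z * S z = p z) &
    S t0%:C = (cmod (t0%:C - w))%:C].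
  have : S1 t0%:C = (cmod (t0%:C - w))%:C \/ S1 t0%:C = - (cmod (t0%:C - w))%:C.
    by apply: sqr_eq_or; rewrite S12 // pR rmorphM.
  case=> e; first by exists S1.
  exists (fun z => - S1 z); split; [exact: smooth_opp| |by rewrite e opprK].
  by move=> z Dz; rewrite mulrNN S12.
have SE t : D t%:C -> S t%:C = (cmod (t%:C - w))%:C.
  move=> Dt; pose lo := Num.min t t0; pose hi := Num.max t t0.
  have seg s : lo <= s <= hi -> D s%:C.
    move=> h; apply: (@real_trace_le lo s hi) => //.
      by rewrite /lo; case: leP.
    by rewrite /hi; case: leP.
  have mem0 : lo <= t0 <= hi by rewrite /lo /hi ge_min le_max !lexx !orbT.
  apply: (@root_on_segment R S (fun t => cmod (t%:C - w)) lo hi t0 mem0).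
  - by move=> s /seg; exact: smooth_ccont.
  - move=> s _; apply: (@cont_cmod_real _ (fun z => z - w)).
    by apply: ccontD; [exact: ccont_id|exact: ccont_cst].
  - by move=> s _; rewrite (le_lt_trans _ (d0 s)).
  - by move=> s /seg Ds; rewrite S2 // pR.
  - exact: St0.
  - by rewrite /lo /hi ge_min le_max !lexx.
exists (fun z => z - x%:C + S z), (fun t => t - x + cmod (t%:C - w)); split.
- by apply: smooth_add => //; apply: smooth_sub => //; [exact: smooth_id|exact: smooth_cst].
- move=> z Dz; rewrite ltNge; apply/negP => /not_slit[r r0 e].
  have SzE : S z = - (r%:C + (z - x%:C)) by rewrite opprD -e; ring.
  have h := S2 z Dz; rewrite SzE pE in h.
  have h2 : r%:C * (r%:C + 2%:R * (z - x%:C)) = (v ^+ 2)%:C.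
    apply: (@addIr _ ((z - x%:C) ^+ 2)); rewrite [RHS]addrC -h; ring.
  (* r (r + 2 (z - x)) = v^2 with v != 0 makes r nonzero and z real *)
  have r1 : r != 0.
    apply/eqP => r00; move: h2; rewrite r00 mul0r => /complexI/esym/eqP.
    by rewrite expf_eq0 (negbTE v0) andbF.
  have zE : z = (x + (v ^+ 2 / r - r) / 2)%:C.
    have h3 : r%:C + 2%:R * (z - x%:C) = (v ^+ 2 / r)%:C.
      have -> : (v ^+ 2 / r)%:C = (v ^+ 2)%:C / r%:C by rewrite rmorphM fmorphV.
      by rewrite -h2 mulrAC divff ?mul1r // realC_neq0.
    have h4 : z - x%:C = ((v ^+ 2 / r - r) / 2)%:C.
      have -> : z - x%:C = (r%:C + 2%:R * (z - x%:C) - r%:C) / 2%:R by field.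
      by rewrite h3 -rmorphB -(rmorph_nat (real_complex R) 2) -fmorphV -rmorphM.
    have -> : (x + (v ^+ 2 / r - r) / 2)%:C = x%:C + ((v ^+ 2 / r - r) / 2)%:C by rewrite rmorphD.
    by rewrite -h4 addrC subrK.
  set t := x + _ in zE.
  have Dt : D t%:C by rewrite -zE.
  move: e; rewrite zE SE // -rmorphB -rmorphD -rmorphN => /complexI e.
  have := d0 t; rewrite ltr_norml => /andP[h5 _].
  by clear -h5 e r0; lra.
- move=> t Dt; split; last by rewrite SE // rmorphD rmorphB.
  have := d0 t; rewrite ltr_norml => /andP[h5 _]; lra.
move=> t t' Dt Dt'.
have := dR t; have := dR t'; have := d0 t; have := d0 t'.
set d := cmod (t%:C - w); set d' := cmod (t'%:C - w) => e' e E' E.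
rewrite -[d + d']ger0_norm -?normrM; last by rewrite addr_ge0 ?cmod_ge0.
have -> : `|t' - t| * (t - x + d + (t' - x + d')) = `|(t' - t) * (t - x + d + (t' - x + d'))|.
  rewrite normrM; congr (_ * _); rewrite ger0_norm //.
  by move: e e'; rewrite !ltr_norml => /andP[? _] /andP[? _]; lra.
congr (`| _ |); apply/eqP; rewrite -subr_eq0; apply/eqP.
have -> : (t' - x + d' - (t - x + d)) * (d + d') - (t' - t) * (t - x + d + (t' - x + d')) =
  (d' ^+ 2 - d ^+ 2) - ((t' - x) ^+ 2 - (t - x) ^+ 2) by ring.
by rewrite E E'; ring.
Qed.
End LocalGeneral.

(** * Local separation estimates *)

Section LocalEstimates.
Variable R : realType.
Implicit Types (z w : R[i]) (f g : R[i] -> R[i]) (a b c r t : R).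
Variable D : set R[i].

Lemma cmod_lt_sym (z : R[i]) (b : R) : 0 < b -> 0 < complex.Re z ->
  cmod (z - b%:C) < cmod (z + b%:C).
Proof.
move=> b0 z0; rewrite -(@ltr_pXn2r _ 2) ?nnegrE ?cmod_ge0 // !sqr_cmod.
case: z z0 => x y /= x0; rewrite subr0 addr0 -subr_gt0.
have -> : (x + b) ^+ 2 + y ^+ 2 - ((x - b) ^+ 2 + y ^+ 2) = 4 * (x * b) by ring.
by rewrite !mulr_gt0.
Qed.

(** The root of the slit map sends [D] to the right half-plane, and the Cayley
transform centred at [b = sqrt (u t)] sends that to the disk. The value at [t'] is
[(b' - b) / (b' + b)], which [slit_map] bounds below. *)
Lemma sep_local (t t' : R) (w : R[i]) :
  simply_connected_domain D -> symmetric_real_axis D ->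
  D t%:C -> D t'%:C -> ~ D w ->
  sep D t%:C t'%:C (1 / 4 * `|t' - t| / (cmod (t%:C - w) + `|t' - t| / 2)).
Proof.
move=> scD symD Dt Dt' nD; have oD : open D by case: scD => -[].
have [f [u [sf fs fR fu]]] : exists f u, slit_map D w f u.
  have [v0|v0] := eqVneq (complex.Im w) 0; last exact: slit_map_nonreal Dt nD v0.
  have wE : w = (complex.Re w)%:C by apply/eqP; rewrite eq_complex /= v0 !eqxx.
  by rewrite wE in nD *; exact: slit_map_real Dt nD.
pose q z := psqrt (f z).
have q2 z : D z -> q z * q z = f z by move=> /fs; exact: psqrtK.
have f0 z : D z -> f z != 0.
  by move=> Dz; have := fs z Dz; apply: contraTneq => ->; rewrite cmod0 /= addr0 ltxx.
have sq : smooth D q.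
  move=> n; apply: (csmooth_sqrt oD f0) => //.
  move=> z Dz; apply: (@ccont_comp _ _ f); first exact: smooth_ccont sf Dz.
  by apply: ccont_psqrt; exact: fs.
have qR z : D z -> 0 < complex.Re (q z) by move=> /fs; exact: Re_psqrt_gt0.
have qt s : D s%:C -> 0 < Num.sqrt (u s) /\ q s%:C = (Num.sqrt (u s))%:C.
  move=> Ds; have [u0 fE] := fR s Ds; have su0 : 0 < Num.sqrt (u s) by rewrite sqrtr_gt0.
  split=> //; have : q s%:C * q s%:C = (Num.sqrt (u s))%:C * (Num.sqrt (u s))%:C.
    by rewrite q2 // fE -rmorphM -expr2 sqr_sqrtr // ltW.
  move=> /sqr_eq_or[//|e]; have := qR _ Ds; rewrite e -rmorphN /=.
  by rewrite oppr_gt0 ltNge ltW.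
have [b0 qb] := qt t Dt; have [b'0 qb'] := qt t' Dt'.
set b := Num.sqrt (u t) in b0 qb; set b' := Num.sqrt (u t') in b'0 qb'.
have den z : D z -> q z + b%:C != 0.
  move=> Dz; apply/eqP => e; have := qR z Dz.
  have -> : q z = - b%:C by apply/eqP; rewrite -addr_eq0 e.
  by rewrite -rmorphN /= oppr_gt0 ltNge ltW.
pose g z := (q z - b%:C) / (q z + b%:C).
move=> r r0 r1; exists g; split.
- split.
    apply: smooth_div => //.
      by apply: smooth_sub => //; exact: smooth_cst.
    by apply: smooth_add => //; exact: smooth_cst.
  move=> z Dz; rewrite /g cmodM cmodV ltr_pdivrMr ?cmod_gt0 ?den // mul1r.
  by apply: cmod_lt_sym => //; exact: qR.
- by rewrite /g qb subrr mul0r.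
- rewrite /g qb' -rmorphB -rmorphD cmodM cmodV !cmod_real [`|b' + b|]ger0_norm; last first.
    by rewrite addr_ge0 // ltW.
  have := fu t t' Dt Dt'; set d := cmod _; set d' := cmod _; set h := `|t' - t|.
  have ub : u t = b ^+ 2 by rewrite sqr_sqrtr // ltW //; case: (fR t Dt).
  have ub' : u t' = b' ^+ 2 by rewrite sqr_sqrtr // ltW //; case: (fR t' Dt').
  have bb : 0 < b' + b by rewrite addr_gt0.
  rewrite ub ub' subr_sqr normrM [`|b' + b|]ger0_norm; last exact: ltW.
  set k := `|b' - b| => e.
  have h0 : 0 <= h by exact: normr_ge0.
  have k0 : 0 <= k by exact: normr_ge0.
  have d0 : 0 < d by rewrite cmod_gt0 subr_eq0; apply: contraPneq nD => <-.
  have d'0 : 0 <= d' := cmod_ge0 _.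
  have dd' : d' <= d + h.
    rewrite /d' /d /h; have -> : t'%:C - w = (t%:C - w) + (t' - t)%:C by rewrite rmorphB; ring.
    by apply: le_trans (cmodD _ _) _; rewrite cmod_real.
  have dh : 0 < d + h / 2 by rewrite ltr_wpDr // divr_ge0.
  have X0 : 0 <= 1 / 4 * h / (d + h / 2) by rewrite divr_ge0 ?mulr_ge0 // ltW.
  apply: le_trans (_ : 1 / 4 * h / (d + h / 2) <= _); first by rewrite ler_piMl // ltW.
  rewrite ler_pdivrMr // [leRHS]mulrAC ler_pdivlMr //.
  (* e is the slit-map identity in terms of b and b'; together with
     (b + b')^2 <= 2 (b^2 + b'^2) it bounds k / (b' + b) from below *)
  have h1 : k * (b' + b) * (2 * (d + h / 2)) >= h * (b ^+ 2 + b' ^+ 2).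
    rewrite -e ler_wpM2l ?mulr_ge0 // ?(ltW bb) //.
    by clear -dd'; lra.
  have h2 : h * (b' + b) ^+ 2 <= h * (2 * (b ^+ 2 + b' ^+ 2)).
    rewrite ler_wpM2l //; have := sqr_ge0 (b - b').
    by clear; rewrite !expr2; nra.
  rewrite -(ler_pM2r bb); move: h1 h2; rewrite [(b' + b) ^+ 2]expr2.
  by clear; nra.
Qed.

Lemma convexE (z w : R[i]) (l : R) : convex_set D -> 0 <= l -> l <= 1 ->
  D z -> D w -> D (l%:C * z + (1 - l)%:C * w).
Proof.
move=> cD l0 l1 Dz Dw.
have L0 : 0 <= l%:C :> R[i] by rewrite ler0c.
have L1 : l%:C <= 1 :> R[i] by rewrite -[1]/(1%:C) lecR.
have := cD z w (Itv01 L0 L1) (mem_set Dz) (mem_set Dw).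
rewrite inE rmorphB rmorph1; exact.
Qed.

(** After rotation, the disk of radius [d] about [t] inside [D] touches the
complement at [w = t + d e], and convexity puts [D] in the half-plane
[Re ((z - t) * conj e) < d]. The map is its Cayley transform centred at [t]. *)
Lemma sep_local_convex (t t' : R) (w : R[i]) : open D -> convex_set D ->
  D t%:C -> D t'%:C -> ~ D w ->
  (forall z, cmod (z - t%:C) < cmod (t%:C - w) -> D z) ->
  sep D t%:C t'%:C (1 / 2 * `|t' - t| / (cmod (t%:C - w) + `|t' - t| / 2)).
Proof.
move=> oD cD Dt Dt' nD ball; set d := cmod (t%:C - w).
have d0 : 0 < d by rewrite cmod_gt0 subr_eq0; apply: contraPneq nD => <-.
pose e := (w - t%:C) / d%:C.
have dC : d%:C != 0 :> R[i] by apply: realC_neq0; rewrite gt_eqF.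
have e1 : cmod e = 1 by rewrite /e cmodM cmodV cmod_real ger0_norm ?ltW // cmodB divff // gt_eqF.
have ee : e * conjc e = 1 by rewrite mulcJ e1 expr1n.
have wE : w = t%:C + d%:C * e by rewrite /e mulrC divfK // addrC subrK.
pose X z := (z - t%:C) * conjc e.
have XE z : z = t%:C + X z * e.
  by rewrite /X -mulrA [conjc e * e]mulrC ee mulr1 addrC subrK.
(* a point z beyond the line puts w in the interior of the hull of z and the
   disk about t: the point p = w - s (z - w) lies in that disk if s minimises its
   distance to t *)
have strict z : D z -> d < complex.Re (X z) -> False.
  move=> Dz Xz; set x := complex.Re (X z) in Xz; set y := complex.Im (X z).
  pose m := (x - d) ^+ 2 + y ^+ 2.
  have m0 : 0 < m by rewrite ltr_wpDr ?sqr_ge0 // exprn_gt0 // subr_gt0.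
  pose s := d * (x - d) / m.
  have s0 : 0 < s by rewrite divr_gt0 // mulr_gt0 // subr_gt0.
  pose p := w - s%:C * (z - w).
  have Dp : D p.
    apply: ball; rewrite -(@ltr_pXn2r _ 2) ?nnegrE ?cmod_ge0 ?(ltW d0) //.
    have -> : p - t%:C = (d%:C - s%:C * (X z - d%:C)) * e.
      by rewrite /p wE {1}(XE z); ring.
    rewrite cmodM e1 mulr1 sqr_cmod.
    have -> : complex.Re (d%:C - s%:C * (X z - d%:C)) = d - s * (x - d).
      by rewrite /x; case: (X z) => x' y' /=; ring.
    have -> : complex.Im (d%:C - s%:C * (X z - d%:C)) = - (s * y).
      by rewrite /y; case: (X z) => x' y' /=; ring.
    rewrite -subr_gt0.
    have -> : d ^+ 2 - ((d - s * (x - d)) ^+ 2 + (- (s * y)) ^+ 2) = 2 * s * d * (x - d) - s * (s * m).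
      by rewrite /m; ring.
    have -> : s * m = d * (x - d) by rewrite /s divfK // gt_eqF.
    have -> : 2 * s * d * (x - d) - s * (d * (x - d)) = s * (d * (x - d)) by ring.
    by rewrite mulr_gt0 // mulr_gt0 // subr_gt0.
  apply: nD; have s1 : 0 < 1 + s by rewrite addr_gt0.
  have -> : w = (1 + s)^-1%:C * p + (1 - (1 + s)^-1)%:C * z.
    have sC : 1 + s%:C != 0 :> R[i] by rewrite -[1]/(1%:C) -rmorphD realC_neq0 // gt_eqF.
    by rewrite rmorphB fmorphV rmorphD rmorph1 /p; field.
  apply: convexE => //; first by rewrite invr_ge0 ltW.
  by rewrite invf_le1 // lerDl ltW.
(* equality is excluded since D is open *)
have half z : D z -> complex.Re (X z) < d.
  move=> Dz; rewrite ltNge; apply/negP => h.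
  have [k k0 hk] := open_cball oD Dz.
  have Dz' : D (z + (k / 2)%:C * e).
    apply: hk; rewrite addrAC subrr add0r cmodM e1 mulr1 cmod_real ger0_norm ?ltW ?divr_gt0 //; lra.
  apply: (strict _ Dz').
  have -> : X (z + (k / 2)%:C * e) = X z + (k / 2)%:C.
    by rewrite /X addrAC mulrDl -[_ * e * _]mulrA ee mulr1.
  by rewrite ReD /=; lra.
have key z : D z -> cmod (X z) < cmod ((2 * d)%:C - X z).
  move=> /half h; rewrite -(@ltr_pXn2r _ 2) ?nnegrE ?cmod_ge0 // !sqr_cmod.
  case: (X z) h => x y /= xd; rewrite -subr_gt0.
  have -> : (2 * d - x) ^+ 2 + (0 - y) ^+ 2 - (x ^+ 2 + y ^+ 2) = 4 * (d * (d - x)) by ring.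
  by rewrite mulr_gt0 // mulr_gt0 // subr_gt0.
have den z : D z -> (2 * d)%:C - X z != 0.
  by move=> /key h; rewrite -cmod_gt0 (le_lt_trans _ h) // cmod_ge0.
have sX : smooth D X.
  by apply: smooth_mul => //; [apply: smooth_sub => //; [exact: smooth_id|exact: smooth_cst]|exact: smooth_cst].
move=> r r0 r1; exists (fun z => X z / ((2 * d)%:C - X z)); split.
- split.
    by apply: smooth_div => //; apply: smooth_sub => //; exact: smooth_cst.
  move=> z Dz; rewrite cmodM cmodV ltr_pdivrMr ?cmod_gt0 ?den // mul1r; exact: key.
- by rewrite /X subrr mul0r mul0r.
- set h := `|t' - t|; have h0 : 0 <= h := normr_ge0 _.
  have Xh : cmod (X t'%:C) = h by rewrite /X -rmorphB cmodM cmodJ e1 mulr1 cmod_real.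
  have dh : 0 < d + h / 2 by rewrite ltr_wpDr // divr_ge0.
  have X0 : 0 <= 1 / 2 * h / (d + h / 2) by rewrite divr_ge0 ?mulr_ge0 // ltW.
  apply: le_trans (_ : 1 / 2 * h / (d + h / 2) <= _); first by rewrite ler_piMl // ltW.
  rewrite cmodM cmodV Xh.
  have b1 : cmod ((2 * d)%:C - X t'%:C) <= 2 * (d + h / 2).
    apply: le_trans (cmodD _ _) _; rewrite cmodN Xh cmod_real.
    by rewrite ger0_norm ?mulr_ge0 ?(ltW d0) //; clear; lra.
  rewrite ler_pdivlMr ?cmod_gt0 ?den // [leLHS]mulrAC ler_pdivrMr //.
  apply: le_trans (_ : 1 / 2 * h * (2 * (d + h / 2)) <= _); first by rewrite ler_wpM2l ?mulr_ge0.
  by clear; lra.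
Qed.

(** The infimum defining [dist_compl] is attained on a compact part of the
complement. *)
Lemma nearest_complement (x : R) : open D -> D <> setT -> D x%:C ->
  exists w, [/\ ~ D w, cmod (x%:C - w) = dist_compl D x,
    0 < cmod (x%:C - w) &
    forall z, cmod (z - x%:C) < cmod (x%:C - w) -> D z].
Proof.
move=> oD DT Dx; have [w0 nD0] : exists w, ~ D w.
  by apply: contrapT => h; apply: DT; apply/seteqP; split=> // w _; apply: contrapT => n; apply: h; exists w.
pose K := ~` D `&` [set w | cmod (w - x%:C) <= cmod (w0 - x%:C)].
have cK : compact K.
  apply: (@subclosed_compact _ _ [set w | cmod (w - x%:C) <= cmod (w0 - x%:C)]).
  - by apply: closedI; [exact: open_closedC|exact: closed_cball].
  - exact: compact_cball.
  - by move=> w [].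
have K0 : K !=set0 by exists w0; split=> //=.
have cd : {within K, continuous (fun w => cmod (w - x%:C))}.
  apply: continuous_subspaceT => z; apply: (@ccont_cmod _ _ (fun w => w - x%:C)).
  by apply: ccontD; [exact: ccont_id|exact: ccont_cst].
have [w [nD Kw] hw] := compact_inf_attained cK K0 cd.
have lower z : ~ D z -> cmod (w - x%:C) <= cmod (z - x%:C).
  move=> nDz; have [le|lt] := leP (cmod (z - x%:C)) (cmod (w0 - x%:C)); first exact: hw.
  exact: le_trans Kw (ltW lt).
exists w; split=> //.
- rewrite cmodB /dist_compl; apply/eqP; rewrite eq_le; apply/andP; split.
    apply: lb_le_inf; first by exists (cmod (x%:C - w)), w.
    by move=> _ [z nDz <-]; rewrite -/(cmod _) [leRHS]cmodB; exact: lower.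
  apply: ge_inf; last by exists w => //; rewrite -/(cmod _) cmodB.
  by exists 0 => _ [z _ <-]; exact: cmod_ge0.
- by rewrite cmod_gt0 subr_eq0; apply: contraPneq nD => <-.
- move=> z; rewrite [ltRHS]cmodB => h; apply: contrapT => /lower; rewrite leNgt h //.
Qed.
End LocalEstimates.

(** * From local to global separation *)

Section Chain.
Variable R : realType.
Implicit Types (a b c r t u v x y L d h : R).

Definition tanh_half u := (expR u - 1) / (expR u + 1).

Lemma tanh_half_den u : 0 < expR u + 1.
Proof. by rewrite addr_gt0 // expR_gt0. Qed.

Lemma tanh_half_mono u v : u <= v -> tanh_half u <= tanh_half v.
Proof.
move=> uv; rewrite /tanh_half ler_pdivrMr ?tanh_half_den // mulrAC ler_pdivlMr ?tanh_half_den // -subr_ge0.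
have -> : (expR v - 1) * (expR u + 1) - (expR u - 1) * (expR v + 1) = 2 * (expR v - expR u) by ring.
by rewrite mulr_ge0 // subr_ge0 ler_expR.
Qed.

Lemma tanh_half0 : tanh_half 0 = 0.
Proof. by rewrite /tanh_half expR0 subrr mul0r. Qed.

Lemma tanh_half_ge0 u : 0 <= u -> 0 <= tanh_half u.
Proof. by move=> /tanh_half_mono; rewrite tanh_half0. Qed.

Lemma tanh_half_add u v : hyp_add (tanh_half u) (tanh_half v) = tanh_half (u + v).
Proof.
have U := expR_gt0 u; have V := expR_gt0 v.
rewrite /hyp_add /tanh_half expRD; set e := expR u in U *; set f := expR v in V *.
have h1 : e + 1 != 0 by rewrite gt_eqF // addr_gt0.
have h2 : f + 1 != 0 by rewrite gt_eqF // addr_gt0.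
have h3 : e * f + 1 != 0 by rewrite gt_eqF // addr_gt0 // mulr_gt0.
have h4 : (e + 1) * (f + 1) + (e - 1) * (f - 1) != 0.
  have -> : (e + 1) * (f + 1) + (e - 1) * (f - 1) = 2 * (e * f + 1) by ring.
  by rewrite mulf_neq0.
have -> : 1 + (e - 1) / (e + 1) * ((f - 1) / (f + 1)) =
  2 * (e * f + 1) / ((e + 1) * (f + 1)) by field; rewrite h1 h2.
by field; rewrite h1 h2 h3.
Qed.

(** With [u] the argument on the left, [exp u <= 1 / (1 - u)] gives
[tanh_half u <= u / (2 - u)]; having [d + h] rather than [d] in [u] leaves room for the
second-order terms. *)
Lemma tanh_half_le_local L d h : 0 < L -> L <= 1 / 2 -> 0 < d -> 0 <= h ->
  tanh_half (2 * L * h / (d + h)) <= L * h / (d + h / 2).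
Proof.
move=> L0 L2 d0 h0; set u := 2 * L * h / (d + h).
have dh : 0 < d + h by lra.
have dh2 : 0 < d + h / 2 by lra.
have Lh : L * h <= h / 2 by rewrite [h / 2]mulrC -[2^-1]mul1r ler_wpM2r.
have uE : u * (d + h) = 2 * (L * h) by rewrite /u divfK ?gt_eqF // mulrA.
have u1 : u < 1 by rewrite /u ltr_pdivrMr // mul1r -mulrA; lra.
have E0 := expR_gt0 u.
have E1 : expR u * (1 - u) <= 1.
  have e0 : expR u != 0 by rewrite gt_eqF.
  rewrite -[leRHS](divff e0) ler_pM2l // -expRN; exact: expR_ge1Dx.
have u0 : 0 <= u by apply: divr_ge0; [apply: mulr_ge0 => //; apply: mulr_ge0 => //|]; exact: ltW.
rewrite /tanh_half ler_pdivrMr ?tanh_half_den // mulrAC ler_pdivlMr //.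
set e := expR u in E1 E0 *.
set X := d + h / 2 in dh2 *; set Y := L * h in uE Lh *.
have XY : 0 <= X - Y by rewrite /X; lra.
have lu : 0 < 1 - u by lra.
(* together: e^u <= 1 / (1 - u) and u <= 2 Y / (X + Y) give (e^u - 1) / (e^u + 1) <= Y / X *)
have k1 : u * (X + Y) <= 2 * Y by rewrite -uE ler_wpM2l // /X; lra.
have k2 : e * (1 - u) * (X - Y) <= 1 * (X - Y) by rewrite ler_wpM2r.
have k3 : e * (X - Y) <= X + Y.
  rewrite -(ler_pM2r lu) mulrAC; apply: le_trans k2 _.
  by clear -k1; lra.
by clear -k3; lra.
Qed.

Section Segment.
Variables (D : set R[i]) (L d : R).
Hypotheses (scD : simply_connected_domain D) (DT : D <> setT)
  (symD : symmetric_real_axis D) (Dseg : forall t : R, -1 <= t <= 1 -> D t%:C)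
  (L0 : 0 < L) (L2 : L <= 1 / 2) (d0 : 0 < d)
  (loc : forall t t' : R, -1 <= t <= 1 -> -1 <= t' <= 1 ->
    sep D t%:C t'%:C (L * `|t' - t| / (d + `|t' - t| / 2))).
Let oD : open D. Proof. by case: scD => -[]. Qed.

(** Cut [[x, y]] into [n] equal steps, compare the local bound of each with [tanh_half] by
[tanh_half_le_local], and add the arguments of [tanh_half] by [sep_add]. *)
Lemma sep_chain x y n : -1 <= x -> x <= y -> y <= 1 -> (0 < n)%N ->
  sep D x%:C y%:C (tanh_half (2 * L * (y - x) / (d + (y - x) / n%:R))).
Proof.
move=> x1 xy y1 n0; have nR : 0 < n%:R :> R by rewrite ltr0n.
set h := (y - x) / n%:R.
have h0 : 0 <= h by rewrite divr_ge0 ?subr_ge0 // ltW.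
have hn : n%:R * h = y - x by rewrite mulrC divfK // gt_eqF.
pose u := 2 * L * h / (d + h).
have dh : 0 < d + h by rewrite ltr_wpDr.
have u0 : 0 <= u by apply: divr_ge0; [apply: mulr_ge0 => //; apply: mulr_ge0 => //|]; exact: ltW.
have key k : (k <= n)%N -> sep D x%:C (x + k%:R * h)%:C (tanh_half (k%:R * u)).
  elim: k => [|k IH] kn; first by rewrite !mul0r addr0 tanh_half0; exact: sep_refl.
  have kn1 : k.+1%:R * h <= y - x by rewrite -hn ler_wpM2r // ler_nat.
  rewrite -natr1 mulrDl mul1r in kn1.
  have kh0 : 0 <= k%:R * h by rewrite mulr_ge0.
  rewrite -natr1 !mulrDl !mul1r -tanh_half_add.
  apply: (@sep_add _ _ _ (x + k%:R * h)) => //.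
  - by move=> t /andP[t1 t2]; apply: Dseg; apply/andP; split; lra.
  - by apply/andP; split; lra.
  - by rewrite tanh_half_ge0 // mulr_ge0.
  - exact: tanh_half_ge0.
  - by apply: IH; exact: ltnW.
  apply: sep_le (loc _ _); last 2 first.
  - by apply/andP; split; lra.
  - by apply/andP; split; lra.
  have -> : x + (k%:R * h + h) - (x + k%:R * h) = h by ring.
  by rewrite ger0_norm //; exact: tanh_half_le_local.
have := key n (leqnn n); rewrite hn addrC subrK.
have -> : n%:R * u = 2 * L * (y - x) / (d + h) by rewrite -hn /u; ring.
by [].
Qed.

Lemma continuous_tanh_half : continuous tanh_half.
Proof.
move=> u; have cE : {for u, continuous (@expR R)} by exact: continuous_expR.
have : {for u, continuous (fun u => (expR u + -1) * (expR u + 1)^-1)}; last exact.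
apply: rcontM; first by apply: rcontD => //; exact: rcont_cst.
apply: (@cvgV R R (nbhs u) _ (fun u => expR u + 1) (expR u + 1)).
  by rewrite gt_eqF // tanh_half_den.
by apply: (@rcontD R R (@expR R) (fun=> 1)) => //; exact: rcont_cst.
Qed.

(** The limit of [sep_chain] for [n] to infinity; the defining factor [r < 1] of [sep]
is split into one factor for the convergence and one for the map. *)
Lemma sep_seg_le x y : -1 <= x -> x <= y -> y <= 1 ->
  sep D x%:C y%:C (tanh_half (2 * L * (y - x) / d)).
Proof.
move=> x1 xy y1 r r0 r1; set T := tanh_half _.
have T0 : 0 <= T by rewrite tanh_half_ge0 //; apply: divr_ge0; [rewrite !mulr_ge0 ?subr_ge0 // ltW|exact: ltW].
have [s s0 [s1 rs]] : exists2 s : R, 0 < s & s < 1 /\ r <= s * s.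
  by exists ((1 + r) / 2); [lra|split; nra].
have [n n0 hn] : exists2 n, (0 < n)%N & s * T <= tanh_half (2 * L * (y - x) / (d + (y - x) / n%:R)).
  have [->|Tn0] := eqVneq T 0.
    exists 1%N => //; rewrite mulr0 tanh_half_ge0 //; apply: divr_ge0; first by rewrite !mulr_ge0 ?subr_ge0 // ltW.
    by rewrite divr1 addr_ge0 ?subr_ge0 // ltW.
  have Tp : 0 < T by rewrite lt_def Tn0.
  have cv : (fun n : nat => tanh_half (2 * L * (y - x) / (d + (y - x) * harmonic n))) @ \oo --> T.
    apply: (@cvg_comp _ _ _ (fun n : nat => 2 * L * (y - x) / (d + (y - x) * harmonic n)) tanh_half _ (nbhs (2 * L * (y - x) / d))); last exact: continuous_tanh_half.
    apply: cvgM; first exact: cvg_cst.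
    have -> : d^-1 = (d + (y - x) * 0)^-1 by rewrite mulr0 addr0.
    apply: cvgV; first by rewrite mulr0 addr0 gt_eqF.
    apply: cvgD; first exact: cvg_cst.
    by apply: cvgM; [exact: cvg_cst|exact: cvg_harmonic].
  have e0 : 0 < (1 - s) * T by rewrite mulr_gt0 // subr_gt0.
  have [m _ hm] : \forall n \near \oo, `|T - tanh_half (2 * L * (y - x) / (d + (y - x) * harmonic n))| < (1 - s) * T.
    exact: cvgr_dist_lt cv _ e0.
  exists m.+1 => //; have := hm m (leqnn m); rewrite /= /harmonic.
  by rewrite ltr_norml => /andP[_]; lra.
have [g [tg gx gy]] := sep_chain x1 xy y1 n0 s0 s1.
exists g; split=> //; apply: le_trans gy; apply: le_trans (_ : s * (s * T) <= _).
  by rewrite mulrA ler_wpM2r.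
by rewrite ler_wpM2l // ltW.
Qed.

Lemma sep_seg x y : -1 <= x <= 1 -> -1 <= y <= 1 ->
  sep D x%:C y%:C (tanh_half (2 * L * `|y - x| / d)).
Proof.
move=> /andP[x1 x2] /andP[y1 y2]; have [xy|/ltW yx] := leP x y.
  by rewrite ger0_norm ?subr_ge0 //; exact: sep_seg_le.
rewrite distrC ger0_norm ?subr_ge0 //; apply: sep_sym => //.
  by apply: Dseg; rewrite x1.
exact: sep_seg_le.
Qed.
End Segment.
End Chain.

(** * The symmetrised product *)

Section Product.
Variable R : realType.
Implicit Types (f g u v : R[i] -> R[i]) (D : set R[i]) (z w : R[i]).

Lemma der_exp v w a m : hasder v w a ->
  hasder (fun w => v w ^+ m.+1) w (m.+1%:R * v w ^+ m * a).
Proof.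
move=> dv; elim: m => [|m IH].
  by apply: (der_eq (f := v) dv); rewrite expr0; ring.
have -> : (fun w => v w ^+ m.+2) = (fun w => v w * v w ^+ m.+1).
  by apply/funext => x; rewrite exprS.
apply: der_eq (der_mul dv IH) _.
by rewrite -[m.+2%:R]natr1 exprS; ring.
Qed.

(** A function with a factor [v ^+ m] has derivatives of order [l] with a factor
[v ^+ (m - l)]. *)
Lemma derive1n_zero l m D f u v z : open D -> smooth D v -> csmooth l D u ->
  D z -> v z = 0 -> (forall w, D w -> f w = v w ^+ m * u w) ->
  (l < m)%N -> f^`(l) z = 0.
Proof.
move=> oD sv; elim: l m f u => [|l IH] [|m] f u su Dz vz fE // lm.
  by rewrite derive1n0 fE // vz expr0n mul0r.
rewrite derive1Sn; have [v' dv sv'] := sv l.+1; have [u' du su'] := su.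
apply: (IH m _ (fun w => m.+1%:R * v' w * u w + v w * u' w)) => //.
  apply: csmooth_add => //.
    apply: csmooth_mul => //; last exact: csmooth_pred.
    by apply: csmooth_mul => //; exact: csmooth_cst.
  by apply: csmooth_mul => //; exact: sv.
move=> w Dw; apply: hasder_derive1.
have [d d0 hd] := open_cball oD Dw.
apply: (hasder_eq_near d0) (der_eq (der_mul (der_exp m (dv w Dw)) (du w Dw)) _).
  by move=> x /hd/fE.
by rewrite exprS; ring.
Qed.

Lemma smooth_prod n D (F : 'I_n -> R[i] -> R[i]) : open D ->
  (forall j, smooth D (F j)) -> smooth D (fun w => \prod_j F j w).
Proof.
move=> oD sF; elim: n F sF => [|n IH] F sF.
  apply: smooth_ext (smooth_cst 1 oD) => // w _; by rewrite big_ord0.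
apply: (@smooth_ext _ _ (fun w => F ord0 w * \prod_(j < n) F (lift ord0 j) w)) => //.
  by move=> w _; rewrite big_ord_recl.
by apply: smooth_mul => //; exact: IH.
Qed.

Lemma cmod_prod n (F : 'I_n -> R[i]) : cmod (\prod_j F j) = \prod_j cmod (F j).
Proof.
by elim/big_ind2: _ => [|a x b y <- <-|//]; [exact: cmod1|exact: cmodM].
Qed.

Variable D : set R[i].
Hypotheses (scD : simply_connected_domain D) (DT : D <> setT)
  (symD : symmetric_real_axis D).

(** The factor of a node is multiplied by its reflection, which doubles the exponent
and makes the product equal to [|f_j|^(2 K_j)] on the real axis. *)
Lemma test_function n (X : 'I_n -> R) (K : 'I_n -> nat) r :
  (0 < n)%N -> (forall j, D (X j)%:C) -> (forall j, (0 < K j)%N) ->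
  0 < r -> r < 1 ->
  exists g (m : R -> R), [/\ F_plus D X K g,
    (forall x, D x%:C -> g x%:C = (m x)%:C) &
    (forall (x c : R), D x%:C -> 0 <= c -> (forall j, sep D (X j)%:C x%:C c) ->
      (r * c) ^+ (2 * (\sum_j K j)%N) <= m x)].
Proof.
move=> n0 DX K0 r0 r1; have oD : open D by case: scD => -[].
have ex j : exists f, [/\ to_disk D f, f (X j)%:C = 0 &
    forall z c, D z -> sep D (X j)%:C z c -> r * c <= cmod (f z)].
  have [f [f1 [tf _ _ fE ext]]] := near_extremal_sep scD DT (DX j) r0 r1.
  by exists f; split=> //; rewrite fE // subrr mul0r.
pose f j := projT1 (cid (ex j)).
have fP j : [/\ to_disk D (f j), f j (X j)%:C = 0 &
    forall z c, D z -> sep D (X j)%:C z c -> r * c <= cmod (f j z)].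
  exact: projT2 (cid (ex j)).
have cD w : D w -> D (conjc w) by exact: symD.
pose F j w := (f j w * conjc (f j (conjc w))) ^+ K j.
have sfc j : smooth D (fun w => conjc (f j (conjc w))).
  by apply: smooth_conj => //; case: (fP j) => -[].
have sf j : smooth D (f j) by case: (fP j) => -[].
have sF j : smooth D (F j).
  by apply: (@smooth_exp _ _ (fun w => f j w * conjc (f j (conjc w)))) => //; exact: smooth_mul.
have f1 j w : D w -> cmod (f j w) < 1 by case: (fP j) => -[_ h] _ _; exact: h.
have F1 j w : D w -> cmod (F j w) < 1.
  move=> Dw; have h : cmod (f j w) * cmod (f j (conjc w)) < 1.
    have [->|fn0] := eqVneq (cmod (f j w)) 0; first by rewrite mul0r.
    by rewrite mulr_ilt1 ?cmod_ge0 // f1 //; exact: cD.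
  rewrite /F cmodX cmodM cmodJ exprn_ilt1 ?mulr_ge0 ?cmod_ge0 // -lt0n; exact: K0.
pose g w := \prod_j F j w.
have sg : smooth D g by exact: smooth_prod.
pose m x : R := \prod_j (cmod (f j x%:C) ^+ 2) ^+ K j.
have gm x : g x%:C = (m x)%:C.
  rewrite /g /m rmorph_prod; apply: eq_bigr => j _.
  by rewrite /F conjc_real mulcJ; exact/esym/(rmorphXn (real_complex R)).
exists g, m; split=> //.
- split.
  + move=> z Dz; split.
      have [g' dg _] := sg 1%N; exact: hasder_derivable (dg z Dz).
    rewrite normE -[1]/(1%:C) ltcR /g cmod_prod (bigD1 (Ordinal n0)) //=.
    apply: le_lt_trans (F1 (Ordinal n0) z Dz).
    rewrite ler_piMr ?cmod_ge0 //; apply: prodr_ile1 => j _.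
    by rewrite cmod_ge0 ltW // F1.
  + move=> j l lK; have [_ fz _] := fP j.
    apply: (@derive1n_zero l (K j) D g (fun w => conjc (f j (conjc w)) ^+ K j *
        \prod_(i | i != j) F i w) (f j)) => //.
      apply: csmooth_mul => //; first by apply: (@smooth_exp _ _ (fun w => conjc (f j (conjc w)))).
      have : smooth D (fun w => \prod_i (if i != j then F i w else 1)).
        apply: (@smooth_prod _ _ (fun i w => if i != j then F i w else 1)) => // i.
        by case: (i != j); [exact: sF|exact: smooth_cst].
      move=> h; apply: csmooth_ext (h l) => // w _.
      by rewrite -big_mkcond.
    by move=> w Dw; rewrite /g (bigD1 j) //= /F exprMn mulrA.
  + move=> x Dx; rewrite gm ler0c; apply: prodr_ge0 => j _.
    by rewrite !exprn_ge0 // cmod_ge0.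
- move=> x c Dx c0 hs; rewrite exprM /m -prodrXr.
  apply: ler_prod => j _; apply/andP; split.
    by rewrite !exprn_ge0 // mulr_ge0 // ltW.
  have [_ _ h] := fP j; have hj := h _ _ Dx (hs j).
  have rc : 0 <= r * c by rewrite mulr_ge0 // ltW.
  rewrite ler_pXn2r ?nnegrE ?exprn_ge0 ?cmod_ge0 //.
  by rewrite ler_pXn2r ?nnegrE ?cmod_ge0.
Qed.
End Product.

(** * Integration against the measure *)

Section Final.
Variable R : realType.
Implicit Types (D : set R[i]) (r c e : R).

Notation seg := (@segment11 R).

Lemma segE (x : R) : seg x <-> -1 <= x <= 1.
Proof. by rewrite /segment11 /= in_itv. Qed.

Lemma deltaD_facts D : admissible D ->
  0 < deltaD D /\ forall x : R, -1 <= x <= 1 -> dist_compl D x <= deltaD D.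
Proof.
move=> [scD DT symD Dseg]; have oD : open D by case: scD => -[].
have near x : -1 <= x <= 1 -> exists w, [/\ ~ D w, cmod (x%:C - w) = dist_compl D x,
    0 < cmod (x%:C - w) & forall z, cmod (z - x%:C) < cmod (x%:C - w) -> D z].
  by move=> /segE/Dseg Dx; exact: nearest_complement.
have zero : -1 <= (0 : R) <= 1 by rewrite lerN10 ler01.
have [w0 [nD e0 p0 _]] := near 0 zero.
have hs : has_sup [set dist_compl D x | x in seg].
  split; first by exists (dist_compl D 0), 0 => //; apply/segE.
  exists (1 + cmod w0) => _ [x /segE hx <-].
  have [w [nDw <- _ ball]] := near x hx.
  apply: le_trans (_ : cmod (w0 - x%:C) <= _).
    by rewrite leNgt; apply/negP => /ball.
  apply: le_trans (cmodD _ _) _; rewrite cmodN cmod_real addrC lerD2r.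
  by rewrite ler_norml.
have le x : -1 <= x <= 1 -> dist_compl D x <= deltaD D.
  by move=> hx; apply: (sup_upper_bound hs); exists x => //; apply/segE.
by split=> //; apply: lt_le_trans (le 0 zero); rewrite -e0.
Qed.

(** [deltaD] bounds the distance from each point of the segment to the complement, so
that the local estimates hold with [deltaD] in place of that distance. *)
Lemma sep_admissible D (L : R) : admissible D ->
  (L = 1 / 4 \/ (L = 1 / 2 /\ convex_set D)) ->
  forall x y : R, -1 <= x <= 1 -> -1 <= y <= 1 ->
    sep D x%:C y%:C (tanh_half (2 * L * `|y - x| / deltaD D)).
Proof.
move=> admD hL x y hx hy; have [scD DT symD Dseg] := admD.
have [d0 dle] := deltaD_facts admD.
have oD : open D by case: scD => -[].
have Dr t : -1 <= t <= 1 -> D t%:C by move=> /segE/Dseg.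
have [L0 L2] : 0 < L /\ L <= 1 / 2 by case: hL => [->|[-> _]]; split; lra.
apply: sep_seg => // t t' ht ht'.
have [w [nDw we w0 ball]] := nearest_complement oD DT (Dr t ht).
have wd : cmod (t%:C - w) <= deltaD D by rewrite we dle.
have h0 : 0 <= `|t' - t| by exact: normr_ge0.
apply: (@sep_le _ _ _ _ (L * `|t' - t| / (cmod (t%:C - w) + `|t' - t| / 2))).
  rewrite ler_wpM2l //; first by apply: mulr_ge0 => //; exact: ltW.
  by rewrite lef_pV2 ?posrE ?lerD2r // ltr_wpDr // divr_ge0.
case: hL => [->|[-> cD]].
  by apply: sep_local => //; exact: Dr.
by apply: sep_local_convex => //; exact: Dr.
Qed.

Lemma le_of_mulX_lt1 (a b : R) n : 0 <= a ->
  (forall r, 0 < r -> r < 1 -> r ^+ n * a <= b) -> a <= b.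
Proof.
elim: n a => [|n IH] a a0 h.
  have h2 : (1 / 2) ^+ 0 * a <= b by apply: h; lra.
  by rewrite expr0 mul1r in h2.
apply: le_of_mul_lt1 => s s0 s1; apply: IH; first by rewrite mulr_ge0 // ltW.
move=> r r0 r1; have [rs|/ltW sr] := leP r s.
  apply: le_trans (h s s0 s1); rewrite exprS mulrCA mulrA ler_wpM2r //.
  by rewrite ler_wpM2l ?(ltW s0) // lerXn2r ?nnegrE ?(ltW r0) ?(ltW s0).
apply: le_trans (h r r0 r1); rewrite exprS mulrA [_ * s]mulrC ler_wpM2r //.
by rewrite ler_wpM2r // exprn_ge0 // ltW.
Qed.

Lemma bernoulli_sub (t : R) m : 0 <= t -> t <= 1 -> 1 - m%:R * t <= (1 - t) ^+ m.
Proof.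
move=> t0 t1; elim: m => [|m IH]; first by rewrite mul0r subr0 expr0.
rewrite exprS; apply: le_trans (_ : (1 - t) * (1 - m%:R * t) <= _).
  rewrite -natr1; have : 0 <= m%:R * t ^+ 2 by rewrite mulr_ge0 // sqr_ge0.
  by rewrite expr2; lra.
by rewrite ler_wpM2l // subr_ge0.
Qed.

Section Measure.
Variable alpha : {finite_measure set (measurableTypeR R) -> \bar R}.
Local Open Scope ereal_scope.

Lemma measurable_seg : measurable seg.
Proof. exact: measurable_itv. Qed.

Lemma continuous_on_seg_measurable (m : R -> R) :
  (forall x, -1 <= x <= 1 -> {for x, continuous m})%R ->
  measurable_fun seg m.
Proof.
move=> cm; apply: measurable_realfun.subspace_continuous_measurable_fun.
  exact: measurable_seg.
by apply: continuous_in_subspaceT => x; rewrite inE => /segE; exact: cm.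
Qed.

Lemma F_plus_measurable D n (X : 'I_n -> R) K g : admissible D ->
  F_plus D X K g -> measurable_fun seg (fun x : R => complex.Re (g x%:C)).
Proof.
move=> [_ _ _ Dseg] [hg _ _]; apply: continuous_on_seg_measurable => x /segE/Dseg Dx.
have [dg _] := hg _ Dx; have /hasder_ccont cg := derivable_hasder dg.
apply: (@ccont_Re R R (fun x : R => g x%:C)).
apply: (@ccont_comp _ _ (fun t : R => t%:C)) => //.
by apply: ccont_real; exact: cvg_id.
Qed.

Lemma J_plus_XK_le D n (X : 'I_n -> R) K : admissible D ->
  J_plus_XK alpha D X K <= alpha seg.
Proof.
move=> admD; apply: ub_ereal_sup => _ [g Fg <-].
have mE := (measurable_realfun.measurable_EFinP _ _).2 (F_plus_measurable admD Fg).
have [h0 h1] : (forall x, seg x -> 0 <= (complex.Re (g x%:C))%:E) /\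
    (forall x, seg x -> (complex.Re (g x%:C))%:E <= 1).
  case: admD Fg => _ _ _ Dseg [hg _ gp]; split=> x /Dseg Dx; rewrite lee_fin.
    by have := gp _ Dx; rewrite lecE => /andP[].
  have [_ g1] := hg _ Dx; apply: le_trans (ler_norm _) (le_trans (Re_le_cmod _) _).
  by move: g1; rewrite normE -[1%R]/(1%:C) ltcR => /ltW.
rewrite gee0_abs; last exact: integral_ge0.
apply: le_trans (_ : \int[alpha]_(x in seg) cst 1 x <= _); last first.
  by rewrite integral_cst ?mul1e //; exact: measurable_seg.
by apply: ge0_le_integral => //; exact: measurable_seg.
Qed.

Lemma omega_le (d : R) : omega d alpha <= alpha seg.
Proof.
apply: ub_ereal_sup => _ [A [mA As _] <-].
by apply: le_measure => //; rewrite inE //; exact: measurable_seg.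
Qed.

Lemma omega_ge0 (d : R) : (0 <= d)%R -> 0 <= omega d alpha.
Proof.
move=> d0; apply: ereal_sup_ubound; exists set0; last by rewrite measure0.
by split=> //; rewrite measure0 lee_fin.
Qed.

Lemma union_measure (n : nat) (F : 'I_n -> set R) (d : R) :
  (forall j, measurable (F j)) -> (forall j, lebesgue_measure (F j) <= d%:E) ->
  measurable (\big[setU/set0]_(j < n) F j) /\
  lebesgue_measure (\big[setU/set0]_(j < n) F j) <= (n%:R * d)%:E.
Proof.
move=> mF lF; elim: n F mF lF => [|n IH] F mF lF.
  by rewrite big_ord0 measure0 mul0r.
rewrite big_ord_recl; have [m1 l1] := IH (fun j => F (lift ord0 j)) (fun j => mF _) (fun j => lF _).
split; first exact: measurableU.
apply: (le_trans (measureU2 (@lebesgue_measure R) (mF ord0) m1)).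
by rewrite -natr1 mulrDl mul1r [(_ + d)%R]addrC EFinD; exact: (leeD (lF ord0) l1).
Qed.

(** For any nodes, integrate the test function over the part of the segment at
distance at least [e] from them. A removed set [B] of measure at most [2 N e]
has mass at most [omega], and the factor [r ^+ (2 * N)] disappears in the limit. *)
Lemma J_plus_ge D (L e : R) (N : nat) : admissible D ->
  (L = 1 / 4 \/ (L = 1 / 2 /\ convex_set D))%R -> (0 < e)%R ->
  ((tanh_half (2 * L * e / deltaD D)) ^+ (2 * N))%:E *
    (alpha seg - omega (2 * N%:R * e) alpha) <= J_plus alpha D N.
Proof.
move=> admD hL e0; apply: le_ereal_inf_tmp => _ [n [X [K [[n0 X1 Xlt K0 KN] ->]]]].
have [scD DT symD Dseg] := admD.
have [d0 _] := deltaD_facts admD.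
have L0 : (0 < L)%R by case: hL => [->|[-> _]]; lra.
set T := tanh_half _.
have T0 : (0 <= T)%R.
  rewrite tanh_half_ge0 //; apply: divr_ge0; last exact: ltW.
  by rewrite !mulr_ge0 // ltW.
have DX j : D (X j)%:C by apply: Dseg; apply/segE.
have [fA fw] : alpha seg \is a fin_num /\ omega (2 * N%:R * e) alpha \is a fin_num.
  have fA : alpha seg \is a fin_num by apply: fin_num_measure; exact: measurable_seg.
  split=> //.
  rewrite ge0_fin_numE; last by rewrite omega_ge0 // !mulr_ge0 // ltW.
  by apply: le_lt_trans (omega_le _) _; rewrite ltey_eq fA.
set w := omega _ _ in fw *.
pose v := (fine (alpha seg) - fine w)%R.
have vE : alpha seg - w = v%:E by rewrite -(fineK fA) -(fineK fw).
have v0 : (0 <= v)%R by rewrite subr_ge0 fine_le // omega_le.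
rewrite vE -EFinM.
have key r : (0 < r)%R -> (r < 1)%R ->
    (r ^+ (2 * N) * (T ^+ (2 * N) * v))%:E <= J_plus_XK alpha D X K.
  move=> r0 r1.
  have [g [m [Fg gm mlow]]] := test_function scD DT symD n0 DX K0 r0 r1.
  rewrite KN in mlow.
  (* the points at distance less than e from a node *)
  pose B := \big[setU/set0]_(j < n) `](X j - e)%R, (X j + e)%R[%classic.
  have [mB lB] : measurable B /\ lebesgue_measure B <= (n%:R * (2 * e))%:E.
    apply: union_measure => j; first exact: measurable_itv.
    rewrite lebesgue_measure_itv /= lte_fin ifT; last by lra.
    by rewrite -EFinB lee_fin; lra.
  have nN : (n <= N)%N.
    rewrite -KN -[leqLHS]card_ord -sum1_card; apply: leq_sum => j _; exact: K0.
  have mBs : measurable (seg `&` B) by apply: measurableI => //; exact: measurable_seg.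
  have aB : alpha (seg `&` B) <= w.
    apply: ereal_sup_ubound; exists (seg `&` B) => //; split=> //.
    apply: le_trans (_ : lebesgue_measure B <= _).
      by apply: le_measure; rewrite ?inE //; exact: subIsetr.
    apply: le_trans lB _; rewrite lee_fin -mulrA [leRHS]mulrCA.
    by rewrite ler_wpM2r ?ler_nat // mulr_ge0 // ltW.
  have mSB : measurable (seg `\` B) by apply: measurableD => //; exact: measurable_seg.
  have aSB : v%:E <= alpha (seg `\` B).
    rewrite measureD //; [|exact: measurable_seg|by rewrite ltey_eq fA].
    by rewrite -vE leeB.
  have mg := F_plus_measurable admD Fg.
  have mE := (measurable_realfun.measurable_EFinP _ _).2 mg.
  have gx x : seg x -> complex.Re (g x%:C) = m x by move=> /Dseg/gm ->.
  have m0 x : seg x -> (0 <= m x)%R.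
    by move=> sx; have Dx := Dseg _ sx; case: Fg => _ _ /(_ x Dx); rewrite gm // ler0c.
  pose c := ((r * T) ^+ (2 * N))%R.
  have c0 : (0 <= c)%R by rewrite exprn_ge0 // mulr_ge0 // ltW.
  have low x : (seg `\` B) x -> (c <= m x)%R.
    move=> [sx nB]; apply: mlow => //; first exact: Dseg.
    move=> j; apply: sep_le (sep_admissible admD hL (X1 j) (proj1 (segE x) sx)).
    apply: tanh_half_mono; rewrite ler_wpM2r ?invr_ge0 ?(ltW d0) //.
    rewrite ler_wpM2l ?mulr_ge0 ?(ltW L0) // leNgt; apply/negP => h; apply: nB.
    rewrite /B (bigD1 j) //=; left; rewrite /= in_itv /=.
    by move: h; rewrite ltr_norml => /andP[h1 h2]; apply/andP; split; lra.
  apply: le_trans (_ : \int[alpha]_(x in seg) (complex.Re (g x%:C))%:E <= _); last first.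
    by apply: le_trans (lee_abs _) _; apply: ereal_sup_ubound; exists g.
  apply: le_trans (_ : \int[alpha]_(x in seg `\` B) (complex.Re (g x%:C))%:E <= _); last first.
    apply: ge0_subset_integral => //; first exact: measurable_seg.
    by move=> x sx /=; rewrite lee_fin gx // m0.
  apply: le_trans (_ : \int[alpha]_(x in seg `\` B) cst c%:E x <= _); last first.
    apply: ge0_le_integral => //.
    - by apply: measurable_funS mE => //; exact: measurable_seg.
    - by move=> x sB /=; rewrite lee_fin gx ?low //; case: sB.
  rewrite integral_cst // mulrA -exprMn -/c EFinM.
  by apply: lee_wpmul2l.
case: (J_plus_XK alpha D X K) key => [b| |] key.
- rewrite lee_fin; apply: (@le_of_mulX_lt1 _ b (2 * N)).
    by rewrite mulr_ge0 // exprn_ge0.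
  by move=> r r0 r1; have := key r r0 r1; rewrite lee_fin.
- exact: leey.
- have [h0 h1] : (0 < (1 / 2 : R))%R /\ ((1 / 2 : R) < 1)%R by split; lra.
  by have := key _ h0 h1; rewrite leeNy_eq.
Qed.

Lemma J_plus_le D (N : nat) : admissible D -> (0 < N)%N -> J_plus alpha D N <= alpha seg.
Proof.
move=> admD N0; apply: le_trans (@J_plus_XK_le D 1 (fun=> 0%R) (fun=> N) admD).
apply: ereal_inf_lbound; exists 1%N, (fun=> 0%R), (fun=> N); split=> //; split=> //.
- by move=> j; rewrite lerN10 ler01.
- by move=> i j; rewrite !ord1.
- by rewrite big_ord1.
Qed.

Lemma lower_bound_le D (L : R) (N : nat) : admissible D ->
  (L = 1 / 4 \/ (L = 1 / 2 /\ convex_set D))%R ->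
  lower_bound alpha D N L <= J_plus alpha D N.
Proof.
by move=> admD hL; apply: ub_ereal_sup => _ [e /= e0 <-]; exact: J_plus_ge.
Qed.

(** The epsilon-delta form of absolute continuity, read off from the variation of the
charge attached to [alpha]. *)
Lemma absolutely_continuous_small (c : R) : alpha `<< @lebesgue_measure R -> (0 < c)%R ->
  exists2 d : R, (0 < d)%R & forall A, measurable A ->
    lebesgue_measure A < d%:E -> alpha A < c%:E.
Proof.
move=> ac c0; pose nu := charge_of_finite_measure alpha.
have [P [N nuPN]] := Hahn_decomposition nu.
have [d [d0 hd]] := @charge_variation_continuous _ _ R nu P N nuPN lebesgue_measure ac c c0.
exists d => // A mA lA; apply: le_lt_trans (hd A mA lA).
by apply: le_trans (abse_charge_variation nuPN mA); exact: lee_abs.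
Qed.

(** [1 - tanh_half u = 2 / (exp u + 1)] and [exp u >= 1 + u]. *)
Lemma tanh_half_ge_sub (u t : R) : (0 < t)%R -> (2 / t <= u)%R -> (1 - t <= tanh_half u)%R.
Proof.
move=> t0 tu; have E0 := expR_gt0 u; have E1 := expR_ge1Dx u.
rewrite /tanh_half ler_pdivlMr ?tanh_half_den //.
have h : (t * (2 / t) <= t * u)%R by rewrite ler_pM2l.
have h2 : (t * (2 / t) = 2)%R by rewrite mulrC divfK // gt_eqF.
have h3 : (t * (1 + u) <= t * expR u)%R by rewrite ler_pM2l.
lra.
Qed.

(** [e] is chosen by absolute continuity to make [omega] at most [eta / 3]; then [t], by
Bernoulli's inequality, so that [(1 - t) ^+ (2 * N)] costs at most [eta / 3] of the
mass; and [delta0] so that [tanh_half] exceeds [1 - t]. *)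
Lemma J_plus_limit (N : nat) (eta : R) : alpha `<< @lebesgue_measure R -> (0 < N)%N ->
  (0 < eta)%R -> exists delta0 : R, (0 < delta0)%R /\
    forall D, admissible D -> (deltaD D < delta0)%R ->
      `| J_plus alpha D N - alpha seg | < eta%:E.
Proof.
move=> ac N0 eta0.
have eta3 : (0 < eta / 3)%R by rewrite divr_gt0.
have [d d0 hd] := absolutely_continuous_small ac eta3.
have NR : (0 < N%:R :> R)%R by rewrite ltr0n.
(* 2 N e = d / 2 < d *)
pose e := (d / (4 * N%:R))%R.
have e0 : (0 < e)%R by rewrite divr_gt0 // mulr_gt0.
have fA : alpha seg \is a fin_num by apply: fin_num_measure; exact: measurable_seg.
set w := omega (2 * N%:R * e) alpha.
have e2 : (2 * N%:R * e = d / 2)%R by rewrite /e; field; rewrite gt_eqF.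
have wle : w <= (eta / 3)%:E.
  apply: ub_ereal_sup => _ [A [mA _ lA] <-]; apply/ltW/hd => //.
  by apply: le_lt_trans lA _; rewrite lte_fin e2; lra.
have w0 : 0 <= w by apply: omega_ge0; rewrite e2; lra.
have fw : w \is a fin_num by rewrite ge0_fin_numE // (le_lt_trans wle) // ltry.
pose a := fine (alpha seg); pose v := fine w.
have aE : alpha seg = a%:E by rewrite /a fineK.
have wE : w = v%:E by rewrite /v fineK.
have a0 : (0 <= a)%R by rewrite fine_ge0.
have v0 : (0 <= v)%R by rewrite fine_ge0.
have va : (v <= a)%R by rewrite fine_le // omega_le.
have v3 : (v <= eta / 3)%R by rewrite -lee_fin -wE.
have den : (0 < 2 * N%:R * (a + 1) * 3 + eta)%R.
  by rewrite addr_gt0 // !mulr_gt0 // ltr_wpDl.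
pose t := (eta / (2 * N%:R * (a + 1) * 3 + eta))%R.
have t0 : (0 < t)%R by rewrite divr_gt0.
have t1 : (t <= 1)%R.
  by rewrite ler_pdivrMr // mul1r lerDr !mulr_ge0 // ?addr_ge0 // ltW.
have ta : ((2 * N)%:R * t * a <= eta / 3)%R.
  have h : (t * (2 * N%:R * (a + 1) * 3 + eta) = eta)%R by rewrite divfK // gt_eqF.
  have p1 : (0 <= N%:R * t)%R by rewrite mulr_ge0 // ltW.
  have p2 : (0 <= t * eta)%R by rewrite mulr_ge0 // ltW.
  have h3 : (2 * (N%:R * t * a) * 3 + 6 * (N%:R * t) + t * eta = eta)%R by rewrite -{2}h; ring.
  rewrite natrM -mulrA -mulrA; move: h3; rewrite -[(N%:R * t * a)%R]mulrA.
  by move: (N%:R * (t * a))%R => q h3; lra.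
(* with L = 1/4 the argument of tanh_half is e / (2 deltaD), which must be at least 2 / t *)
pose delta0 := (e * t / 4)%R.
exists delta0; split; first by rewrite divr_gt0 // mulr_gt0.
move=> D admD dD; have [dp _] := deltaD_facts admD.
have := @J_plus_ge D _ _ N admD (or_introl erefl) e0.
rewrite -/w aE wE -EFinB -EFinM => low.
have := J_plus_le admD N0; rewrite aE => up.
set T := tanh_half _ in low.
have Tt : (1 - t <= T)%R.
  apply: tanh_half_ge_sub => //; rewrite ler_pdivlMr // mulrAC ler_pdivrMr //.
  by move: dD; rewrite /delta0; lra.
have T2 : (1 - (2 * N)%:R * t <= T ^+ (2 * N))%R.
  apply: le_trans (bernoulli_sub (2 * N) (ltW t0) t1) _.
  by rewrite lerXn2r // ?nnegrE ?subr_ge0 // (le_trans _ Tt) // subr_ge0.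
have fin : (a - eta < T ^+ (2 * N) * (a - v))%R.
  have av : (0 <= a - v)%R by rewrite subr_ge0.
  apply: lt_le_trans (_ : (1 - (2 * N)%:R * t) * (a - v) <= _)%R; last by rewrite ler_wpM2r.
  have : ((2 * N)%:R * t * (a - v) <= (2 * N)%:R * t * a)%R.
    by apply: ler_wpM2l; [rewrite mulr_ge0 // ltW | rewrite gerBl].
  by lra.
case: (J_plus alpha D N) low up => [b| |]; rewrite ?lee_fin // => low up.
by rewrite -EFinB abse_EFin lte_fin ltr_norml; apply/andP; split; lra.
Qed.
End Measure.
End Final.

Theorem theorem14 (R : realType)
    (alpha : {finite_measure set (measurableTypeR R) -> \bar R})
    (alpha_supp : alpha (~` @segment11 R) = 0%E)
    (alpha_ac : alpha `<< @lebesgue_measure R)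
    (N : nat) (N_gt0 : (0 < N)%N) :
  (forall D : set R[i], admissible D ->
     (lower_bound alpha D N (1 / 4) <= J_plus alpha D N)%E /\
     (convex_set D -> (lower_bound alpha D N (1 / 2) <= J_plus alpha D N)%E)) /\
  (forall eta : R, 0 < eta -> exists delta0 : R, 0 < delta0 /\
     forall D : set R[i], admissible D -> deltaD D < delta0 ->
       (`| J_plus alpha D N - alpha (@segment11 R) | < eta%:E)%E).
Proof.
split; last by move=> eta; exact: J_plus_limit.
move=> D admD; split=> [|cD]; apply: lower_bound_le => //; first by left.
by right; split.
Qed.
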